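(* Let $(M,\pi_M)$ be a holomorphic Poisson manifold. If $(M,\pi_M)$ is not symplectic (i.e. its bivector field is not invertible at every point), then $(M,\pi_M)$ does not admit a connected symplectic resolution.
   Context: Manifolds are Hausdorff and paracompact. A symplectic manifold is a Poisson manifold whose bivector field is invertible at every point. A symplectic resolution of a holomorphic Poisson manifold $(M,\pi_M)$ of complex dimension $n$ is a triple $(\Sigma,\Pi_\Sigma,\varphi)$ where $(\Sigma,\Pi_\Sigma)$ is a holomorphic symplectic manifold of the same complex dimension $n$ and $\varphi:\Sigma\to M$ is a surjective holomorphic Poisson morphism, i.e. $\{\varphi^*F,\varphi^*G\}_\Sigma=\varphi^*\{F,G\}_M$ for all local holomorphic functions $F,G$ on $M$ ($\varphi$ is not required to be a submersion). It is connected if $\Sigma$ is connected. *)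

(* Defs.v *)
From HB Require Import structures.
From mathcomp Require Import all_boot all_order all_algebra.
From mathcomp Require Import ring.
From mathcomp Require Import all_classical all_reals all_analysis.

Set Implicit Arguments.
Unset Strict Implicit.
Unset Printing Implicit Defensive.

Import Order.TTheory GRing.Theory Num.Theory.
Import numFieldNormedType.Exports.

Local Open Scope classical_set_scope.
Local Open Scope ring_scope.

(* Throughout, [C] stands for the field of complex numbers: everything is meant
   to be used at [C := R[i]] with [R : realType], where [differentiable] is
   complex differentiability.  [C] is kept abstract because unification with the
   normed structures of [C] and ['rV[C]_n] diverges on the concrete [R[i]]. *)
Notation Cn C n := 'rV[C]_n (only parsing).

(* Only used for open [U]. *)
Definition holomorphic (C : numClosedFieldType) (n : nat) (W : normedModType C)
    (U : set (Cn C n)) (f : Cn C n -> W) : Prop :=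
  forall x, U x -> differentiable f x.

Definition partial (C : numClosedFieldType) (n : nat) (k : 'I_n)
    (f : Cn C n -> C) (x : Cn C n) : C :=
  'D_(delta_mx 0 k) f x.

Definition locally_finite (T : topologicalType) (D : set (set T)) : Prop :=
  forall x : T, exists2 N, nbhs x N &
    finite_set [set B | D B /\ B `&` N !=set0].

Definition paracompact (T : topologicalType) : Prop :=
  forall U : set (set T),
    (forall A, U A -> open A) -> \bigcup_(A in U) A = [set: T] ->
  exists D : set (set T),
    [/\ (forall B, D B -> open B), \bigcup_(B in D) B = [set: T],
        (forall B, D B -> exists2 A, U A & B `<=` A) & locally_finite D].

(* A homeomorphism [chart_map] from the open set [chart_dom] of [T] onto the
   open set [chart_cod] of C^n, with inverse [chart_inv]; the values of the two
   total functions outside of these open sets are irrelevant. *)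
Record chart (C : numClosedFieldType) (n : nat) (T : topologicalType) := Chart {
  chart_dom : set T;
  chart_cod : set (Cn C n);
  chart_map : T -> Cn C n;
  chart_inv : Cn C n -> T;
  chart_dom_open : open chart_dom;
  chart_cod_open : open chart_cod;
  chart_map_cod : forall p, chart_dom p -> chart_cod (chart_map p);
  chart_inv_dom : forall x, chart_cod x -> chart_dom (chart_inv x);
  chart_mapK : forall p, chart_dom p -> chart_inv (chart_map p) = p;
  chart_invK : forall x, chart_cod x -> chart_map (chart_inv x) = x;
  chart_map_cont : {within chart_dom, continuous chart_map};
  chart_inv_cont : {within chart_cod, continuous chart_inv}
}.

Definition transition (C : numClosedFieldType) (n : nat) (T : topologicalType)
    (e e' : chart C n T) : Cn C n -> Cn C n :=
  chart_map e' \o chart_inv e.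

Definition transition_dom (C : numClosedFieldType) (n : nat) (T : topologicalType)
    (e e' : chart C n T) : set (Cn C n) :=
  chart_cod e `&` chart_inv e @^-1` chart_dom e'.

Record complexManifold (C : numClosedFieldType) (n : nat) := ComplexManifold {
  mcarrier :> topologicalType;
  atlas : set (chart C n mcarrier);
  mfd_hausdorff : hausdorff_space mcarrier;
  mfd_paracompact : paracompact mcarrier;
  atlas_cover : forall p, exists e, atlas e /\ chart_dom e p;
  atlas_compat : forall e e', atlas e -> atlas e' ->
    holomorphic (transition_dom e e') (transition e e')
}.

Definition chart_at (C : numClosedFieldType) (n : nat) (M : complexManifold C n) (p : M) :
    chart C n M :=
  projT1 (cid (atlas_cover p)).

(* Local holomorphic functions: a function on an open set [V] of [M] is given
   by a total function, whose values outside of [V] are irrelevant. *)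
Definition holomorphic_fun (C : numClosedFieldType) (n : nat) (M : complexManifold C n)
    (V : set M) (F : M -> C) : Prop :=
  forall e, atlas e ->
    holomorphic (chart_cod e `&` chart_inv e @^-1` V) (F \o chart_inv e).

Definition holomorphic_map (C : numClosedFieldType) (m n : nat)
    (S : complexManifold C m) (M : complexManifold C n) (phi : S -> M) : Prop :=
  continuous phi /\
  forall e e', atlas e -> atlas e' ->
    holomorphic (chart_cod e `&` (phi \o chart_inv e) @^-1` chart_dom e')
      (chart_map e' \o phi \o chart_inv e).

(* A holomorphic bivector field sum_{k,l} (1/2) b_kl d_k /\ d_l, given by its
   skew-symmetric matrix (b_kl) in each chart.  MathComp's Jacobian matrix
   ['J f x] acts on row vectors on the right: its (k, a) entry is d_k f_a. *)
Record bivectorField (C : numClosedFieldType) (n : nat) (M : complexManifold C n) :=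
  BivectorField {
  bivec :> chart C n M -> M -> 'M[C]_n;
  bivec_skew : forall e p, atlas e -> chart_dom e p ->
    (bivec e p)^T = - bivec e p;
  bivec_hol : forall e, atlas e -> forall k l : 'I_n,
    holomorphic (chart_cod e)
      ((fun x => bivec e (chart_inv e x) k l) : Cn C n -> C);
  bivec_transition : forall e e' p, atlas e -> atlas e' ->
    chart_dom e p -> chart_dom e' p ->
    bivec e' p = ('J (transition e e') (chart_map e p))^T
                   *m bivec e p *m 'J (transition e e') (chart_map e p)
}.

Definition bracket_in (C : numClosedFieldType) (n : nat) (M : complexManifold C n)
    (b : bivectorField M) (e : chart C n M) (F G : M -> C) (p : M) : C :=
  \sum_(k < n) \sum_(l < n)
     b e p k l * partial k (F \o chart_inv e) (chart_map e p)
               * partial l (G \o chart_inv e) (chart_map e p).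

(* [chart_at p] may be replaced by any chart around [p], see [bracketE]. *)
Definition bracket (C : numClosedFieldType) (n : nat) (M : complexManifold C n)
    (b : bivectorField M) (F G : M -> C) (p : M) : C :=
  bracket_in b (chart_at p) F G p.

Lemma partial_comp (C : numClosedFieldType) (n : nat) (k : 'I_n) (g : Cn C n -> C)
    (t : Cn C n -> Cn C n) (x : Cn C n) :
  differentiable t x -> differentiable g (t x) ->
  partial k (g \o t) x = \sum_(a < n) 'J t x k a * partial a g (t x).
Proof.
move=> dt dg; rewrite /partial deriveE; last exact: differentiable_comp.
rewrite diff_comp //= -(mul_rV_lin1 ('d t x)) -rowE.
rewrite [row k _]row_sum_delta linear_sum /=; apply: eq_bigr => a _.
by rewrite linearZ /= mxE deriveE.
Qed.

Lemma chart_inv_near (C : numClosedFieldType) (n : nat) (T : topologicalType)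
    (e : chart C n T) (p : T) (V : set T) : chart_dom e p -> open V -> V p ->
  \forall y \near chart_map e p, chart_cod e y /\ V (chart_inv e y).
Proof.
move=> ep oV Vp; have cx := chart_map_cod ep.
have oc : nbhs (chart_map e p) (chart_cod e).
  by apply: open_nbhs_nbhs; split => //; exact: chart_cod_open.
apply: filterI => //.
have := @chart_inv_cont _ _ _ e; rewrite continuous_open_subspace; last exact: chart_cod_open.
move=> /(_ _ (mem_set cx)); apply.
by apply: open_nbhs_nbhs; split => //; rewrite chart_mapK.
Qed.

Lemma bracket_inE (C : numClosedFieldType) (n : nat) (M : complexManifold C n)
    (b : bivectorField M) (e e' : chart C n M) (V : set M) (F G : M -> C)
    (p : M) :
  atlas e -> atlas e' -> chart_dom e p -> chart_dom e' p -> open V -> V p ->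
  holomorphic_fun V F -> holomorphic_fun V G ->
  bracket_in b e F G p = bracket_in b e' F G p.
Proof.
move=> ae ae' ep ep' oV Vp hF hG; rewrite /bracket_in.
set x := chart_map e p; set t := transition e e'.
have tx : t x = chart_map e' p by rewrite /t /transition /= chart_mapK.
have dt : differentiable t x.
  by apply: (atlas_compat ae ae'); split; [exact: chart_map_cod|rewrite /= chart_mapK].
have step H k : holomorphic_fun V H -> partial k (H \o chart_inv e) x
   = \sum_(a < n) 'J t x k a * partial a (H \o chart_inv e') (chart_map e' p).
  move=> hH; rewrite -tx -partial_comp //; last first.
    rewrite tx; apply: hH => //; split; first exact: chart_map_cod.
    by rewrite /= chart_mapK.
  apply: near_eq_derive.
  have := chart_inv_near ep (chart_dom_open e') ep'.
  by apply: filterS => y [cy dy]; rewrite /t /transition /= chart_mapK.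
rewrite (bivec_transition b ae ae' ep ep') -/t -/x.
under eq_bigr => k _ do under eq_bigr => l _ do
  rewrite (step F k hF) (step G l hG).
set J := 'J t x; set B := b e p.
set f := fun a => partial a (F \o chart_inv e') (chart_map e' p).
set g := fun a => partial a (G \o chart_inv e') (chart_map e' p).
have -> : \sum_(k < n) \sum_(l < n)
    B k l * (\sum_(a < n) J k a * f a) * (\sum_(a < n) J l a * g a)
  = \sum_(k < n) \sum_(l < n) \sum_(a < n) \sum_(c < n)
      J k a * B k l * J l c * f a * g c.
  apply: eq_bigr => k _; apply: eq_bigr => l _.
  rewrite -mulrA mulr_suml mulr_sumr; apply: eq_bigr => a _.
  rewrite !mulr_sumr; apply: eq_bigr => c _; ring.
have -> : \sum_(k < n) \sum_(l < n) ((J^T *m B *m J) k l * f k * g l)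
  = \sum_(a < n) \sum_(c < n) \sum_(l < n) \sum_(k < n)
      J k a * B k l * J l c * f a * g c.
  apply: eq_bigr => a _; apply: eq_bigr => c _.
  rewrite mxE !mulr_suml; apply: eq_bigr => l _.
  rewrite mxE !mulr_suml; apply: eq_bigr => k _.
  by rewrite mxE.
rewrite exchange_big /=.
under eq_bigr => l _ do rewrite exchange_big /=.
rewrite exchange_big /=; apply: eq_bigr => a _.
under eq_bigr => l _ do rewrite exchange_big /=.
by rewrite exchange_big.
Qed.

Lemma bracketE (C : numClosedFieldType) (n : nat) (M : complexManifold C n)
    (b : bivectorField M) (e : chart C n M) (V : set M) (F G : M -> C)
    (p : M) :
  atlas e -> chart_dom e p -> open V -> V p ->
  holomorphic_fun V F -> holomorphic_fun V G ->
  bracket b F G p = bracket_in b e F G p.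
Proof.
move=> ae ep oV Vp hF hG; rewrite /bracket /chart_at.
case: cid => e' [ae' e'p] /=; exact: bracket_inE hF hG.
Qed.

Record poissonManifold (C : numClosedFieldType) (n : nat) := PoissonManifold {
  pmfd :> complexManifold C n;
  pbivec : bivectorField pmfd;
  jacobi_identity : forall (V : set pmfd) (F G H : pmfd -> C), open V ->
    holomorphic_fun V F -> holomorphic_fun V G -> holomorphic_fun V H ->
    forall p, V p ->
      bracket pbivec F (bracket pbivec G H) p
      + bracket pbivec G (bracket pbivec H F) p
      + bracket pbivec H (bracket pbivec F G) p = 0
}.

Definition invertible_at (C : numClosedFieldType) (n : nat) (M : complexManifold C n)
    (b : bivectorField M) (p : M) : Prop :=
  forall e, atlas e -> chart_dom e p -> b e p \in unitmx.

Definition symplectic (C : numClosedFieldType) (n : nat) (M : poissonManifold C n) :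
    Prop :=
  forall p, invertible_at (pbivec M) p.

Definition poisson_morphism (C : numClosedFieldType) (m n : nat)
    (S : poissonManifold C m) (M : poissonManifold C n) (phi : S -> M) : Prop :=
  holomorphic_map phi /\
  forall (V : set M) (F G : M -> C), open V ->
    holomorphic_fun V F -> holomorphic_fun V G ->
    forall p, V (phi p) ->
      bracket (pbivec S) (F \o phi) (G \o phi) p
      = bracket (pbivec M) F G (phi p).

Record symplecticResolution (C : numClosedFieldType) (n : nat)
    (M : poissonManifold C n) := SymplecticResolution {
  res_mfd : poissonManifold C n;
  res_map : res_mfd -> M;
  res_symplectic : symplectic res_mfd;
  res_surj : forall q, exists p, res_map p = q;
  res_poisson : poisson_morphism res_map
}.

Definition connected_resolution (C : numClosedFieldType) (n : nat)
    (M : poissonManifold C n) (S : symplecticResolution M) : Prop :=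
  connected [set: res_mfd S].

(* Main.v *)
From HB Require Import structures.
Require Import Defs.
From mathcomp Require Import all_boot all_order all_algebra.
From mathcomp Require Import perm ring lra.
From mathcomp Require Import all_classical all_reals all_analysis.
From mathcomp Require Import complex.

Set Implicit Arguments.
Unset Strict Implicit.
Unset Printing Implicit Defensive.

Import Order.TTheory GRing.Theory Num.Theory.
Import numFieldNormedType.Exports.

Local Open Scope classical_set_scope.
Local Open Scope ring_scope.

(** Let [phi : S -> M] be a symplectic resolution with [S] connected, and suppose
    that the bivector [P] of [M] is degenerate at some point.  Read in charts, the
    Poisson property says [P (phi x) = J^T * Q x * J], where [J] is the Jacobian
    matrix of [phi] and [Q] is the invertible bivector of [S] ([rep_bivec]).  Hence
    [F x = \det (P (phi x))] equals [(\det J)^2 * \det Q], so that [phi] is singular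
    exactly over the degenerate points ([rep_det_singular]).

    Suppose first that [F] vanishes on a nonempty open set.  By the identity theorem
    the interior of the zero set of [F] is closed ([interior_sing_closed]), so by
    connectedness [F] vanishes everywhere and [phi] is everywhere singular.  A Sard
    argument ([sard_count], [singular_local]) shows that [phi] maps small open sets
    to nowhere dense sets.  As a connected paracompact manifold has a countable atlas
    ([countable_atlas]), the image of [phi] is meagre in the charts of [M], which
    contradicts surjectivity by Baire's theorem ([baire]).

    Otherwise every zero of [F] has a finite order of vanishing.  The Jacobi identity
    makes the degeneracy divisor Poisson: [{x_i, \det P} = 2 (div X_i) \det P] for the
    Hamiltonian field [X_i] of a coordinate [x_i] ([ham_det]).  Pulled back to [S],
    this says that the Hamiltonian fields of the functions [x_i o phi], which are the
    rows of [J^T * Q], map [F] to multiples of [F]; therefore they annihilate, along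
    the points where [F] vanishes to order [k], all derivatives of [F] of order less
    than [k] ([ord_transport], [tangent_kernel]).  Near a zero of order exactly [k]
    the points of order [k] lie in a smooth hypersurface [G = 0], [G] being a
    derivative of [F] of order [k - 1] with [dG <> 0].  The vector field [Q dG]
    is tangent to that hypersurface because [Q] is skew, and it is killed by [d phi].
    So [phi] restricted to a hypersurface of dimension [n - 1] has a kernel, its rank
    is at most [n - 2], and the sum of the image of the stratum with any fixed complex
    disc is again nowhere dense ([kernel_direction], [strata_local]).  On the other
    hand the zero set of [\det P] is a hypersurface of [M]: if [\det P] does not
    vanish identically on the line through a zero [y0] in the direction [v], then for
    all [y] near [y0] the disc [y + t v] meets the zero set ([root_persist]).  Since
    [phi] is surjective, the countably many nowhere dense sums above cover a
    neighbourhood of [y0], which contradicts Baire's theorem again.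

    The complex analysis is derived from Green's theorem on a rectangle, proved by
    bisection as in Goursat's lemma ([green]).  Applied to circles that shrink to a
    point of the disc, it yields Cauchy's formula ([cauchy]); the geometric series
    then gives power series with explicit remainders and Cauchy estimates
    ([series_bound], [coef_bound]), and from these Taylor expansions, holomorphy of
    directional derivatives, their commutation, the identity theorem and the
    persistence of roots. *)

(** * The complex modulus as a real number *)

(** The field [C] is only assumed to be of the form [R + i R], which is what
    allows its modulus, and the norms over it, to be compared in [R]. *)
Record complexification (R : realType) (C : numClosedFieldType) := Complexification {
  ofR :> {rmorphism R -> C};
  ofR_le : {mono ofR : x y / x <= y};
  ofR_rect : forall z, exists a b, z = ofR a + 'i * ofR b
}.

Section Modulus.
Variables (R : realType) (C : numClosedFieldType) (io : complexification R C).
Implicit Types (x y : R) (z w : C).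

Lemma ofR_lt : {mono io : x y / x < y}.
Proof. exact: leW_mono (ofR_le io). Qed.

Lemma ofR_real x : io x \is Num.real.
Proof. by rewrite realE -[0](rmorph0 io) !ofR_le -realE num_real. Qed.

Lemma re_subproof z : exists a, io a = 'Re z.
Proof.
by have [a [b ->]] := ofR_rect io z; exists a; rewrite Re_rect ?ofR_real.
Qed.

Lemma im_subproof z : exists a, io a = 'Im z.
Proof.
by have [a [b ->]] := ofR_rect io z; exists b; rewrite Im_rect ?ofR_real.
Qed.

Definition re z : R := projT1 (cid (re_subproof z)).
Definition im z : R := projT1 (cid (im_subproof z)).
Definition nm z : R := re `|z|.

Lemma reE z : io (re z) = 'Re z. Proof. by rewrite /re; case: cid. Qed.
Lemma imE z : io (im z) = 'Im z. Proof. by rewrite /im; case: cid. Qed.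
Lemma nmE z : io (nm z) = `|z|.
Proof. by rewrite reE; apply/Creal_ReP; rewrite normr_real. Qed.

Lemma rectE z : z = io (re z) + 'i * io (im z).
Proof. by rewrite reE imE -Crect. Qed.

Lemma ofR_inj : injective io. Proof. exact: fmorph_inj. Qed.

Lemma nm_ofR x : nm (io x) = `|x|.
Proof.
apply: ofR_inj; rewrite nmE; case: (ger0P x) => [x0|/ltW x0].
  by rewrite ger0_norm // -[0](rmorph0 io) ofR_le.
by rewrite ler0_norm ?rmorphN // -[0](rmorph0 io) ofR_le.
Qed.

Lemma nm_ge0 z : 0 <= nm z.
Proof. by rewrite -(ofR_le io) nmE rmorph0. Qed.

Lemma nm0 : nm 0 = 0. Proof. by apply: ofR_inj; rewrite nmE normr0 rmorph0. Qed.
Lemma nm1 : nm 1 = 1. Proof. by apply: ofR_inj; rewrite nmE normr1 rmorph1. Qed.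
Lemma nmi : nm 'i = 1. Proof. by apply: ofR_inj; rewrite nmE normCi rmorph1. Qed.
Lemma nmN z : nm (- z) = nm z. Proof. by rewrite /nm normrN. Qed.
Lemma nm_distC z w : nm (z - w) = nm (w - z). Proof. by rewrite -nmN opprB. Qed.
Lemma nmM z w : nm (z * w) = nm z * nm w.
Proof. by apply: ofR_inj; rewrite rmorphM !nmE normrM. Qed.
Lemma nmX z n : nm (z ^+ n) = nm z ^+ n.
Proof. by apply: ofR_inj; rewrite rmorphXn !nmE normrX. Qed.
Lemma nmV z : nm z^-1 = (nm z)^-1.
Proof. by apply: ofR_inj; rewrite fmorphV !nmE normfV. Qed.
Lemma nmD z w : nm (z + w) <= nm z + nm w.
Proof. by rewrite -(ofR_le io) rmorphD !nmE ler_normD. Qed.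
Lemma nmB z w : nm (z - w) <= nm z + nm w.
Proof. by rewrite -(nmN w) nmD. Qed.
Lemma nm_eq0 z : (nm z == 0) = (z == 0).
Proof. by rewrite -(inj_eq ofR_inj) nmE rmorph0 normr_eq0. Qed.
Lemma nm_gt0 z : (0 < nm z) = (z != 0).
Proof. by rewrite lt_def nm_ge0 nm_eq0 andbT. Qed.
Lemma nm_lt z w : (`|z| < `|w|) = (nm z < nm w).
Proof. by rewrite -!nmE ofR_lt. Qed.

Lemma re_is_additive : additive re.
Proof. by move=> z w; apply: ofR_inj; rewrite rmorphB !reE raddfB. Qed.
HB.instance Definition _ := GRing.isAdditive.Build C R re re_is_additive.
Lemma im_is_additive : additive im.
Proof. by move=> z w; apply: ofR_inj; rewrite rmorphB !imE raddfB. Qed.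
HB.instance Definition _ := GRing.isAdditive.Build C R im im_is_additive.

Lemma re_rect x y : re (io x + 'i * io y) = x.
Proof. by apply: ofR_inj; rewrite reE Re_rect ?ofR_real. Qed.
Lemma im_rect x y : im (io x + 'i * io y) = y.
Proof. by apply: ofR_inj; rewrite imE Im_rect ?ofR_real. Qed.

Lemma re_ofRM x z : re (io x * z) = x * re z.
Proof.
by rewrite {1}(rectE z) mulrDr mulrCA -!rmorphM re_rect.
Qed.
Lemma im_ofRM x z : im (io x * z) = x * im z.
Proof.
by rewrite {1}(rectE z) mulrDr mulrCA -!rmorphM im_rect.
Qed.
Lemma re_iM z : re ('i * z) = - im z.
Proof.
rewrite {1}(rectE z) mulrDr mulrA -expr2 sqrCi mulN1r addrC -rmorphN.
by rewrite re_rect.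
Qed.
Lemma im_iM z : im ('i * z) = re z.
Proof.
rewrite {1}(rectE z) mulrDr mulrA -expr2 sqrCi mulN1r addrC -rmorphN.
by rewrite im_rect.
Qed.

Lemma nm2 z : nm z ^+ 2 = re z ^+ 2 + im z ^+ 2.
Proof.
by apply: ofR_inj; rewrite rmorphD !rmorphXn nmE reE imE normC2_Re_Im.
Qed.

Lemma re_le z : `|re z| <= nm z.
Proof.
rewrite -(@ler_pXn2r _ 2) ?nnegrE ?nm_ge0 // nm2 real_normK ?num_real //.
by rewrite lerDl sqr_ge0.
Qed.
Lemma im_le z : `|im z| <= nm z.
Proof.
rewrite -(@ler_pXn2r _ 2) ?nnegrE ?nm_ge0 // nm2 real_normK ?num_real //.
by rewrite lerDr sqr_ge0.
Qed.
Lemma nm_le_reim z : nm z <= `|re z| + `|im z|.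
Proof.
rewrite {1}(rectE z); apply: (le_trans (nmD _ _)).
by rewrite nmM nmi mul1r !nm_ofR.
Qed.

End Modulus.

(** * Integrals of continuous functions on a segment *)
Section Rint.
Variable R : realType.
Notation mu := lebesgue_measure.

Definition rint (a b : R) (f : R -> R) : R := \int[mu]_(x in `[a, b]) f x.

Definition rseg_cont (a b : R) (f : R -> R) := {within `[a, b], continuous f}.

Lemma rseg_cont_integrable a b f : rseg_cont a b f ->
  mu.-integrable `[a, b] (EFin \o f).
Proof. by move=> cf; apply: continuous_compact_integrable => //; exact: segment_compact. Qed.

Lemma rintD a b f g : rseg_cont a b f -> rseg_cont a b g ->
  rint a b (fun t => f t + g t) = rint a b f + rint a b g.
Proof. by move=> cf cg; rewrite /rint RintegralD //; exact: rseg_cont_integrable. Qed.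

Lemma rintZ a b k f : rseg_cont a b f ->
  rint a b (fun t => k * f t) = k * rint a b f.
Proof. by move=> cf; rewrite /rint RintegralZl //; exact: rseg_cont_integrable. Qed.

Lemma rint_cst a b k : a <= b -> rint a b (fun=> k) = k * (b - a).
Proof.
move=> ab; rewrite /rint Rintegral_cst //= lebesgue_measure_itv /= lte_fin.
by move: ab; rewrite le_eqVlt => /predU1P[->|->] //=; rewrite subrr ltxx.
Qed.

Lemma rint_split a m b f : a <= m -> m <= b -> rseg_cont a b f ->
  rint a b f = rint a m f + rint m b f.
Proof.
move=> am mb cf; have If := rseg_cont_integrable cf.
have := @Rintegral_itvB R f (BLeft a) (BRight b) m If.
rewrite !bnd_simp => /(_ am mb).
rewrite Rintegral_itv_obnd_cbnd; last first.
  by apply: integrableS If => //=; apply: subset_itv; rewrite ?bnd_simp.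
by move=> /eqP; rewrite subr_eq addrC => /eqP.
Qed.

Lemma rint_norm a b f M : a <= b -> rseg_cont a b f ->
  (forall t, a <= t <= b -> `|f t| <= M) -> `|rint a b f| <= M * (b - a).
Proof.
move=> ab cf fM; have If := rseg_cont_integrable cf.
have Ic k : mu.-integrable `[a, b] (EFin \o (fun=> k : R)).
  by apply: rseg_cont_integrable => x; exact: cvg_cst.
rewrite ler_norml -mulNr -!rint_cst //; apply/andP; split.
  apply: le_Rintegral => //; try exact: (Ic (- M)).
  move=> t /=; rewrite in_itv /= => /fM; rewrite ler_norml => /andP[] //.
apply: le_Rintegral => //; try exact: (Ic M).
by move=> t /=; rewrite in_itv /= => /fM; rewrite ler_norml => /andP[] //.
Qed.

End Rint.

(** * Vanishing of local subadditive functions of rectangles *)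

(** Goursat's bisection argument: a nonnegative function [J] of rectangles which is
    subadditive under cutting and negligible compared with the squared size of
    small rectangles has to vanish. *)
Section RectVanish.
Variables (R : realType) (J : R -> R -> R -> R -> R) (a b c d : R).
Hypotheses (ab : a <= b) (cd : c <= d) (J0 : forall s1 s2 t1 t2, 0 <= J s1 s2 t1 t2).
Hypothesis Js : forall s1 m s2 t1 t2, a <= s1 -> s1 <= m -> m <= s2 -> s2 <= b ->
  c <= t1 -> t1 <= t2 -> t2 <= d -> J s1 s2 t1 t2 <= J s1 m t1 t2 + J m s2 t1 t2.
Hypothesis Jt : forall s1 s2 t1 m t2, a <= s1 -> s1 <= s2 -> s2 <= b ->
  c <= t1 -> t1 <= m -> m <= t2 -> t2 <= d -> J s1 s2 t1 t2 <= J s1 s2 t1 m + J s1 s2 m t2.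
Hypothesis Jloc : forall s0 t0, a <= s0 <= b -> c <= t0 <= d -> forall e, 0 < e ->
  exists2 del, 0 < del & forall s1 s2 t1 t2, a <= s1 -> s1 <= s0 -> s0 <= s2 -> s2 <= b ->
   c <= t1 -> t1 <= t0 -> t0 <= t2 -> t2 <= d -> s2 - s1 < del -> t2 - t1 < del ->
   J s1 s2 t1 t2 <= e * ((s2 - s1) + (t2 - t1)) ^+ 2.

Let rect := (R * R * (R * R))%type.
Let good (r : rect) := [/\ a <= r.1.1, r.1.1 <= r.1.2, r.1.2 <= b,
  c <= r.2.1 & r.2.1 <= r.2.2 /\ r.2.2 <= d].
Let JJ (r : rect) := J r.1.1 r.1.2 r.2.1 r.2.2.
Let quarter (r r' : rect) := [/\ r.1.1 <= r'.1.1, r'.1.2 <= r.1.2,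
  r.2.1 <= r'.2.1, r'.2.2 <= r.2.2 &
  [/\ r'.1.2 - r'.1.1 = (r.1.2 - r.1.1) / 2, r'.2.2 - r'.2.1 = (r.2.2 - r.2.1) / 2,
   good r' & JJ r / 4 <= JJ r']].

(** Cut both sides in half: one of the four pieces carries at least a quarter of
    the value of [J]. *)
Lemma quarter_ex r : good r -> exists r', quarter r r'.
Proof.
case: r => [[s1 s2] [t1 t2]]; rewrite /good /quarter /JJ /= => -[h1 h2 h3 h4 [h5 h6]].
pose ms := (s1 + s2) / 2; pose mt := (t1 + t2) / 2.
have [m1 m2] : s1 <= ms /\ ms <= s2 by rewrite /ms; split; lra.
have [m3 m4] : t1 <= mt /\ mt <= t2 by rewrite /mt; split; lra.
have K1 := Js h1 m1 m2 h3 h4 h5 h6.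
have K2 : J s1 ms t1 t2 <= J s1 ms t1 mt + J s1 ms mt t2 by apply: Jt => //; lra.
have K3 : J ms s2 t1 t2 <= J ms s2 t1 mt + J ms s2 mt t2 by apply: Jt => //; lra.
set j := J s1 s2 t1 t2 in K1 *.
have [L1|L1] := lerP (j / 4) (J s1 ms t1 mt).
  by exists ((s1, ms), (t1, mt)) => /=; rewrite /ms /mt in m1 m2 m3 m4 L1 *; repeat split => //=; lra.
have [L2|L2] := lerP (j / 4) (J s1 ms mt t2).
  by exists ((s1, ms), (mt, t2)) => /=; rewrite /ms /mt in m1 m2 m3 m4 L2 *; repeat split => //=; lra.
have [L3|L3] := lerP (j / 4) (J ms s2 t1 mt).
  by exists ((ms, s2), (t1, mt)) => /=; rewrite /ms /mt in m1 m2 m3 m4 L3 *; repeat split => //=; lra.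
have [L4|L4] := lerP (j / 4) (J ms s2 mt t2).
  by exists ((ms, s2), (mt, t2)) => /=; rewrite /ms /mt in m1 m2 m3 m4 L4 *; repeat split => //=; lra.
by exfalso; lra.
Qed.

Let next (r : rect) : rect :=
  if pselect (exists r', quarter r r') is left h then projT1 (cid h) else r.
Let seqr n := iter n next ((a, b), (c, d)).

Lemma next_quarter r : good r -> quarter r (next r).
Proof.
move=> gr; rewrite /next; case: pselect => [h|]; first by case: cid.
by move/(_ (quarter_ex gr)).
Qed.

Lemma seqr_good n : good (seqr n).
Proof.
elim: n => [|n /next_quarter]; first by rewrite /good.
by rewrite /seqr iterS; case=> _ _ _ _ [].
Qed.

Lemma seqr_quarter n : quarter (seqr n) (seqr n.+1).
Proof. by rewrite /seqr iterS; apply: next_quarter; exact: seqr_good. Qed.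

Lemma seqr_w n : [/\ (seqr n).1.2 - (seqr n).1.1 = (b - a) / 2 ^+ n,
  (seqr n).2.2 - (seqr n).2.1 = (d - c) / 2 ^+ n & J a b c d / 4 ^+ n <= JJ (seqr n)].
Proof.
elim: n => [|n [h1 h2 h3]]; first by rewrite !expr0 !divr1.
have [_ _ _ _ [-> -> _ h]] := seqr_quarter n.
rewrite h1 h2 !exprSr !invfM !mulrA; split => //.
by apply: le_trans h; rewrite ler_pM2r ?invr_gt0.
Qed.

Lemma seqr_mono n k : [/\ (seqr n).1.1 <= (seqr (n + k)).1.1,
  (seqr (n + k)).1.2 <= (seqr n).1.2, (seqr n).2.1 <= (seqr (n + k)).2.1 &
  (seqr (n + k)).2.2 <= (seqr n).2.2].
Proof.
elim: k => [|k [h1 h2 h3 h4]]; first by rewrite addn0.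
rewrite addnS; have [g1 g2 g3 g4 _] := seqr_quarter (n + k).
by split; [apply: le_trans h1 _|apply: le_trans h2|apply: le_trans h3 _|apply: le_trans h4].
Qed.

Lemma seqr_ineq n m : (seqr n).1.1 <= (seqr m).1.2 /\ (seqr n).2.1 <= (seqr m).2.2.
Proof.
have [a1 _ a3 _] := seqr_mono n m; have [_ b2 _ b4] := seqr_mono m n.
have [_ c2 _ _ [c3 _]] := seqr_good (n + m); rewrite addnC in b2 b4.
by split; [apply: le_trans a1 (le_trans c2 b2)|apply: le_trans a3 (le_trans c3 b4)].
Qed.

Lemma nested_point (l u : nat -> R) : (forall n m, l n <= u m) ->
  exists x, forall n, l n <= x <= u n.
Proof.
move=> lu; exists (sup (range l)) => n.
have ub m : ubound (range l) (u m) by move=> _ [k _ <-].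
apply/andP; split.
  by apply: ub_le_sup; [exists (u 0%N); exact: ub|exists n].
by apply: ge_sup; [exists (l 0%N), 0%N|exact: ub].
Qed.

Lemma rect_vanish : J a b c d = 0.
Proof.
have [/eqP//|Jn0] := boolP (J a b c d == 0).
have Jp : 0 < J a b c d by rewrite lt_def Jn0 J0.
have [s0 hs] := nested_point (fun n m => (seqr_ineq n m).1).
have [t0 ht] := nested_point (fun n m => (seqr_ineq n m).2).
pose W := (b - a) + (d - c) + 1.
have W0 : 0 < W by rewrite /W; move: ab cd; lra.
(* The n-th rectangle has size at most W / 2^n and value at least
   J a b c d / 4^n; this precision bounds its value by half of that. *)
have e0 : 0 < J a b c d / (2 * W ^+ 2) by rewrite divr_gt0 // mulr_gt0 // exprn_gt0.
have [del del0 H] := Jloc (hs 0%N) (ht 0%N) e0.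
have [n hn] : exists n : nat, W / 2 ^+ n < del.
  have h : 0 <= W / del by rewrite divr_ge0 // ltW.
  exists (Num.bound (W / del)); rewrite ltr_pdivrMr ?exprn_gt0 // -ltr_pdivrMl //.
  rewrite mulrC; apply: (lt_trans (archi_boundP h)).
  by rewrite -natrX ltr_nat ltn_expl.
have [w1 w2 w3] := seqr_w n.
have [g1 g2 g3 g4 [g5 g6]] := seqr_good n.
have /andP[hs1 hs2] := hs n; have /andP[ht1 ht2] := ht n.
have p2 : 0 < 2 ^+ n :> R by rewrite exprn_gt0.
have lt1 : (b - a) / 2 ^+ n < del.
  by apply: le_lt_trans hn; rewrite ler_pM2r ?invr_gt0 // /W; move: ab cd; lra.
have lt2 : (d - c) / 2 ^+ n < del.
  by apply: le_lt_trans hn; rewrite ler_pM2r ?invr_gt0 // /W; move: ab cd; lra.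
have := H _ _ _ _ g1 hs1 hs2 g3 g4 ht1 ht2 g6.
rewrite w1 w2 => /(_ lt1 lt2) K.
have E (x : R) : (x / 2 ^+ n) ^+ 2 = x ^+ 2 / 4 ^+ n.
  by rewrite expr_div_n -exprM mulnC exprM (_ : 2 ^+ 2 = 4 :> R) //; ring.
have := le_trans w3 K; rewrite -mulrDl E mulrA ler_pM2r ?invr_gt0 ?exprn_gt0 // => K'.
have XW : ((b - a) + (d - c)) ^+ 2 <= W ^+ 2.
  by rewrite ler_pXn2r ?nnegrE /W //; move: ab cd; lra.
have := ler_wpM2l (ltW e0) XW.
have -> : J a b c d / (2 * W ^+ 2) * W ^+ 2 = J a b c d / 2.
  by field; rewrite gt_eqF.
by move=> /(le_trans K'); lra.
Qed.

End RectVanish.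

(** * Integrals of complex functions on a segment *)
Section CInt.
Variables (R : realType) (C : numClosedFieldType) (io : complexification R C).
Notation re := (re io).
Notation im := (im io).
Notation nm := (nm io).

(** Continuity on [[a, b]] in terms of the real modulus, so that real and imaginary
    parts inherit it directly. *)
Definition seg_cont (a b : R) (h : R -> C) := forall t, a <= t <= b ->
  forall e : R, 0 < e -> exists2 d : R, 0 < d &
  forall t', a <= t' <= b -> `|t' - t| < d -> nm (h t' - h t) <= e.

Lemma seg_cont_sub a b a' b' h : a <= a' -> b' <= b -> seg_cont a b h -> seg_cont a' b' h.
Proof.
move=> aa bb ch t /andP[t1 t2] e e0.
have ht : a <= t <= b by rewrite (le_trans aa) // (le_trans t2).
have [d d0 H] := ch t ht e e0; exists d => // t' /andP[t1' t2'].
by apply: H; rewrite (le_trans aa) // (le_trans t2').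
Qed.

Lemma seg_cont_rseg_cont a b h (g : {additive C -> R}) : (forall z, `|g z| <= nm z) ->
  seg_cont a b h -> rseg_cont a b (g \o h).
Proof.
move=> gn ch; apply/subspace_continuousP => x /=; rewrite in_itv /= => xab.
apply/cvgrPdist_le => e e0; have [d d0 H] := ch x xab e e0.
rewrite /prop_near1 /within /=; exists d => //= t xt.
rewrite in_itv /= => tab; rewrite -raddfB; apply: (le_trans (gn _)).
by rewrite nm_distC; apply: H => //; rewrite distrC.
Qed.

Lemma seg_cont_re a b h : seg_cont a b h -> rseg_cont a b (re \o h).
Proof. exact: seg_cont_rseg_cont (re_le io). Qed.
Lemma seg_cont_im a b h : seg_cont a b h -> rseg_cont a b (im \o h).
Proof. exact: seg_cont_rseg_cont (im_le io). Qed.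

Lemma seg_contD a b h k : seg_cont a b h -> seg_cont a b k -> seg_cont a b (fun t => h t + k t).
Proof.
move=> ch ck t tab e e0; have e2 : 0 < e / 2 by rewrite divr_gt0.
have [d1 d10 H1] := ch t tab _ e2; have [d2 d20 H2] := ck t tab _ e2.
exists (Num.min d1 d2); first by rewrite lt_min d10.
move=> t' t'ab; rewrite lt_min => /andP[/H1 -/(_ t'ab) K1 /H2 -/(_ t'ab) K2].
rewrite [X in nm X](_ : _ = (h t' - h t) + (k t' - k t)); last by ring.
by apply: (le_trans (nmD _ _ _)); lra.
Qed.

Lemma seg_contZ a b c h : seg_cont a b h -> seg_cont a b (fun t => c * h t).
Proof.
move=> ch t tab e e0; have c0 : 0 < nm c + 1 by rewrite ltr_wpDl ?nm_ge0.
have [d d0 H] := ch t tab (e / (nm c + 1)) (divr_gt0 e0 c0).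
exists d => // t' t'ab /(H _ t'ab) K; rewrite -mulrBr nmM.
apply: (@le_trans _ _ ((nm c + 1) * nm (h t' - h t))).
  by apply: ler_wpM2r; rewrite ?nm_ge0 // lerDl.
by rewrite mulrC -ler_pdivlMr.
Qed.

Lemma seg_contB a b h k : seg_cont a b h -> seg_cont a b k -> seg_cont a b (fun t => h t - k t).
Proof.
move=> ch ck; have := seg_contD ch (@seg_contZ _ _ (-1) _ ck).
by congr seg_cont; apply/funext => t; rewrite mulN1r.
Qed.

Lemma seg_cont_cst a b c : seg_cont a b (fun=> c).
Proof. by move=> t _ e e0; exists 1 => // t' _ _; rewrite subrr nm0 ltW. Qed.

Definition cint a b (h : R -> C) : C :=
  io (rint a b (re \o h)) + 'i * io (rint a b (im \o h)).

Lemma cintD a b h k : seg_cont a b h -> seg_cont a b k ->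
  cint a b (fun t => h t + k t) = cint a b h + cint a b k.
Proof.
move=> ch ck; rewrite /cint.
rewrite [X in rint a b X](_ : _ = fun t => (re \o h) t + (re \o k) t); last first.
  by apply/funext => t /=; rewrite raddfD.
rewrite [X in _ + 'i * io (rint a b X)](_ : _ = fun t => (im \o h) t + (im \o k) t); last first.
  by apply/funext => t /=; rewrite raddfD.
rewrite !rintD; try exact: seg_cont_re; try exact: seg_cont_im.
by rewrite !rmorphD /=; ring.
Qed.

Lemma cintR a b (x : R) h : seg_cont a b h -> cint a b (fun t => io x * h t) = io x * cint a b h.
Proof.
move=> ch; rewrite /cint.
rewrite [X in rint a b X](_ : _ = fun t => x * (re \o h) t); last first.
  by apply/funext => t /=; rewrite re_ofRM.
rewrite [X in _ + 'i * io (rint a b X)](_ : _ = fun t => x * (im \o h) t); last first.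
  by apply/funext => t /=; rewrite im_ofRM.
rewrite !rintZ; try exact: seg_cont_re; try exact: seg_cont_im.
by rewrite !rmorphM /=; ring.
Qed.

Lemma cinti a b h : seg_cont a b h -> cint a b (fun t => 'i * h t) = 'i * cint a b h.
Proof.
move=> ch; rewrite /cint.
rewrite [X in rint a b X](_ : _ = fun t => -1 * (im \o h) t); last first.
  by apply/funext => t /=; rewrite re_iM mulN1r.
rewrite [X in _ + 'i * io (rint a b X)](_ : _ = re \o h); last first.
  by apply/funext => t /=; rewrite im_iM.
rewrite rintZ; last exact: seg_cont_im.
rewrite mulN1r rmorphN mulrDr mulrA -expr2 sqrCi /=; ring.
Qed.

Lemma cintZ a b c h : seg_cont a b h -> cint a b (fun t => c * h t) = c * cint a b h.
Proof.
move=> ch.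
rewrite (_ : (fun t => _) = fun t => io (re c) * h t + 'i * (io (im c) * h t)); last first.
  by apply/funext => t; rewrite {1}(rectE io c) mulrDl mulrA.
rewrite cintD ?cinti ?cintR //; try by repeat apply: seg_contZ.
by rewrite [in RHS](rectE io c); ring.
Qed.

Lemma cintB a b h k : seg_cont a b h -> seg_cont a b k ->
  cint a b (fun t => h t - k t) = cint a b h - cint a b k.
Proof.
move=> ch ck; rewrite -(mulN1r (cint a b k)) -cintZ // -cintD //; last exact: seg_contZ.
by congr cint; apply/funext => t; rewrite mulN1r.
Qed.

Lemma cint_split a m b h : a <= m -> m <= b -> seg_cont a b h ->
  cint a b h = cint a m h + cint m b h.
Proof.
move=> am mb ch; rewrite /cint !(rint_split am mb); try exact: seg_cont_re; try exact: seg_cont_im.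
by rewrite !rmorphD /=; ring.
Qed.

(** Estimating the real and the imaginary part separately costs the factor [2],
    which is harmless since only orders of magnitude matter later. *)
Lemma cint_norm a b h M : a <= b -> seg_cont a b h ->
  (forall t, a <= t <= b -> nm (h t) <= M) -> nm (cint a b h) <= 2 * M * (b - a).
Proof.
move=> ab ch hM; rewrite /cint; apply: (le_trans (nmD _ _ _)).
rewrite nmM nmi mul1r !nm_ofR -mulrA mulr_natl mulr2n; apply: lerD; apply: rint_norm => //.
- exact: seg_cont_re.
- by move=> t /hM; apply: le_trans; exact: re_le.
- exact: seg_cont_im.
- by move=> t /hM; apply: le_trans; exact: im_le.
Qed.

Lemma cint_cst a b c : a <= b -> cint a b (fun=> c) = c * io (b - a).
Proof.
move=> ab; rewrite /cint /= !rint_cst // !rmorphM /= [in RHS](rectE io c); ring.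
Qed.

Lemma cint_conj a b h : seg_cont a b h -> cint a b (fun t => (h t)^*) = (cint a b h)^*.
Proof.
move=> ch; have rc z : re z^* = re z.
  by apply: (ofR_inj (io := io)); rewrite !reE Re_conj.
have ic z : im z^* = - im z.
  by apply: (ofR_inj (io := io)); rewrite rmorphN !imE Im_conj.
rewrite /cint rmorphD rmorphM /= conjCi !(CrealP _) ?ofR_real //.
rewrite [X in rint a b X](_ : _ = re \o h); last first.
  by apply/funext => t /=; rewrite rc.
rewrite [X in _ + 'i * io (rint a b X)](_ : _ = fun t => -1 * (im \o h) t); last first.
  by apply/funext => t /=; rewrite ic mulN1r.
rewrite rintZ; last exact: seg_cont_im.
by rewrite mulN1r rmorphN mulrN mulNr.
Qed.

End CInt.

(** * Green's theorem on a rectangle *)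
Section Green.
Variables (R : realType) (C : numClosedFieldType) (io : complexification R C).
Notation nm := (nm io).
Notation seg_cont := (seg_cont io).
Notation cint := (cint io).

(** Total differentiability of [u] at the point [(s0, t0)], with partial derivatives [us]
    and [ut]: the information that complex differentiability gives as long as
    holomorphic functions are not known to be smooth. *)
Definition expands (u : R -> R -> C) (s0 t0 : R) (us ut : C) :=
  forall e : R, 0 < e -> exists2 d : R, 0 < d & forall s t,
   `|s - s0| < d -> `|t - t0| < d ->
   nm (u s t - u s0 t0 - us * io (s - s0) - ut * io (t - t0))
     <= e * (`|s - s0| + `|t - t0|).

Lemma expands_cont u s0 t0 us ut : expands u s0 t0 us ut ->
  forall e : R, 0 < e -> exists2 d : R, 0 < d & forall s t,
   `|s - s0| < d -> `|t - t0| < d -> nm (u s t - u s0 t0) <= e.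
Proof.
move=> h e e0; have [d d0 H] := h 1 ltr01.
pose K := nm us + nm ut + 2; have K0 : 0 < K.
  by rewrite /K; have := nm_ge0 io us; have := nm_ge0 io ut; lra.
exists (Num.min d (e / K)); first by rewrite lt_min d0 divr_gt0.
move=> s t; rewrite !lt_min => /andP[s1 s2] /andP[t1 t2].
have := H s t s1 t1; set v := _ - _ - _ - _ => hv.
have -> : u s t - u s0 t0 = v + (us * io (s - s0) + ut * io (t - t0)).
  by rewrite /v; ring.
apply: (le_trans (nmD _ _ _)); have := nmD io (us * io (s - s0)) (ut * io (t - t0)).
rewrite !nmM !nm_ofR => h2.
have ns := nm_ge0 io us; have nt := nm_ge0 io ut.
have b1 : nm us * `|s - s0| <= nm us * (e / K) by rewrite ler_wpM2l // ltW.
have b2 : nm ut * `|t - t0| <= nm ut * (e / K) by rewrite ler_wpM2l // ltW.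
have : (nm us + nm ut + 2) * (e / K) = e by rewrite -/K mulrC divfK // gt_eqF.
by rewrite !mulrDl; lra.
Qed.

Variables (P Q : R -> R -> C) (a b c d : R).
Hypotheses (ab : a <= b) (cd : c <= d).
(* The common value k is the closedness of the form P ds + Q dt. *)
Hypothesis PQ : forall s0 t0, a <= s0 <= b -> c <= t0 <= d ->
  exists Ps k Qt, expands P s0 t0 Ps k /\ expands Q s0 t0 k Qt.

Lemma green_contP t : c <= t <= d -> seg_cont a b (P^~ t).
Proof.
move=> tcd s sab e e0; have [Ps [k [Qt [h _]]]] := PQ sab tcd.
have [del del0 H] := expands_cont h e0; exists del => // s' _ hs.
by apply: H; rewrite // subrr normr0.
Qed.

Lemma green_contQ s : a <= s <= b -> seg_cont c d (Q s).
Proof.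
move=> sab t tcd e e0; have [Ps [k [Qt [_ h]]]] := PQ sab tcd.
have [del del0 H] := expands_cont h e0; exists del => // t' _ ht.
by apply: H; rewrite // subrr normr0.
Qed.

Let J s1 s2 t1 t2 := cint s1 s2 (fun s => P s t1 - P s t2)
  + cint t1 t2 (fun t => Q s2 t - Q s1 t).

(** The boundary integral of a closed form is additive under cutting and [o(size^2)]
    on small rectangles, so the bisection argument applies to its modulus. *)
Lemma green : cint a b (fun s => P s c - P s d)
  + cint c d (fun t => Q b t - Q a t) = 0.
Proof.
have tr (x y z w v : R) : x <= y -> y <= z -> z <= v -> x <= y <= v.
  by move=> -> /= h1 h2; exact: le_trans h2.
have cP s1 s2 t : a <= s1 -> s2 <= b -> c <= t <= d -> seg_cont s1 s2 (P^~ t).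
  by move=> h1 h2 /green_contP; apply: seg_cont_sub.
have cQ t1 t2 s : c <= t1 -> t2 <= d -> a <= s <= b -> seg_cont t1 t2 (Q s).
  by move=> h1 h2 /green_contQ; apply: seg_cont_sub.
suff : nm (J a b c d) = 0 by move=> /eqP; rewrite nm_eq0 => /eqP.
apply: (rect_vanish (J := fun s1 s2 t1 t2 => nm (J s1 s2 t1 t2)) ab cd).
- by move=> *; exact: nm_ge0.
- move=> s1 m s2 t1 t2 h1 h2 h3 h4 h5 h6 h7.
  suff -> : J s1 s2 t1 t2 = J s1 m t1 t2 + J m s2 t1 t2 by exact: nmD.
  have ht1 : c <= t1 <= d by rewrite h5 /= (le_trans h6).
  have ht2 : c <= t2 <= d by rewrite h7 andbT (le_trans h5).
  have hs1 : a <= s1 <= b by rewrite h1 /= (le_trans h2) ?(le_trans h3).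
  have hs2 : a <= s2 <= b by rewrite h4 andbT (le_trans h1) ?(le_trans h2).
  have hm : a <= m <= b by rewrite (le_trans h1) ?(le_trans h3).
  rewrite /J (@cint_split _ _ _ s1 m s2) //; last by apply: seg_contB; apply: cP.
  rewrite !(@cintB _ _ _ t1 t2); try exact: cQ.
  by ring.
- move=> s1 s2 t1 m t2 h1 h2 h3 h4 h5 h6 h7.
  suff -> : J s1 s2 t1 t2 = J s1 s2 t1 m + J s1 s2 m t2 by exact: nmD.
  have ht1 : c <= t1 <= d by rewrite h4 /= (le_trans h5) ?(le_trans h6).
  have ht2 : c <= t2 <= d by rewrite h7 andbT (le_trans h4) ?(le_trans h5).
  have hs1 : a <= s1 <= b by rewrite h1 /= (le_trans h2).
  have hs2 : a <= s2 <= b by rewrite h3 andbT (le_trans h1).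
  have hm : c <= m <= d by rewrite (le_trans h4) ?(le_trans h6).
  rewrite /J (@cint_split _ _ _ t1 m t2) //; last by apply: seg_contB; apply: cQ.
  rewrite !(@cintB _ _ _ s1 s2); try exact: cP.
  by ring.
move=> s0 t0 hs0 ht0 e e0; have [Ps [k [Qt [HP HQ]]]] := PQ hs0 ht0.
have e8 : 0 < e / 8 by rewrite divr_gt0.
have [d1 d10 H1] := HP _ e8; have [d2 d20 H2] := HQ _ e8.
exists (Num.min d1 d2); first by rewrite lt_min d10.
move=> s1 s2 t1 t2 h1 h2 h3 h4 h5 h6 h7 h8; rewrite !lt_min => /andP[k1 k2] /andP[k3 k4].
have s12 : s1 <= s2 by apply: le_trans h3.
have t12 : t1 <= t2 by apply: le_trans h7.
have ht1 : c <= t1 <= d by rewrite h5 (le_trans t12).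
have ht2 : c <= t2 <= d by rewrite h8 (le_trans h5).
have hs1 : a <= s1 <= b by rewrite h1 (le_trans s12).
have hs2 : a <= s2 <= b by rewrite h4 (le_trans h1).
set W := (s2 - s1) + (t2 - t1).
have as1 s : s1 <= s -> s <= s2 -> `|s - s0| <= s2 - s1.
  by move=> *; rewrite ler_norml; lra.
have at1 t : t1 <= t -> t <= t2 -> `|t - t0| <= t2 - t1.
  by move=> *; rewrite ler_norml; lra.
have bd u us ut del : (forall s t, `|s - s0| < del -> `|t - t0| < del ->
    nm (u s t - u s0 t0 - us * io (s - s0) - ut * io (t - t0))
     <= e / 8 * (`|s - s0| + `|t - t0|)) -> s2 - s1 < del -> t2 - t1 < del ->
   forall s t, s1 <= s <= s2 -> t1 <= t <= t2 ->
    nm (u s t - u s0 t0 - us * io (s - s0) - ut * io (t - t0)) <= e / 8 * W.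
  move=> H l1 l2 s t /andP[m1 m2] /andP[m3 m4].
  have n1 := as1 _ m1 m2; have n2 := at1 _ m3 m4.
  apply: (le_trans (H _ _ _ _)); [exact: le_lt_trans l1|exact: le_lt_trans l2|].
  by rewrite ler_pM2l // /W lerD.
have B1 := bd _ _ _ _ H1 k1 k3; have B2 := bd _ _ _ _ H2 k2 k4.
(* The two constants subtracted here contribute k (t1 - t2) (s2 - s1) and its
   opposite: this is where closedness is used. *)
have -> : J s1 s2 t1 t2 =
   cint s1 s2 (fun s => P s t1 - P s t2 - k * io (t1 - t2)) +
   cint t1 t2 (fun t => Q s2 t - Q s1 t - k * io (s2 - s1)).
  have c1 : seg_cont s1 s2 (fun s => P s t1 - P s t2) by apply: seg_contB; exact: cP.
  have c2 : seg_cont t1 t2 (fun t => Q s2 t - Q s1 t) by apply: seg_contB; exact: cQ.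
  rewrite (cintB c1 (@seg_cont_cst _ _ io _ _ _)) (cintB c2 (@seg_cont_cst _ _ io _ _ _)).
  by rewrite !cint_cst // /J !rmorphB /=; ring.
apply: (le_trans (nmD _ _ _)).
have W0 : 0 <= W by rewrite /W; lra.
have E1 : nm (cint s1 s2 (fun s => P s t1 - P s t2 - k * io (t1 - t2))) <=
   2 * (e / 4 * W) * (s2 - s1).
  apply: cint_norm => //.
    by apply: seg_contB; [apply: seg_contB; exact: cP|exact: seg_cont_cst].
  move=> s hs; rewrite [X in nm X](_ : _ =
   (P s t1 - P s0 t0 - Ps * io (s - s0) - k * io (t1 - t0))
   - (P s t2 - P s0 t0 - Ps * io (s - s0) - k * io (t2 - t0))); last first.
    by rewrite !rmorphB /=; ring.
  apply: (le_trans (nmB _ _ _)).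
  have := B1 s t1 hs; have := B1 s t2 hs; rewrite !lexx t12 /=.
  by move=> /(_ isT) g1 /(_ isT) g2; apply: (le_trans (lerD g2 g1)); lra.
have E2 : nm (cint t1 t2 (fun t => Q s2 t - Q s1 t - k * io (s2 - s1))) <=
   2 * (e / 4 * W) * (t2 - t1).
  apply: cint_norm => //.
    by apply: seg_contB; [apply: seg_contB; exact: cQ|exact: seg_cont_cst].
  move=> t ht; rewrite [X in nm X](_ : _ =
   (Q s2 t - Q s0 t0 - k * io (s2 - s0) - Qt * io (t - t0))
   - (Q s1 t - Q s0 t0 - k * io (s1 - s0) - Qt * io (t - t0))); last first.
    by rewrite !rmorphB /=; ring.
  apply: (le_trans (nmB _ _ _)).
  have := B2 s1 t; have := B2 s2 t; rewrite !lexx s12 /= => /(_ isT ht) g1 /(_ isT ht) g2.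
  by apply: (le_trans (lerD g1 g2)); lra.
apply: (le_trans (lerD E1 E2)); rewrite -mulrDr -/W.
have : 0 <= e * W ^+ 2 by rewrite mulr_ge0 ?sqr_ge0 // ltW.
by rewrite expr2; lra.
Qed.

End Green.

(** * Means over the unit circle and Cauchy's kernel *)
Lemma derivable_eps (K : numFieldType) (f : K -> K) (z l : K) :
  is_derive z 1 f l -> forall e, 0 < e -> exists2 d, 0 < d &
  forall h, `|h| < d -> `|f (h + z) - f z - l * h| <= e * `|h|.
Proof.
case=> df dl e e0; have := derivable_nbhs df; rewrite dl.
move=> /eqaddoP /(_ e e0) /nbhs_ballP [d /= d0 H]; exists d => // h hd.
have /= := H h; rewrite /ball /= sub0r normrN => /(_ hd).
by rewrite !fctE /= /GRing.scale /= mulr1 opprD addrA (mulrC h).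
Qed.

Section Mean.
Variables (R : realType) (C : numClosedFieldType) (io : complexification R C).
Notation nm := (nm io).
Notation seg_cont := (seg_cont io).
Notation cint := (cint io).
Notation expands := (expands io).

Definition cdiff (f : C -> C) (z l : C) := forall e : R, 0 < e ->
  exists2 d : R, 0 < d & forall w, nm (w - z) < d ->
    nm (f w - f z - l * (w - z)) <= e * nm (w - z).

Definition ccont (h : C -> C) (z : C) := forall e : R, 0 < e ->
  exists2 d : R, 0 < d & forall w, nm (w - z) < d -> nm (h w - h z) <= e.

Lemma ofR_gt0 (e : R) : (0 < io e) = (0 < e).
Proof. by rewrite -[0 in LHS](rmorph0 io) ofR_lt. Qed.

Lemma gt0_nm (d : C) : 0 < d -> 0 < nm d.
Proof. by rewrite nm_gt0 => /gt_eqF ->. Qed.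

Lemma ball_nm (d h : C) : 0 < d -> (`|h| < d) = (nm h < nm d).
Proof. by move=> d0; rewrite -[d in LHS]gtr0_norm // (nm_lt io). Qed.

Lemma derive_cdiff (f : C -> C) (z l : C) : is_derive z 1 f l -> cdiff f z l.
Proof.
move=> df e e0; have [|d d0 H] := derivable_eps df (e := io e).
  by rewrite ofR_gt0.
exists (nm d); first exact: gt0_nm.
move=> w wd; have := H (w - z); rewrite subrK ball_nm // => /(_ wd).
by rewrite -(nmE io) -(nmE io (w - z)) -rmorphM ofR_le.
Qed.

Lemma cdiff_cont f z l : cdiff f z l -> ccont f z.
Proof.
move=> h e e0; have [d d0 H] := h 1 ltr01.
have K0 : 0 < nm l + 1 by rewrite ltr_wpDl ?nm_ge0.
exists (Num.min d (e / (nm l + 1))); first by rewrite lt_min d0 divr_gt0.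
move=> w; rewrite lt_min => /andP[w1 w2].
rewrite [X in nm X](_ : _ = (f w - f z - l * (w - z)) + l * (w - z)); last by ring.
apply: (le_trans (nmD _ _ _)); rewrite nmM.
apply: (le_trans (lerD (H w w1) (lexx _))); rewrite -mulrDl addrC.
by rewrite mulrC -ler_pdivlMr // ltW.
Qed.

Lemma expands_lip u s0 t0 us ut : expands u s0 t0 us ut ->
  exists2 d : R, 0 < d & forall s t, `|s - s0| < d -> `|t - t0| < d ->
   nm (u s t - u s0 t0) <= (nm us + nm ut + 1) * (`|s - s0| + `|t - t0|).
Proof.
move=> h; have [d d0 H] := h 1 ltr01; exists d => // s t hs ht.
have := H s t hs ht; set v := _ - _ - _ - _ => hv.
have -> : u s t - u s0 t0 = v + (us * io (s - s0) + ut * io (t - t0)).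
  by rewrite /v; ring.
apply: (le_trans (nmD _ _ _)); have := nmD io (us * io (s - s0)) (ut * io (t - t0)).
rewrite !nmM !nm_ofR => h2.
have ns := nm_ge0 io us; have nt := nm_ge0 io ut.
have : 0 <= nm us * `|t - t0| by rewrite mulr_ge0.
have : 0 <= nm ut * `|s - s0| by rewrite mulr_ge0.
by rewrite !mulrDl !mulrDr; lra.
Qed.

(** The chain rule, with a complex differentiable outer function. *)
Lemma expands_comp f w s0 t0 ws wt l : expands w s0 t0 ws wt ->
  cdiff f (w s0 t0) l -> expands (fun s t => f (w s t)) s0 t0 (l * ws) (l * wt).
Proof.
move=> hw hf e e0; have [d1 d10 H1] := expands_lip hw.
set K := nm ws + nm wt + 1 in H1.
have K0 : 0 < K by rewrite /K; have := nm_ge0 io ws; have := nm_ge0 io wt; lra.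
have L0 : 0 < nm l + 1 by have := nm_ge0 io l; lra.
have [d2 d20 H2] := hf (e / 2 / K) (divr_gt0 (divr_gt0 e0 (ltr0n _ 2)) K0).
have [d3 d30 H3] := expands_cont hw (divr_gt0 d20 (ltr0n _ 2)).
have [d4 d40 H4] := hw (e / 2 / (nm l + 1)) (divr_gt0 (divr_gt0 e0 (ltr0n _ 2)) L0).
exists (Num.min d1 (Num.min d3 d4)); first by rewrite !lt_min d10 d30.
move=> s t; rewrite !lt_min => /and3P[s1 s3 s4] /and3P[t1 t3 t4].
have lw : nm (w s t - w s0 t0) < d2.
  by apply: (le_lt_trans (H3 _ _ s3 t3)); lra.
have g1 := H1 _ _ s1 t1; have g2 := H2 _ lw; have g4 := H4 _ _ s4 t4.
set ds := s - s0 in g1 g4 *; set dt := t - t0 in g1 g4 *.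
rewrite [X in nm X](_ : _ = (f (w s t) - f (w s0 t0) - l * (w s t - w s0 t0))
  + l * (w s t - w s0 t0 - ws * io ds - wt * io dt)); last by ring.
apply: (le_trans (nmD _ _ _)); rewrite nmM.
have r0 : 0 <= `|ds| + `|dt| by rewrite addr_ge0.
have h1 : e / 2 / K * nm (w s t - w s0 t0) <= e / 2 * (`|ds| + `|dt|).
  rewrite -mulrA; apply: ler_wpM2l; first by rewrite divr_ge0 // ltW.
  by rewrite mulrC ler_pdivrMr // mulrC.
have h2 : nm l * nm (w s t - w s0 t0 - ws * io ds - wt * io dt)
    <= e / 2 * (`|ds| + `|dt|).
  apply: (@le_trans _ _ ((nm l + 1) * (e / 2 / (nm l + 1) * (`|ds| + `|dt|)))).
    by apply: ler_pM; rewrite ?nm_ge0 // lerDl.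
  by rewrite mulrA (mulrC (nm l + 1)) divfK // gt_eqF.
by apply: (le_trans (lerD (le_trans g2 h1) h2)); lra.
Qed.

Lemma expandsM u v s0 t0 us ut vs vt : expands u s0 t0 us ut ->
  expands v s0 t0 vs vt ->
  expands (fun s t => u s t * v s t) s0 t0 (us * v s0 t0 + u s0 t0 * vs)
   (ut * v s0 t0 + u s0 t0 * vt).
Proof.
move=> hu hv e e0.
set M := nm us + nm ut + nm (u s0 t0) + nm (v s0 t0) + 2.
have nn := (nm_ge0 io us, nm_ge0 io ut, nm_ge0 io (u s0 t0), nm_ge0 io (v s0 t0)).
case: nn => [[[n1 n2] n3] n4].
have M0 : 0 < M by rewrite /M; lra.
pose e1 := e / 3 / M; have e10 : 0 < e1 by rewrite !divr_gt0.
have eM : e1 * M = e / 3 by rewrite divfK // gt_eqF.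
have [d1 d10 H1] := hu _ e10; have [d2 d20 H2] := hv _ e10.
have m0 : 0 < Num.min 1 e1 by rewrite lt_min ltr01.
have [d3 d30 H3] := expands_cont hv m0.
exists (Num.min d1 (Num.min d2 d3)); first by rewrite !lt_min d10 d20.
move=> s t; rewrite !lt_min => /and3P[s1 s2 s3] /and3P[t1 t2 t3].
have g1 := H1 _ _ s1 t1; have g2 := H2 _ _ s2 t2; have := H3 _ _ s3 t3.
rewrite le_min => /andP[g3 g3'].
set ds := s - s0 in g1 g2 *; set dt := t - t0 in g1 g2 *.
set U := u s t in g1 *; set V := v s t in g2 g3 g3' *.
set U0 := u s0 t0 in g1 n3 *; set V0 := v s0 t0 in g2 g3 g3' n4 *.
rewrite [X in nm X](_ : _ = (U - U0 - us * io ds - ut * io dt) * V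
  + U0 * (V - V0 - vs * io ds - vt * io dt) + (us * io ds + ut * io dt) * (V - V0));
  last by ring.
apply: (le_trans (nmD _ _ _)); apply: (le_trans (lerD (nmD _ _ _) (lexx _))).
rewrite !nmM.
have r0 : 0 <= `|ds| + `|dt| by rewrite addr_ge0.
set r := `|ds| + `|dt| in g1 g2 r0 *.
have nV : nm V <= M.
  by have := nmD io (V - V0) V0; rewrite subrK /M -/U0 -/V0; lra.
have k1 : nm (U - U0 - us * io ds - ut * io dt) * nm V <= e1 * r * M.
  by apply: ler_pM; rewrite ?nm_ge0.
have k2 : nm U0 * nm (V - V0 - vs * io ds - vt * io dt) <= M * (e1 * r).
  by apply: ler_pM; rewrite ?nm_ge0 // /M -/U0 -/V0; lra.
have k3 : nm (us * io ds + ut * io dt) * nm (V - V0) <= M * r * e1.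
  apply: ler_pM; rewrite ?nm_ge0 //.
  apply: (le_trans (nmD _ _ _)); rewrite !nmM !nm_ofR.
  have a1 : nm us * `|ds| <= nm us * r by rewrite ler_wpM2l // lerDl.
  have a2 : nm ut * `|dt| <= nm ut * r by rewrite ler_wpM2l // lerDr.
  apply: (le_trans (lerD a1 a2)); rewrite -mulrDl ler_wpM2r //.
  by rewrite /M -/U0 -/V0; lra.
apply: (le_trans (lerD (lerD k1 k2) k3)).
rewrite (_ : _ + _ + _ = 3 * (e1 * M) * r); last by ring.
by rewrite eM (_ : 3 * (e / 3) = e) //; field.
Qed.

Lemma expands_s (g : R -> R) (s0 t0 l : R) : is_derive s0 1 g l ->
  expands (fun s _ => io (g s)) s0 t0 (io l) 0.
Proof.
move=> dg e e0; have [d d0 H] := derivable_eps dg e0; exists d => // s t hs _.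
rewrite mul0r subr0 -rmorphM -!rmorphB nm_ofR.
have := H _ hs; rewrite subrK => /le_trans; apply.
by rewrite ler_pM2l // lerDl.
Qed.

Lemma expands_t (g : R -> R) (s0 t0 l : R) : is_derive t0 1 g l ->
  expands (fun _ t => io (g t)) s0 t0 0 (io l).
Proof.
move=> dg e e0; have [d d0 H] := derivable_eps dg e0; exists d => // s t _ ht.
rewrite mul0r subr0 -rmorphM -!rmorphB nm_ofR.
have := H _ ht; rewrite subrK => /le_trans; apply.
by rewrite ler_pM2l // lerDr.
Qed.

Lemma expandsD u v s0 t0 us ut vs vt : expands u s0 t0 us ut ->
  expands v s0 t0 vs vt ->
  expands (fun s t => u s t + v s t) s0 t0 (us + vs) (ut + vt).
Proof.
move=> hu hv e e0; have e20 : 0 < e / 2 by rewrite divr_gt0.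
have [d1 d10 H1] := hu _ e20; have [d2 d20 H2] := hv _ e20.
exists (Num.min d1 d2); first by rewrite !lt_min d10 d20.
move=> s t; rewrite !lt_min => /andP[s1 s2] /andP[t1 t2].
have g1 := H1 _ _ s1 t1; have g2 := H2 _ _ s2 t2.
set ds := s - s0 in g1 g2 *; set dt := t - t0 in g1 g2 *.
rewrite [X in nm X](_ : _ = (u s t - u s0 t0 - us * io ds - ut * io dt) +
  (v s t - v s0 t0 - vs * io ds - vt * io dt)); last by ring.
by apply: (le_trans (nmD _ _ _)); lra.
Qed.

Lemma expands_cst (c : C) s0 t0 : expands (fun _ _ => c) s0 t0 0 0.
Proof.
move=> e e0; exists 1 => // s t _ _; rewrite !mul0r !subr0 subrr nm0.
by rewrite mulr_ge0 ?addr_ge0 // ltW.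
Qed.

Definition circle (t : R) : C := io (cos t) + 'i * io (sin t).

Lemma nm_circle t : nm (circle t) = 1.
Proof.
apply/eqP; rewrite -(@eqrXn2 _ 2) ?nm_ge0 // nm2 re_rect im_rect.
by rewrite cos2Dsin2 expr1n.
Qed.

Lemma expands_circle s0 t0 : expands (fun _ t => circle t) s0 t0 0 ('i * circle t0).
Proof.
have h1 := @expands_t cos s0 t0 _ (is_derive_cos t0).
have h2 := @expands_t sin s0 t0 _ (is_derive_sin t0).
have := expandsD h1 (expandsM (expands_cst 'i s0 t0) h2).
rewrite !(mul0r, mulr0, addr0, add0r).
suff -> : io (- sin t0) + 'i * io (cos t0) = 'i * circle t0 by [].
by rewrite /circle mulrDr mulrA -expr2 sqrCi rmorphN; ring.
Qed.

Lemma seg_cont_circle h : (forall z, nm z = 1 -> ccont h z) -> seg_cont 0 (2 * pi) (h \o circle).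
Proof.
move=> hc t _ e e0; have [d d0 H] := hc _ (nm_circle t) e e0.
have [d1 d10 H1] := expands_cont (expands_circle 0 t) (divr_gt0 d0 (ltr0n _ 2)).
exists d1 => // t' _ ht'; apply: H.
have := H1 0 t'; rewrite subrr normr0 => /(_ d10 ht') => h1.
by apply: le_lt_trans h1 _; lra.
Qed.

Definition cmean (h : C -> C) : C := io ((2 * pi)^-1) * cint 0 (2 * pi) (h \o circle).
Definition circ_cont (h : C -> C) := seg_cont 0 (2 * pi) (h \o circle).

Let pi20 : 0 < 2 * pi :> R. Proof. by rewrite mulr_gt0 // pi_gt0. Qed.

Lemma cmeanD h k : circ_cont h -> circ_cont k ->
  cmean (fun z => h z + k z) = cmean h + cmean k.
Proof.
move=> ch ck; by rewrite /cmean -mulrDr -(cintD ch ck).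
Qed.

Lemma cmeanZ c h : circ_cont h -> cmean (fun z => c * h z) = c * cmean h.
Proof.
by move=> ch; rewrite /cmean mulrCA -(cintZ _ ch).
Qed.

Lemma cmean_norm h M : circ_cont h -> (forall z, nm z = 1 -> nm (h z) <= M) ->
  nm (cmean h) <= 2 * M.
Proof.
move=> ch hM; rewrite /cmean nmM nm_ofR ger0_norm; last by rewrite invr_ge0 ltW.
rewrite ler_pdivrMl // [leRHS]mulrC.
have := @cint_norm _ _ io 0 (2 * pi) (h \o circle) M; rewrite subr0; apply => //.
- exact: ltW.
- by move=> t _; apply: hM; exact: nm_circle.
Qed.

Lemma cmean_cst c : cmean (fun=> c) = c.
Proof.
by rewrite /cmean /= (cint_cst io) ?ltW // subr0 mulrCA -rmorphM mulVf ?gt_eqF // rmorph1 mulr1.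
Qed.

(** The map [w] joins the unit circle, at [s = 0], to circles that shrink to the point
    [a] as [s] tends to minus infinity.  The form obtained by pulling back
    [f z / (z - a) dz] along it is closed, which gives Cauchy's theorem for this
    family of circles without any homotopy argument. *)
Section OffCentre.
Variables (f : C -> C) (a : C).
Hypothesis (a1 : nm a < 1).
Hypothesis fd : forall z, nm z <= 1 -> exists l, cdiff f z l.

Let w (s t : R) : C := a + io (expR s) * (circle t - a).
Let ka (t : R) : C := 'i * (circle t / (circle t - a)).

Lemma circle_neq t : circle t - a != 0.
Proof.
by rewrite subr_eq0; apply/eqP => e; move: a1; rewrite -e nm_circle ltxx.
Qed.

Lemma w_le1 s t : s <= 0 -> nm (w s t) <= 1.
Proof.
move=> s0; have E1 : expR s <= 1 by rewrite -expR0 ler_expR.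
have E0 := expR_gt0 s.
rewrite /w (_ : _ + _ = io (1 - expR s) * a + io (expR s) * circle t); last first.
  by rewrite rmorphB rmorph1; ring.
apply: (le_trans (nmD _ _ _)); rewrite !nmM !nm_ofR nm_circle mulr1.
rewrite !ger0_norm ?subr_ge0 //.
have : (1 - expR s) * nm a <= (1 - expR s) * 1.
  by rewrite ler_wpM2l ?subr_ge0 // ltW.
by lra.
Qed.

Lemma expands_w s0 t0 : expands w s0 t0 (io (expR s0) * (circle t0 - a))
   (io (expR s0) * ('i * circle t0)).
Proof.
have h1 := @expands_s expR s0 t0 _ (is_derive_expR s0).
have h2 := expandsD (expands_circle s0 t0) (expands_cst (- a) s0 t0).
have := expandsD (expands_cst a s0 t0) (expandsM h1 h2).
by rewrite !(mul0r, mulr0, addr0, add0r).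
Qed.

Lemma expands_ka s0 t0 : exists k, expands (fun _ => ka) s0 t0 0 k.
Proof.
have [l hl] : exists l, cdiff (fun z => z / (z - a)) (circle t0) l.
  have dv : derivable (fun z : C => z / (z - a)) (circle t0) 1.
    apply: derivableM => //; apply: derivableV; first exact: circle_neq.
    by apply: derivableB.
  exists ('D_1 (fun z : C => z / (z - a)) (circle t0)).
  by apply: derive_cdiff; exact/derivableP.
have := expandsM (expands_cst 'i s0 t0) (expands_comp (expands_circle s0 t0) hl).
by rewrite !(mul0r, mulr0, addr0, add0r) => h; eexists; exact: h.
Qed.

(** Green's theorem for [P = f o w] and [Q = (f o w) ka] on [[- L, 0] x [0, 2 pi]]; the two
    sides [t = 0] and [t = 2 pi] cancel by periodicity. *)
Lemma shrink_circle L : 0 <= L ->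
  seg_cont 0 (2 * pi) (fun t => f (w (- L) t) * ka t) /\
  cint 0 (2 * pi) (fun t => f (w 0 t) * ka t) =
  cint 0 (2 * pi) (fun t => f (w (- L) t) * ka t).
Proof.
move=> L0; pose P s t := f (w s t); pose Q s t := f (w s t) * ka t.
have PQ s0 t0 : - L <= s0 <= 0 -> 0 <= t0 <= 2 * pi ->
  exists Ps k Qt, expands P s0 t0 Ps k /\ expands Q s0 t0 k Qt.
  move=> /andP[_ s00] _; have [l hl] := fd (w_le1 t0 s00).
  have hP := expands_comp (expands_w s0 t0) hl.
  have [k hk] := expands_ka s0 t0.
  have := expandsM hP hk; rewrite mulr0 addr0.
  rewrite [X in expands _ _ _ X](_ : _ = l * (io (expR s0) * ('i * circle t0))) => [hQ|].
    by do 3 eexists; split; [exact: hP|exact: hQ].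
  by rewrite /ka; field; exact: circle_neq.
have LL : - L <= 0 by rewrite oppr_le0.
have := green LL (ltW pi20) PQ.
have -> : (fun s => P s 0 - P s (2 * pi)) = fun=> 0.
  apply/funext => s; rewrite /P /w /circle cos0 sin0.
  rewrite (_ : 2 * pi = pi *+ 2); last by rewrite mulr_natl.
  by rewrite cos2pi sin2pi subrr.
have c1 : seg_cont 0 (2 * pi) (Q 0) by apply: (green_contQ PQ); rewrite LL lexx.
have c2 : seg_cont 0 (2 * pi) (Q (- L)) by apply: (green_contQ PQ); rewrite LL lexx.
rewrite (cint_cst io _ LL) mul0r add0r (cintB c1 c2).
by move=> /eqP; rewrite subr_eq0 => /eqP.
Qed.

Lemma nm_small (X : C) (K : R) : (forall e, 0 < e -> nm X <= e * K) -> X = 0.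
Proof.
move=> h; apply/eqP; rewrite -(nm_eq0 io) eq_le nm_ge0 andbT leNgt; apply/negP => X0.
have K0 : 0 < `|K| + 1 by rewrite ltr_wpDl.
have e0 : 0 < nm X / 2 / (`|K| + 1) by rewrite !divr_gt0.
have := h _ e0; apply/negP; rewrite -ltNge.
apply: (@le_lt_trans _ _ (nm X / 2 / (`|K| + 1) * (`|K| + 1))).
  by rewrite ler_pM2l // (le_trans (ler_norm _)) // lerDl.
by rewrite divfK ?gt_eqF //; lra.
Qed.

Lemma circle_dist_ge t : 1 - nm a <= nm (circle t - a).
Proof. by have := nmD io (circle t - a) a; rewrite subrK nm_circle; lra. Qed.

Lemma circle_dist_le t : nm (circle t - a) <= 2.
Proof. by have := nmB io (circle t) a; rewrite nm_circle; move: a1; lra. Qed.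

Lemma near_centre e : 0 < e -> exists2 L, 0 <= L &
  forall t, nm (f (w (- L) t) - f a) <= e.
Proof.
move=> e0; have [l /cdiff_cont /(_ e e0) [d d0 H]] := fd (ltW a1).
exists (2 / d) => [|t]; first by rewrite divr_ge0 // ltW.
apply: H; rewrite /w addrC addKr nmM nm_ofR ger0_norm ?expR_ge0 //.
apply: (@le_lt_trans _ _ (expR (- (2 / d)) * 2)).
  by rewrite ler_wpM2l ?expR_ge0 // circle_dist_le.
rewrite expRN mulrC ltr_pdivrMr ?expR_gt0 // -ltr_pdivrMl // mulrC.
by apply: lt_le_trans (expR_ge1Dx _); rewrite ltrDr.
Qed.

(** On circles close to [a] the function [f] is almost constant, so that its
    integral against the kernel is almost [f a] times the integral of the kernel. *)
Lemma cint_kernel : cint 0 (2 * pi) (fun t => f (circle t) * ka t) = f a * cint 0 (2 * pi) ka.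
Proof.
have cka : seg_cont 0 (2 * pi) ka.
  move=> t _ e e0; have [k hk] := expands_ka 0 t.
  have [d d0 H] := expands_cont hk e0; exists d => // t' _ ht'.
  by apply: (H 0 t'); rewrite ?subrr ?normr0.
apply/eqP; rewrite -subr_eq0; apply/eqP.
apply: (@nm_small _ (2 * (1 - nm a)^-1 * (2 * pi))) => e e0.
have [L L0 HL] := near_centre e0; have [cL] := shrink_circle L0.
have -> : (fun t => f (w 0 t) * ka t) = (fun t => f (circle t) * ka t).
  by apply/funext => t; rewrite /w expR0 rmorph1 mul1r addrC subrK.
move=> ->; rewrite -cintZ // -cintB //; last exact: seg_contZ.
have := @cint_norm _ _ io 0 (2 * pi) (fun t => f (w (- L) t) * ka t - f a * ka t)
  (e * (1 - nm a)^-1); rewrite subr0 => h.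
apply: (le_trans (h _ _ _)); first exact: ltW.
- by apply: seg_contB => //; exact: seg_contZ.
- move=> t _; rewrite -mulrBl nmM; apply: ler_pM; rewrite ?nm_ge0 //.
  rewrite /ka nmM nmi mul1r nmM nm_circle mul1r nmV lef_pV2 ?circle_dist_ge // posrE.
    by rewrite nm_gt0 circle_neq.
  by rewrite subr_gt0.
by rewrite le_eqVlt; apply/orP; left; apply/eqP; ring.
Qed.

Lemma cmean_kernel : circ_cont (fun z => f z * (z / (z - a))) ->
  circ_cont (fun z => z / (z - a)) ->
  cmean (fun z => f z * (z / (z - a))) = f a * cmean (fun z => z / (z - a)).
Proof.
move=> c1 c2; rewrite /cmean mulrCA; congr (_ * _).
apply: (@mulfI _ 'i); first by rewrite neq0Ci.
rewrite mulrCA -(cintZ _ c1) -(cintZ _ c2) -[in RHS]cint_kernel.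
by congr cint; apply/funext => t /=; rewrite /ka; ring.
Qed.

End OffCentre.
End Mean.

(** * Cauchy's formula and power series in one variable *)
Section Series.
Variables (R : realType) (C : numClosedFieldType) (io : complexification R C).
Notation nm := (nm io).
Notation ccont := (ccont io).
Notation cdiff := (cdiff io).
Notation circ_cont := (circ_cont io).
Notation cmean := (cmean io).

Lemma continuous_ccont (h : C -> C) (z : C) : {for z, continuous h} -> ccont h z.
Proof.
move=> /cvgrPdist_le hc e e0; have e0' : 0 < io e by rewrite ofR_gt0.
have /nbhs_ballP [d /= d0 H] := hc _ e0'.
exists (nm d); first exact: gt0_nm.
move=> w; rewrite (nm_distC io w z) => wz; have := H w; rewrite /ball /= (ball_nm io _ d0) => H'; have {H'} := H' wz.
by rewrite distrC -(nmE io) ofR_le.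
Qed.

Lemma circ_continuous (h : C -> C) : (forall z, nm z = 1 -> {for z, continuous h}) ->
  circ_cont h.
Proof. by move=> H; apply: seg_cont_circle => z /H; exact: continuous_ccont. Qed.

Lemma cmean_ext h k : (forall z, nm z = 1 -> h z = k z) -> cmean h = cmean k.
Proof.
move=> hk; rewrite /cmean; congr (_ * cint _ _ _ _).
by apply/funext => t /=; apply: hk; exact: nm_circle.
Qed.

Definition holo_disc (r : R) (g : C -> C) := forall z : C, nm z <= r -> derivable g z 1.

Lemma nm1_neq0 (z : C) : nm z = 1 -> z != 0.
Proof. by move=> z1; rewrite -(nm_gt0 io) z1. Qed.

Lemma derivable_continuous (g : C -> C) (z : C) : derivable g z 1 ->
  {for z, continuous g}.
Proof. by move=> /derivable1_diffP /differentiable_continuous. Qed.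

Lemma holo_cdiff r g : holo_disc r g -> forall z, nm z <= r -> exists l, cdiff g z l.
Proof.
move=> hg z /hg dg; exists ('D_1 g z); apply: derive_cdiff; exact/derivableP.
Qed.

Lemma derivable_mul (f g : C -> C) (z : C) : derivable f z 1 -> derivable g z 1 ->
  derivable (fun w : C => f w * g w) z 1.
Proof. by move=> df dg; have := derivableM df dg. Qed.

Lemma derivable_div (c z : C) : z != 0 -> derivable (fun w : C => c / w) z 1.
Proof.
move=> z0; apply: derivable_mul; first exact: derivable_cst.
by apply: derivableV => //; exact: derivable_id.
Qed.

Lemma derivable_pow (f : C -> C) (z : C) k : derivable f z 1 ->
  derivable (fun w : C => f w ^+ k) z 1.
Proof.
move=> df; elim: k => [|k IH].
  have -> : (fun w => f w ^+ 0) = cst 1 by apply/funext => w; rewrite expr0.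
  exact: derivable_cst.
have -> : (fun w => f w ^+ k.+1) = (fun w => f w * f w ^+ k).
  by apply/funext => w; rewrite exprS.
exact: derivable_mul.
Qed.

Lemma derivable_divX (c z : C) k : z != 0 -> derivable (fun w : C => (c / w) ^+ k) z 1.
Proof.
by move=> z0; apply: derivable_pow; exact: derivable_div.
Qed.

Lemma derivable_invX (z : C) k : z != 0 -> derivable (fun w : C => w ^- k) z 1.
Proof.
have -> : (fun w : C => w ^- k) = (fun w => (1 / w) ^+ k).
  by apply/funext => w; rewrite div1r exprVn.
exact: derivable_divX.
Qed.

Lemma kernel_cont (a z : C) : nm a < 1 -> nm z = 1 ->
  {for z, continuous (fun w : C => w / (w - a))}.
Proof.
move=> a1 z1; have za : z - a != 0.
  by rewrite subr_eq0; apply/eqP => e; move: a1; rewrite -e z1 ltxx.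
apply: derivable_continuous; apply: derivableM => //; exact: derivableV.
Qed.

Lemma mean_value g : holo_disc 1 g -> cmean g = g 0.
Proof.
move=> hg; have h0 : nm 0 < 1 by rewrite nm0.
have gc z : nm z = 1 -> {for z, continuous g}.
  by move=> z1; apply: derivable_continuous; apply: hg; rewrite z1.
have := cmean_kernel h0 (holo_cdiff hg).
have e1 : cmean (fun z => z / (z - 0)) = 1.
  rewrite -[RHS](cmean_cst io); apply: cmean_ext => z /nm1_neq0 z0.
  by rewrite subr0 divff.
rewrite e1 mulr1 => <-.
- by apply: cmean_ext => z /nm1_neq0 z0; rewrite subr0 divff // mulr1.
- apply: circ_continuous => z z1; apply: continuousM; first exact: gc.
  exact: kernel_cont.
- apply: circ_continuous => z z1; exact: kernel_cont.
Qed.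

(** On the unit circle [z / (z - a)] is the conjugate of [1 / (1 - a^* z)], which is
    holomorphic on the disc; so its mean is the conjugate of the value of that
    function at [0]. *)
Lemma kernel_mean (a : C) : nm a < 1 -> cmean (fun z => z / (z - a)) = 1.
Proof.
move=> a1; have nJ (z : C) : nm z^* = nm z.
  by apply: (ofR_inj (io := io)); rewrite !nmE norm_conjC.
pose g (z : C) := (1 - a^* * z)^-1.
have g0 z : nm z <= 1 -> 1 - a^* * z != 0.
  move=> z1; rewrite subr_eq0; apply/eqP => e.
  have : nm (a^* * z) < 1.
    rewrite nmM nJ; apply: le_lt_trans a1; rewrite -[leRHS]mulr1.
    by rewrite ler_wpM2l ?nm_ge0.
  by rewrite -e nm1 ltxx.
have hg : holo_disc 1 g.
  move=> z z1; apply: derivableV; first exact: g0.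
  by apply: derivableB => //; apply: derivableM.
have := mean_value hg; rewrite /g mulr0 subr0 invr1 => e.
have gc : circ_cont g.
  apply: circ_continuous => z z1; apply: derivable_continuous; apply: hg.
  by rewrite z1.
rewrite -[RHS]conjC1 -e /cmean rmorphM /= -(cint_conj gc).
rewrite (CrealP _) ?ofR_real //; congr (_ * _); congr cint; apply/funext => t /=.
have zz : circle io t * (circle io t)^* = 1.
  by rewrite -normCK -(nmE io) nm_circle rmorph1 expr1n.
have z0 : circle io t != 0 by apply: nm1_neq0; exact: nm_circle.
rewrite /g fmorphV rmorphB rmorph1 rmorphM /= conjCK.
have -> : (circle io t)^* = (circle io t)^-1.
  by apply: (mulfI z0); rewrite zz mulfV.
have za : circle io t - a != 0 by exact: circle_neq.
by field; rewrite za z0.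
Qed.

Theorem cauchy g (a : C) : nm a < 1 -> holo_disc 1 g ->
  g a = cmean (fun z => g z * (z / (z - a))).
Proof.
move=> a1 hg; rewrite (cmean_kernel a1 (holo_cdiff hg)).
- by rewrite kernel_mean // mulr1.
- apply: circ_continuous => z z1; apply: continuousM; last exact: kernel_cont.
  by apply: derivable_continuous; apply: hg; rewrite z1.
- apply: circ_continuous => z z1; exact: kernel_cont.
Qed.

(** The [k]-th Taylor coefficient of [g] at [0], as a mean over the circle of radius [r]. *)
Definition coef (r : R) (k : nat) (g : C -> C) : C :=
  io (r ^- k) * cmean (fun z => g (io r * z) * z ^- k).

Lemma derivable_dilate (g : C -> C) (c z : C) : derivable g (c * z) 1 ->
  derivable (fun w => g (c * w)) z 1.
Proof.
move=> /derivable1_diffP dg; apply/derivable1_diffP.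
exact: (@differentiable_comp _ _ _ _ (fun w : C => c * w) g).
Qed.

(** Cauchy's formula for the dilated function, with the geometric series of the
    kernel stopped after [k] terms. *)
Lemma series_rem (r : R) (g : C -> C) (t : C) k : 0 < r -> holo_disc r g -> nm t < r ->
  g t = \sum_(j < k) coef r j g * t ^+ j +
   cmean (fun z => g (io r * z) * ((t / io r / z) ^+ k * (z / (z - t / io r)))).
Proof.
move=> r0 hg tr; have rn0 : io r != 0 by rewrite fmorph_eq0 gt_eqF.
have nr : nm (io r) = r by rewrite nm_ofR gtr0_norm.
pose h z := g (io r * z); set a := t / io r.
have a1 : nm a < 1 by rewrite nmM nmV nr ltr_pdivrMr // mul1r.
have hh : holo_disc 1 h.
  move=> z z1; apply: derivable_dilate; apply: hg.
  by rewrite nmM nr -[leRHS]mulr1 ler_pM2l.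
have hc z : nm z = 1 -> {for z, continuous h}.
  by move=> z1; apply: derivable_continuous; apply: hh; rewrite z1.
have pc (c z : C) i : nm z = 1 -> {for z, continuous (fun w : C => (c / w) ^+ i)}.
  by move=> /nm1_neq0 z0; apply: derivable_continuous; exact: derivable_divX.
elim: k => [|k IH].
  rewrite big_ord0 add0r -[in LHS](divfK rn0 t) -/a mulrC -/(h a) (cauchy a1 hh).
  by apply: cmean_ext => z z1; rewrite expr0 mul1r.
rewrite {1}IH big_ord_recr /= -addrA; congr (_ + _).
rewrite /coef -(mulrA (io _)) [X in io _ * X]mulrC mulrA.
have -> : io (r ^- k) * t ^+ k = a ^+ k.
  by rewrite fmorphV rmorphXn /a expr_div_n mulrC.
have cc : circ_cont (fun z => h z * z ^- k).
  apply: circ_continuous => z z1; apply: continuousM; first exact: hc.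
  by apply: derivable_continuous; apply: derivable_invX; exact: nm1_neq0.
rewrite -cmeanZ // -cmeanD //.
- apply: cmean_ext => z z1; have z0 := nm1_neq0 z1; rewrite -/(h z).
  have za : z - a != 0.
    by rewrite subr_eq0; apply/eqP => e; move: a1; rewrite -e z1 ltxx.
  rewrite [RHS](_ : _ = h z * ((a / z) ^+ k * (1 + (a / z) * (z / (z - a))))); last first.
    by rewrite exprS (expr_div_n a z); ring.
  congr (_ * (_ * _)); field; exact/andP.
- apply: circ_continuous => z z1; apply: (@continuousM _ _ (cst (a ^+ k))).
    exact: cst_continuous.
  apply: continuousM; first exact: hc.
  by apply: derivable_continuous; apply: derivable_invX; exact: nm1_neq0.
- apply: circ_continuous => z z1; apply: continuousM; first exact: hc.
  apply: continuousM; first exact: pc.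
  exact: kernel_cont.
Qed.

Lemma series_bound (r M : R) (g : C -> C) (t : C) k : 0 < r -> holo_disc r g ->
  (forall z, nm z = r -> nm (g z) <= M) -> nm t <= r / 2 ->
  nm (g t - \sum_(j < k) coef r j g * t ^+ j) <= 4 * M * (nm t / r) ^+ k.
Proof.
move=> r0 hg gM tr; have tr' : nm t < r by lra.
have nr : nm (io r) = r by rewrite nm_ofR gtr0_norm.
have rn0 : io r != 0 by rewrite fmorph_eq0 gt_eqF.
rewrite {1}(series_rem k r0 hg tr') addrC addKr.
set a := t / io r.
have na : nm a = nm t / r by rewrite nmM nmV nr.
have a2 : nm a <= 1 / 2 by rewrite na ler_pdivrMr // mulrAC mul1r mulrC; lra.
have a1 : nm a < 1 by lra.
have -> : 4 * M * (nm t / r) ^+ k = 2 * (M * (nm a ^+ k * 2)) by rewrite na; ring.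
apply: cmean_norm => [|z z1].
  apply: circ_continuous => z z1; have /nm1_neq0 z0 := z1; apply: continuousM.
    apply: derivable_continuous; apply: derivable_dilate; apply: hg.
    by rewrite nmM nr z1 mulr1.
  apply: continuousM; last exact: kernel_cont.
  by apply: derivable_continuous; exact: derivable_divX.
have -> : nm (g (io r * z) * ((a / z) ^+ k * (z / (z - a)))) =
    nm (g (io r * z)) * (nm a ^+ k * (nm (z - a))^-1).
  by clearbody a; rewrite !(nmM, nmX, nmV) z1 mul1r invr1 mulr1.
have g1 : nm (g (io r * z)) <= M by apply: gM; rewrite nmM nr z1 mulr1.
apply: ler_pM; rewrite ?nm_ge0 ?mulr_ge0 ?exprn_ge0 ?invr_ge0 ?nm_ge0 //.
apply: ler_wpM2l; first by rewrite exprn_ge0 ?nm_ge0.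
rewrite -[leRHS]invrK.
have : 1 - nm a <= nm (z - a) by have := nmD io (z - a) a; rewrite subrK z1; lra.
move=> h; rewrite lef_pV2 ?posrE ?invr_gt0 //; lra.
Qed.

Lemma coef_bound (r M : R) (g : C -> C) k : 0 < r -> holo_disc r g ->
  (forall z, nm z = r -> nm (g z) <= M) -> nm (coef r k g) <= 2 * M / r ^+ k.
Proof.
move=> r0 hg gM; rewrite /coef nmM nm_ofR ger0_norm; last by rewrite invr_ge0 exprn_ge0 // ltW.
rewrite [leLHS]mulrC ler_pM2r ?invr_gt0 ?exprn_gt0 //; have nr : nm (io r) = r by rewrite nm_ofR gtr0_norm.
apply: cmean_norm => [|z z1].
  apply: circ_continuous => z z1; have /nm1_neq0 z0 := z1; apply: continuousM.
    apply: derivable_continuous; apply: derivable_dilate; apply: hg.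
    by rewrite nmM nr z1 mulr1.
  by apply: derivable_continuous; exact: derivable_invX.
by rewrite nmM nmV nmX z1 expr1n invr1 mulr1; apply: gM; rewrite nmM nr z1 mulr1.
Qed.

Lemma cdiff_uniq g (z l l' : C) : cdiff g z l -> cdiff g z l' -> l = l'.
Proof.
move=> h h'; apply/eqP; rewrite -subr_eq0; apply/eqP.
apply: (@nm_small _ _ io _ 2) => e e0.
have [d d0 H] := h e e0; have [d' d0' H'] := h' e e0.
pose x := Num.min d d' / 2; have x0 : 0 < x by rewrite divr_gt0 // lt_min d0.
have xd : x < Num.min d d' by rewrite /x; have := x0; rewrite /x; lra.
move: xd; rewrite lt_min => /andP[xd xd'].
have nx : nm (z + io x - z) = x by rewrite addrC addKr nm_ofR gtr0_norm.
have := H (z + io x); have := H' (z + io x); rewrite nx => /(_ xd') k' /(_ xd) k.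
rewrite -(ler_pM2r x0) -{1}nx -nmM.
rewrite [X in nm X](_ : _ = (g (z + io x) - g z - l' * (z + io x - z)) -
  (g (z + io x) - g z - l * (z + io x - z))); last by ring.
by apply: (le_trans (nmB _ _ _)); apply: (le_trans (lerD k' k)); rewrite -mulrDr; lra.
Qed.

Lemma coef0 r g : 0 < r -> holo_disc r g -> coef r 0 g = g 0.
Proof.
move=> r0 hg; rewrite /coef expr0 invr1 rmorph1 mul1r.
have h1 : holo_disc 1 (fun z => g (io r * z)).
  move=> z z1; apply: derivable_dilate; apply: hg.
  by rewrite nmM nm_ofR gtr0_norm // -[leRHS]mulr1 ler_pM2l.
rewrite -[in RHS](mulr0 (io r)) -(mean_value h1); apply: cmean_ext => z _.
by rewrite expr0 invr1 mulr1.
Qed.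

(** The remainder after two terms is [O(|w|^2)], so the first coefficient has the
    property that characterizes the derivative. *)
Lemma coef1 r M g : 0 < r -> holo_disc r g ->
  (forall z, nm z = r -> nm (g z) <= M) -> coef r 1 g = 'D_1 g 0.
Proof.
move=> r0 hg gM; apply: (@cdiff_uniq g 0); last first.
  by apply: derive_cdiff; apply/derivableP; apply: hg; rewrite nm0 ltW.
have M0 : 0 <= M.
  by apply: le_trans (gM (io r) _); rewrite ?nm_ge0 // nm_ofR gtr0_norm.
move=> e e0; pose K := 4 * M / r ^+ 2 + 1.
have K0 : 0 < K by rewrite ltr_wpDl // divr_ge0 ?mulr_ge0 ?exprn_ge0 // ltW.
exists (Num.min (r / 2) (e / K)); first by rewrite lt_min !divr_gt0.
move=> w; rewrite subr0 lt_min => /andP[w1 w2].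
have := series_bound 2 r0 hg gM (ltW w1).
rewrite big_ord_recr big_ord1 /= expr0 mulr1 expr1 coef0 // opprD addrA.
move=> h; apply: (le_trans h).
rewrite expr_div_n mulrA mulrAC expr2 mulrA ler_wpM2r ?nm_ge0 //.
apply: (@le_trans _ _ (K * nm w)); last by rewrite mulrC -ler_pdivlMr // ltW.
by rewrite ler_wpM2r ?nm_ge0 // /K lerDl.
Qed.

End Series.

(** * Real-valued norms and quadratic remainders *)
Section Vn.
Variables (R : realType) (C : numClosedFieldType) (io : complexification R C).
Notation nm := (nm io).

Definition vn (V : normedModType C) (x : V) : R := re io `|x|.

Section General.
Variables (V : normedModType C).
Implicit Types (x y : V).

Lemma vnE x : io (vn x) = `|x|.
Proof. by rewrite reE; apply/Creal_ReP; rewrite ger0_real. Qed.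
Lemma vn_ge0 x : 0 <= vn x.
Proof. by rewrite -(ofR_le io) vnE rmorph0. Qed.
Lemma vn0 : vn (0 : V) = 0.
Proof. by apply: (ofR_inj (io := io)); rewrite vnE normr0 rmorph0. Qed.
Lemma vnN x : vn (- x) = vn x. Proof. by rewrite /vn normrN. Qed.
Lemma vnD x y : vn (x + y) <= vn x + vn y.
Proof. by rewrite -(ofR_le io) rmorphD !vnE ler_normD. Qed.
Lemma vnB x y : vn (x - y) <= vn x + vn y.
Proof. by rewrite -(vnN y) vnD. Qed.
Lemma vn_distC x y : vn (x - y) = vn (y - x). Proof. by rewrite -vnN opprB. Qed.
Lemma vnZ (a : C) x : vn (a *: x) = nm a * vn x.
Proof. by apply: (ofR_inj (io := io)); rewrite rmorphM !vnE nmE normrZ. Qed.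
Lemma vn_eq0 x : (vn x == 0) = (x == 0).
Proof. by rewrite -(inj_eq (ofR_inj (io := io))) vnE rmorph0 normr_eq0. Qed.
Lemma vn_gt0 x : (0 < vn x) = (x != 0).
Proof. by rewrite lt_def vn_ge0 vn_eq0 andbT. Qed.
Lemma vn_lt x (d : C) : 0 < d -> (`|x| < d) = (vn x < nm d).
Proof. by move=> d0; rewrite -[d in LHS]gtr0_norm // -vnE -(nmE io) ofR_lt. Qed.

Lemma nbhs_vn x (P : set V) :
  nbhs x P <-> exists2 r : R, 0 < r & forall y, vn (y - x) < r -> P y.
Proof.
split=> [/nbhs_ballP [d /= d0 H]|[r r0 H]].
  exists (nm d) => [|y yd]; first exact: gt0_nm.
  by apply: H; rewrite -ball_normE /= -normrN opprB vn_lt.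
apply/nbhs_ballP; exists (io r) => [|y]; first by rewrite /= ofR_gt0.
rewrite -ball_normE /= -normrN opprB vn_lt ?ofR_gt0 // nm_ofR gtr0_norm //.
exact: H.
Qed.

Lemma vn_shift x y z : vn (x + y - z) <= vn (x - z) + vn y.
Proof. by rewrite addrAC vnD. Qed.

End General.

Lemma nm_vn (z : C) : vn (z : C^o) = nm z. Proof. by []. Qed.

Lemma continuous_vn (V W : normedModType C) (f : V -> W) x : {for x, continuous f} ->
  forall e : R, 0 < e -> exists2 d : R, 0 < d &
    forall y, vn (y - x) < d -> vn (f y - f x) < e.
Proof.
move=> fc e e0; have : nbhs (f x) [set w | vn (w - f x) < e].
  by apply/nbhs_vn; exists e.
by move=> /fc /nbhs_vn.
Qed.

Lemma vn_continuous (V W : normedModType C) (f : V -> W) x :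
  (forall e : R, 0 < e -> exists2 d : R, 0 < d &
    forall y, vn (y - x) < d -> vn (f y - f x) < e) -> {for x, continuous f}.
Proof.
move=> h A /nbhs_vn [e e0 H]; have [d d0 H'] := h e e0.
by apply/nbhs_vn; exists d => // y /H' /H.
Qed.

(** The form in which Cauchy estimates yield differentiability: they produce
    quadratic remainders. *)
Lemma quad_diff (V W : normedModType C) (f : V -> W) (x : V) (L : {linear V -> W})
    (K M r : R) : 0 < r -> (forall h, vn (L h) <= M * vn h) ->
  (forall h, vn h < r -> vn (f (h + x) - f x - L h) <= K * vn h ^+ 2) ->
  differentiable f x /\ 'd f x = L :> (V -> W).
Proof.
move=> r0 hL hf.
have cL : continuous L.
  move=> y; apply: vn_continuous => e e0; have M0 : 0 < `|M| + 1 by rewrite ltr_wpDl.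
  exists (e / (`|M| + 1)); first by rewrite divr_gt0.
  move=> z; rewrite ltr_pdivlMr // => zy; rewrite -linearB.
  apply: le_lt_trans (hL _) _; apply: le_lt_trans zy; rewrite mulrC.
  by apply: ler_wpM2l; rewrite ?vn_ge0 // (le_trans (ler_norm _)) // lerDl.
have dL : f \o shift x = cst (f x) + L +o_ 0 id.
  apply/eqaddoP => e e0; have K0 : 0 < `|K| + 1 by rewrite ltr_wpDl.
  apply/nbhs_vn; exists (Num.min r (nm e / (`|K| + 1))).
    by rewrite lt_min r0 divr_gt0 // gt0_nm.
  move=> h; rewrite subr0 lt_min ltr_pdivlMr // => /andP[h1 h2].
  rewrite !fctE /= opprD addrA -!vnE -[e]gtr0_norm // -(nmE io) -rmorphM ofR_le.
  apply: (le_trans (hf _ h1)); rewrite expr2 mulrA ler_wpM2r ?vn_ge0 //.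
  apply: le_trans (ltW h2); rewrite mulrC ler_wpM2l ?vn_ge0 //.
  by rewrite (le_trans (ler_norm _)) // lerDl.
have e := diff_unique cL dL; split => //.
by apply/diff_locallyP; rewrite e.
Qed.

End Vn.

(** * Holomorphic functions of a vector variable *)
Section Circ.
Variables (R : realType) (C : numClosedFieldType) (io : complexification R C).
Notation nm := (nm io).
Notation circ_cont := (circ_cont io).
Notation cmean := (cmean io).

Lemma circ_contZ (c : C) (a : C -> C) : circ_cont a -> circ_cont (fun z => c * a z).
Proof. exact: seg_contZ. Qed.
Lemma circ_contB (a b : C -> C) : circ_cont a -> circ_cont b ->
  circ_cont (fun z => a z - b z).
Proof. exact: seg_contB. Qed.

Lemma cmeanB (a b : C -> C) : circ_cont a -> circ_cont b ->
  cmean (fun z => a z - b z) = cmean a - cmean b.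
Proof.
move=> ca cb; rewrite -[in RHS]mulN1r -cmeanZ // -cmeanD //; last exact: circ_contZ.
by apply: cmean_ext => z _; rewrite mulN1r.
Qed.

End Circ.

Section Holo.
Variables (R : realType) (C : numClosedFieldType) (io : complexification R C).
Variable V : normedModType C.
Notation nm := (nm io).
Notation vn := (vn io).
Notation circ_cont := (circ_cont io).
Notation cmean := (cmean io).
Notation holo_disc := (holo_disc io).
Notation coef := (coef io).
Implicit Types (f : V -> C) (x v h : V).

Lemma line_quotient f x v (t : C) (g := fun t : C => f (x + t *: v)) :
  (fun h : C => h^-1 *: ((g \o shift t) (h *: 1) - g t)) =
  (fun h : C => h^-1 *: ((f \o shift (x + t *: v)) (h *: v) - f (x + t *: v))).
Proof.
apply/funext => h /=; congr (_ *: (f _ - _)).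
by rewrite [h *: 1]mulr1 scalerDl addrCA.
Qed.

Lemma line_derivable f x v (t : C) : derivable f (x + t *: v) v ->
  derivable (fun t : C => f (x + t *: v)) t 1.
Proof. by rewrite /derivable line_quotient. Qed.

Lemma line_derive f x v (t : C) :
  'D_1 (fun t : C => f (x + t *: v)) t = 'D_v f (x + t *: v).
Proof. by rewrite /derive line_quotient. Qed.

(** The radius and the bound that enter all the estimates of Cauchy type. *)
Definition holo_bd f x0 (r M : R) := forall x, vn (x - x0) < r ->
  differentiable f x /\ nm (f x) <= M.

Lemma holo_bd_sub f x0 r M x1 r1 : holo_bd f x0 r M -> vn (x1 - x0) + r1 <= r ->
  holo_bd f x1 r1 M.
Proof.
move=> H xr x xx1; apply: H; have := vnD io (x - x1) (x1 - x0).
by rewrite addrA subrK; lra.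
Qed.

Section Centre.
Variables (f : V -> C) (x : V) (r M : R).
Hypotheses (r0 : 0 < r) (H : holo_bd f x r M).

(** Restriction to complex lines reduces the estimates to one variable. *)
Lemma holo_line v (s : R) : 0 < s -> s * vn v < r ->
  holo_disc s (fun t => f (x + t *: v)) /\
  (forall z : C, nm z = s -> nm (f (x + z *: v)) <= M).
Proof.
move=> s0 sv; have K z : nm z <= s -> vn (x + z *: v - x) < r.
  move=> zs; rewrite addrC addKr vnZ; apply: le_lt_trans sv.
  by rewrite ler_wpM2r ?vn_ge0.
split=> z zs.
  by apply: line_derivable; apply: diff_derivable; exact: (H (K z zs)).1.
by apply: (H (K z _)).2; rewrite zs.
Qed.

Lemma holo_bd_ge0 : 0 <= M.
Proof.
by apply: le_trans (nm_ge0 io (f x)) (H _).2; rewrite subrr vn0.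
Qed.

Lemma cauchy_derive v (s : R) : 0 < s -> s * vn v < r ->
  'D_v f x = io s^-1 * cmean (fun z => f (x + (io s * z) *: v) * z^-1).
Proof.
move=> s0 sv; have [h1 h2] := holo_line s0 sv.
have := coef1 s0 h1 h2; rewrite (line_derive f x v 0) scale0r addr0 => <-.
by rewrite /coef expr1; congr (_ * _); apply: cmean_ext => z _; rewrite expr1.
Qed.

(** The radius of the disc on the line in the direction [h] is half of what the ball
    allows; the point [x + h], at [t = 1], has to lie in the half disc where the power
    series is controlled. *)
Lemma unit_line h : h != 0 -> [/\ 0 < r / (2 * vn h),
  holo_disc (r / (2 * vn h)) (fun t => f (x + t *: h)),
  (forall z : C, nm z = r / (2 * vn h) -> nm (f (x + z *: h)) <= M) &
  vn h <= r / 4 -> nm 1 <= r / (2 * vn h) / 2].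
Proof.
have rpos := r0; rewrite -(vn_gt0 io) => vp.
have s0 : 0 < r / (2 * vn h) by rewrite divr_gt0 // mulr_gt0.
have sv : r / (2 * vn h) * vn h < r.
  by rewrite invfM mulrA divfK ?gt_eqF // ltr_pdivrMr //; lra.
have [h1 h2] := holo_line s0 sv; split => // hr.
by rewrite nm1 ler_pdivlMr // ler_pdivlMr ?mulr_gt0 //; lra.
Qed.

Lemma derive_bound v : nm ('D_v f x) <= 4 * M / r * vn v.
Proof.
have [->|v0] := eqVneq v 0; first by rewrite derive0 nm0 vn0 mulr0.
have [s0 h1 h2 _] := unit_line v0.
have := coef_bound 1 s0 h1 h2; rewrite (coef1 s0 h1 h2) line_derive scale0r addr0.
rewrite expr1 invf_div => /le_trans; apply.
by rewrite (_ : 2 * M * _ = 4 * M / r * vn v) //; ring.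
Qed.

Lemma taylor1 h : vn h <= r / 4 ->
  nm (f (x + h) - f x) <= 8 * M / r * vn h.
Proof.
have [->|v0] := eqVneq h 0; first by rewrite addr0 subrr nm0 vn0 mulr0.
move=> hr; have [s0 h1 h2 /(_ hr) t1] := unit_line v0.
have := series_bound 1 s0 h1 h2 t1.
rewrite big_ord1 (coef0 s0 h1) scale1r scale0r addr0 expr0 mulr1 nm1.
rewrite expr1 mul1r invf_div => /le_trans; apply.
by rewrite (_ : 4 * M * _ = 8 * M / r * vn h) //; ring.
Qed.

Lemma taylor2 h : vn h <= r / 4 ->
  nm (f (x + h) - f x - 'D_h f x) <= 16 * M / r ^+ 2 * vn h ^+ 2.
Proof.
have [->|v0] := eqVneq h 0.
  by rewrite addr0 derive0 !subrr nm0 vn0 expr0n /= mulr0.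
move=> hr; have [s0 h1 h2 /(_ hr) t1] := unit_line v0.
have := series_bound 2 s0 h1 h2 t1.
rewrite big_ord_recr big_ord1 /= (coef0 s0 h1) (coef1 s0 h1 h2) line_derive.
rewrite scale1r scale0r addr0 expr0 !expr1 !mulr1 nm1 opprD addrA mul1r invf_div.
move=> /le_trans; apply.
by rewrite (_ : 4 * M * _ = 16 * M / r ^+ 2 * vn h ^+ 2) // -exprVn; ring.
Qed.

End Centre.

(** A Lipschitz bound in place of differentiability: the lemma is also applied to a
    directional derivative, before its differentiability is known. *)
Lemma circ_cont_line (g : V -> C) x v (s d K : R) : 0 < d -> 0 <= K ->
  (forall z, nm z = 1 -> forall h, vn h <= d ->
    nm (g (x + (io s * z) *: v + h) - g (x + (io s * z) *: v)) <= K * vn h) ->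
  circ_cont (fun z => g (x + (io s * z) *: v) * z^-1).
Proof.
move=> d0 K0 H; apply: circ_continuous => z z1; have z0 := nm1_neq0 z1.
apply: continuousM; last first.
  apply: derivable_continuous; apply: derivableV => //; exact: derivable_id.
apply: (vn_continuous (io := io)) => e e0.
pose T := `|s| * vn v + 1; have T0 : 0 < T.
  by rewrite ltr_wpDl // mulr_ge0 ?vn_ge0.
exists (Num.min (d / T) (e / ((K + 1) * T))).
  by rewrite lt_min !divr_gt0 // mulr_gt0 // ltr_wpDl.
move=> w; rewrite lt_min (nm_vn io) => /andP[w1 w2].
set h := (io s * (w - z)) *: v.
have -> : x + (io s * w) *: v = x + (io s * z) *: v + h.
  by rewrite -addrA -scalerDl -mulrDr addrCA subrr addr0.
have hT : vn h <= nm (w - z) * T.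
  rewrite vnZ nmM nm_ofR mulrAC mulrC; apply: ler_wpM2l; first exact: nm_ge0.
  by rewrite /T lerDl.
have hd : vn h <= d by apply: (le_trans hT); rewrite -ler_pdivlMr // ltW.
apply: le_lt_trans (H z z1 h hd) _.
have K1 : 0 < K + 1 by rewrite ltr_wpDl.
apply: (@le_lt_trans _ _ ((K + 1) * (nm (w - z) * T))).
  by apply: ler_pM; rewrite ?vn_ge0 // lerDl.
by rewrite mulrCA -ltr_pdivlMr // mulr_gt0.
Qed.

Lemma lip_near f x r M y k : 0 < r -> holo_bd f x r M ->
  vn (y - x) <= r / 2 -> vn k <= r / 8 -> nm (f (y + k) - f y) <= 16 * M / r * vn k.
Proof.
move=> r0 H yx kr; have H3 : holo_bd f y (r / 2) M by apply: holo_bd_sub H _; lra.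
have r2 : 0 < r / 2 by lra.
have kr4 : vn k <= r / 2 / 4 by lra.
apply: (le_trans (taylor1 r2 H3 kr4)).
by rewrite (_ : 8 * M / (r / 2) = 16 * M / r) //; field; rewrite gt_eqF.
Qed.

Section Second.
Variables (f : V -> C) (x : V) (r M : R) (v : V) (s : R).
Hypotheses (r0 : 0 < r) (H : holo_bd f x r M) (s0 : 0 < s) (sv : s * vn v < r / 8).

Lemma vn_line_small (z : C) : nm z = 1 -> vn ((io s * z) *: v) < r / 8.
Proof. by move=> z1; rewrite vnZ nmM z1 mulr1 nm_ofR gtr0_norm. Qed.

Let K0 : 0 <= 16 * M / r.
Proof. by have M0 := holo_bd_ge0 r0 H; rewrite divr_ge0 ?mulr_ge0 // ltW. Qed.

Lemma line_near y z : nm z = 1 -> vn (y - x) <= 3 * r / 8 ->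
  vn (y + (io s * z) *: v - x) <= r / 2.
Proof.
have rpos := r0; have spos := s0; have svr := sv.
move=> z1 yx; have := vn_line_small z1; have := vn_shift io y ((io s * z) *: v) x.
by lra.
Qed.

Lemma circ_cont_near y : vn (y - x) <= 3 * r / 8 ->
  circ_cont (fun z => f (y + (io s * z) *: v) * z^-1).
Proof.
have rpos := r0; have spos := s0; have svr := sv.
move=> yx; have r8 : 0 < r / 8 by lra.
apply: (circ_cont_line r8 K0) => z z1 h hr.
by apply: (lip_near r0 H) => //; exact: line_near.
Qed.

Lemma cauchy_near y : vn (y - x) <= 3 * r / 8 ->
  'D_v f y = io s^-1 * cmean (fun z => f (y + (io s * z) *: v) * z^-1).
Proof.
have rpos := r0; have spos := s0; have svr := sv.
move=> yx; have H1 : holo_bd f y (r / 2) M by apply: holo_bd_sub H _; lra.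
by apply: (cauchy_derive H1) => //; lra.
Qed.

(** By Cauchy's formula in the direction [v], a Lipschitz bound for [f] passes to
    ['D_v f]. *)
Lemma derive_lip y h : vn (y - x) <= r / 4 -> vn h <= r / 8 ->
  nm ('D_v f (y + h) - 'D_v f y) <= 32 * M / r / s * vn h.
Proof.
have rpos := r0; have spos := s0; have svr := sv.
move=> yx hr; have yhx := vn_shift io y h x.
have y1 : vn (y - x) <= 3 * r / 8 by lra.
have y2 : vn (y + h - x) <= 3 * r / 8 by lra.
rewrite (cauchy_near y1) (cauchy_near y2) -mulrBr.
have c1 := circ_cont_near y1; have c2 := circ_cont_near y2.
rewrite -cmeanB // nmM nm_ofR gtr0_norm ?invr_gt0 //.
have : nm (cmean (fun z => f (y + h + (io s * z) *: v) * z^-1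
     - f (y + (io s * z) *: v) * z^-1)) <= 2 * (16 * M / r * vn h).
  apply: cmean_norm => [|z z1]; first exact: circ_contB.
  rewrite -mulrBl nmM nmV z1 invr1 mulr1 addrAC.
  by apply: (lip_near r0 H) => //; exact: line_near.
move=> hm; rewrite mulrC ler_pdivrMr //; apply: (le_trans hm).
rewrite le_eqVlt; apply/orP; left; apply/eqP; field.
by rewrite !gt_eqF.
Qed.

End Second.

Lemma holo_bd_derive_lin f y r M u w (a : C) : 0 < r -> holo_bd f y r M ->
  'D_(a *: u + w) f y = a * 'D_u f y + 'D_w f y.
Proof.
move=> r0 H; have df : differentiable f y by apply: (H y _).1; rewrite subrr vn0.
by rewrite !deriveE // linearP.
Qed.

Section Third.
Variables (f : V -> C) (x : V) (r M : R).
Hypotheses (r0 : 0 < r) (H : holo_bd f x r M).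

Lemma small_step v : exists2 s : R, 0 < s & s * vn v < r / 8.
Proof.
have v0 : 0 < vn v + 1 by rewrite ltr_wpDl ?vn_ge0.
exists (r / 8 / (vn v + 1)); first by rewrite !divr_gt0.
rewrite mulrAC ltr_pdivrMr // ltr_pM2l ?divr_gt0 //.
by rewrite ltrDl.
Qed.

(** Cauchy's formula expresses ['D_v f] as a mean of translates of [f]; expanding the
    translates to second order under the integral shows that ['D_v f] is
    differentiable and that its differential is the mean of the differentials. *)
Lemma derive_differentiable v : differentiable ('D_v f) x /\
  forall u, exists2 s : R, 0 < s /\ s * vn v < r / 8 &
   'D_u ('D_v f) x = io s^-1 * cmean (fun z => 'D_u f (x + (io s * z) *: v) * z^-1).
Proof.
have rpos := r0.
have [s s0 sv] := small_step v.
have xx : vn (x - x) <= 3 * r / 8 by rewrite subrr vn0; lra.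
have M0 := holo_bd_ge0 r0 H.
have Hz z : nm z = 1 -> holo_bd f (x + (io s * z) *: v) (r / 2) M.
  by move=> z1; apply: holo_bd_sub H _; have := line_near r0 s0 sv z1 xx; lra.
have r2 : 0 < r / 2 by lra.
have cu u : circ_cont (fun z => 'D_u f (x + (io s * z) *: v) * z^-1).
  have [s' s'0 s'u] := small_step u; have r8 : 0 < r / 8 by lra.
  have K0 : 0 <= 32 * M / r / s' by rewrite !divr_ge0 ?mulr_ge0 // ltW.
  apply: (@circ_cont_line ('D_u f) x v s _ _ r8 K0) => z z1 h hr.
  apply: (derive_lip r0 H s'0 s'u) => //.
  by rewrite addrC addKr; have := vn_line_small s0 sv z1; lra.
pose L u := io s^-1 * cmean (fun z => 'D_u f (x + (io s * z) *: v) * z^-1).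
have linE a u w : L (a *: u + w) = a * L u + L w.
  rewrite /L [a * _]mulrCA -mulrDr; congr (_ * _).
  rewrite -cmeanZ // -cmeanD //; last exact: circ_contZ.
  apply: cmean_ext => z z1.
  by rewrite (holo_bd_derive_lin _ _ _ r2 (Hz z z1)) mulrDl mulrA.
have linL : linear L by move=> a u w; exact: linE.
pose Lm : {linear V -> C} := HB.pack L (GRing.isLinear.Build _ _ _ _ L linL).
have dq : differentiable ('D_v f) x /\ 'd ('D_v f) x = Lm :> (V -> C).
  have r8 : 0 < r / 8 by lra.
  apply: (@quad_diff _ _ io V C _ _ Lm (s^-1 * (2 * (64 * M / r ^+ 2)))
    (s^-1 * (2 * (8 * M / r))) (r / 8) r8).
  - move=> h; rewrite nm_vn /= /L nmM nm_ofR gtr0_norm ?invr_gt0 // -!mulrA.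
    rewrite ler_pM2l ?invr_gt0 //; apply: cmean_norm => [|z z1]; first exact: cu.
    rewrite nmM nmV z1 invr1 mulr1; apply: (le_trans (derive_bound r2 (Hz z z1) h)).
    by rewrite le_eqVlt; apply/orP; left; apply/eqP; field; rewrite gt_eqF.
  - move=> h hr; rewrite nm_vn /=.
    have hx : vn (h + x - x) <= 3 * r / 8 by rewrite addrK; lra.
    rewrite (cauchy_near r0 H s0 sv hx) (cauchy_near r0 H s0 sv xx) /L -2!mulrBr.
    have c1 := circ_cont_near r0 H s0 sv hx; have c2 := circ_cont_near r0 H s0 sv xx.
    rewrite -cmeanB // -cmeanB //; last exact: circ_contB.
    rewrite nmM nm_ofR gtr0_norm ?invr_gt0 // -!mulrA.
    rewrite ler_pM2l ?invr_gt0 //; apply: cmean_norm => [|z z1].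
      by apply: circ_contB => //; exact: circ_contB.
    rewrite -!mulrBl nmM nmV z1 invr1 mulr1 (addrC h) (addrAC x h).
    have hr4 : vn h <= r / 2 / 4 by lra.
    apply: (le_trans (taylor2 r2 (Hz z z1) hr4)).
    by rewrite le_eqVlt; apply/orP; left; apply/eqP; field; rewrite gt_eqF.
case: dq => d1 d2; split => // u; exists s => //.
by rewrite deriveE // d2.
Qed.

End Third.

Lemma holo_bd_local f x : (\forall y \near x, differentiable f y) ->
  exists r M, 0 < r /\ holo_bd f x r M.
Proof.
move=> /(nbhs_vn io) [d d0 H].
have /(continuous_vn io) : {for x, continuous f}.
  by apply: differentiable_continuous; apply: H; rewrite subrr vn0.
move=> /(_ 1 ltr01) [d' d'0 H'].
exists (Num.min d d'), (nm (f x) + 1); split; first by rewrite lt_min d0.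
move=> y; rewrite lt_min => /andP[/H y1 /H' y2]; split => //.
by have := nmD io (f y - f x) (f x); rewrite subrK; move: y2; rewrite nm_vn; lra.
Qed.

Lemma near_derive f x v : (\forall y \near x, differentiable f y) ->
  \forall y \near x, differentiable ('D_v f) y.
Proof.
move=> /holo_bd_local [r [M [r0 H]]]; apply/(nbhs_vn io).
exists (r / 2) => [|y yx]; first by rewrite divr_gt0.
have Hy : holo_bd f y (r / 2) M by apply: holo_bd_sub H _; lra.
by apply: (derive_differentiable _ Hy v).1; rewrite divr_gt0.
Qed.

(** Differentiating Cauchy's formula for ['D_v f] in the direction [u] gives the same
    mean as Cauchy's formula for ['D_u f] in the direction [v]. *)
Lemma derive_comm f x u v : (\forall y \near x, differentiable f y) ->
  'D_u ('D_v f) x = 'D_v ('D_u f) x.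
Proof.
move=> /holo_bd_local [r [M [r0 H]]].
have [_ /(_ u) [s [s0 sv] ->]] := derive_differentiable r0 H v.
have r2 : 0 < r / 2 by lra.
have Hu : holo_bd ('D_u f) x (r / 2) (4 * M / (r / 2) * vn u).
  move=> y yx; have Hy : holo_bd f y (r / 2) M by apply: holo_bd_sub H _; lra.
  by split; [exact: (derive_differentiable r2 Hy u).1|exact: derive_bound r2 Hy u].
by rewrite (cauchy_derive Hu s0) //; lra.
Qed.

End Holo.

(** * Order of vanishing, identity theorem and persistence of roots *)
Section Vanishing.
Variables (R : realType) (C : numClosedFieldType) (io : complexification R C).
Variable V : normedModType C.
Notation nm := (nm io).
Notation vn := (vn io).
Notation holo_bd := (holo_bd io).
Notation holo_disc := (holo_disc io).
Notation coef := (coef io).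
Notation cdiff := (cdiff io).
Implicit Types (f g : V -> C) (p v : V).

Lemma eps_derive (h : R -> R) (s l : R) :
  (forall e, 0 < e -> exists2 d : R, 0 < d & forall y, `|y| < d ->
     `|h (y + s) - h s - l * y| <= e * `|y|) -> is_derive s 1 h l.
Proof.
move=> H; have cv : (fun y : R => y^-1 *: ((h \o shift s) (y *: 1) - h s)) @ 0^' --> l.
  apply/cvgrPdist_le => e e0; have [d d0 Hd] := H e e0.
  rewrite near_withinE; exists d => //= y; rewrite /ball_ /= sub0r normrN => yd y0.
  have := Hd y yd; rewrite /= /GRing.scale /= mulr1 => hy.
  rewrite -(ler_pM2r (_ : 0 < `|y|)) ?normr_gt0 // -normrM.
  by rewrite mulrBl mulrAC mulVf // mul1r distrC.
split; first by apply/cvg_ex; exists l.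
exact: cvg_lim.
Qed.

Lemma ray_derive (g : C -> C) (t l : C) (s : R) (u : {additive C -> R}) :
  (forall z, `|u z| <= nm z) -> (forall (x : R) z, u (io x * z) = x * u z) ->
  cdiff g (io s * t) l -> is_derive s 1 (fun x : R => u (g (io x * t))) (u (l * t)).
Proof.
move=> un uR hg; apply: eps_derive => e e0.
have t0 : 0 < nm t + 1 by rewrite ltr_wpDl ?nm_ge0.
have [d d0 H] := hg (e / (nm t + 1)) (divr_gt0 e0 t0).
exists (d / (nm t + 1)) => [|y yd]; first by rewrite divr_gt0.
have E : io (y + s) * t - io s * t = io y * t by rewrite rmorphD; ring.
have ny : nm (io y * t) <= `|y| * (nm t + 1).
  by rewrite nmM nm_ofR ler_wpM2l // lerDl.
have yd' : nm (io (y + s) * t - io s * t) < d.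
  by rewrite E; apply: le_lt_trans ny _; rewrite -ltr_pdivlMr.
have := H _ yd'; rewrite E => hh.
have -> : u (l * t) * y = u (l * (io y * t)).
  by rewrite [LHS]mulrC -uR mulrCA.
rewrite -!raddfB; apply: (le_trans (un _)); apply: (le_trans hh).
apply: (@le_trans _ _ (e / (nm t + 1) * (`|y| * (nm t + 1)))).
  by rewrite ler_wpM2l // divr_ge0 // ltW.
by rewrite [leLHS]mulrCA divfK ?gt_eqF // mulrC.
Qed.

(** The real mean value theorem along the segment from [0] to [t], for the real and
    the imaginary part. *)
Lemma mean_ineq (g : C -> C) (t : C) (B : R) :
  (forall z, nm z <= nm t -> derivable g z 1 /\ nm ('D_1 g z) <= B) ->
  nm (g t - g 0) <= 2 * B * nm t.
Proof.
move=> H; have nt := nm_ge0 io t.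
have st (s : R) : 0 <= s <= 1 -> nm (io s * t) <= nm t.
  by move=> /andP[s0 s1]; rewrite nmM nm_ofR ger0_norm // -[leRHS]mul1r ler_wpM2r.
suff K (u : {additive C -> R}) : (forall z, `|u z| <= nm z) ->
    (forall (x : R) z, u (io x * z) = x * u z) -> `|u (g t - g 0)| <= B * nm t.
  apply: (le_trans (nm_le_reim _ _)); rewrite -mulrA mulr_natl mulr2n.
  by apply: lerD; apply: K; [exact: re_le|exact: re_ofRM|exact: im_le|exact: im_ofRM].
move=> un uR; pose h x := u (g (io x * t)).
have dh (s : R) : 0 <= s <= 1 -> is_derive s 1 h (u ('D_1 g (io s * t) * t)).
  move=> hs; apply: ray_derive => //; apply: derive_cdiff.
  by apply/derivableP; apply: (H _ (st s hs)).1.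
have [|||c] := @MVT_segment R h (fun s => u ('D_1 g (io s * t) * t)) 0 1.
- exact: ler01.
- move=> s; rewrite in_itv /= => /andP[s0 s1]; apply: dh.
  by rewrite !ltW.
- apply: derivable_within_continuous => s; rewrite in_itv /= => hs.
  by have [] := dh s hs.
rewrite in_itv /= => hc.
rewrite /h rmorph1 rmorph0 mul1r mul0r -raddfB subr0 mulr1 => ->.
apply: (le_trans (un _)); rewrite nmM ler_wpM2r //.
by apply: (H _ (st c hc)).2.
Qed.

Definition nholo f p := \forall y \near p, differentiable f y.

Fixpoint dlist (s : seq V) f : V -> C :=
  if s is v :: s' then 'D_v (dlist s' f) else f.

Lemma nholo_derive f p v : nholo f p -> nholo ('D_v f) p.
Proof. exact: (near_derive io). Qed.

Lemma nholo_dlist s f p : nholo f p -> nholo (dlist s f) p.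
Proof. by elim: s => //= v s IH /IH; exact: nholo_derive. Qed.

Lemma nholo_diff f p : nholo f p -> differentiable f p.
Proof. exact: nbhs_singleton. Qed.

Lemma near_open (P : V -> Prop) p : (\forall y \near p, P y) ->
  \forall y \near p, \forall z \near y, P z.
Proof.
move=> /(nbhs_vn io) [r r0 H]; apply/(nbhs_vn io); exists (r / 2).
  by rewrite divr_gt0.
move=> y yp; apply/(nbhs_vn io); exists (r / 2) => [|z zy]; first by rewrite divr_gt0.
by apply: H; have := vnD io (z - y) (y - p); rewrite addrA subrK; lra.
Qed.

Lemma dlist_near f g p s : (\forall y \near p, f y = g y) ->
  \forall y \near p, dlist s f y = dlist s g y.
Proof.
move=> fg; elim: s => //= v s /near_open; apply: filterS => y hy.
exact: near_eq_derive.
Qed.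

(** Vanishing to order at least [k], in terms of iterated directional derivatives,
    a basis-free form that is stable under differentiation. *)
Definition ord k f p := forall s, (size s < k)%N -> dlist s f p = 0.

Lemma dlist0 s : dlist s (fun=> 0 : C) = fun=> 0.
Proof. by elim: s => //= v s ->; apply/funext => y; rewrite derive_cst. Qed.

Lemma dlist_rcons s v f : dlist (rcons s v) f = dlist s ('D_v f).
Proof. by elim: s => //= u s ->. Qed.

Lemma ord_le k k' f p : (k' <= k)%N -> ord k f p -> ord k' f p.
Proof. by move=> kk h s sk; apply: h; exact: leq_trans kk. Qed.

Lemma ordS k f p : ord k.+1 f p <-> f p = 0 /\ forall v, ord k ('D_v f) p.
Proof.
split=> [h|[h0 h] s].
  split=> [|v s sk]; first exact: (h [::]).
  by rewrite -dlist_rcons; apply: h; rewrite size_rcons.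
by case/lastP: s => [//|s v]; rewrite size_rcons ltnS dlist_rcons => /h.
Qed.

Lemma ord_near k f g p : (\forall y \near p, f y = g y) -> ord k f p -> ord k g p.
Proof. by move=> fg h s /h <-; have /nbhs_singleton := dlist_near s fg. Qed.

Lemma dlistD s f g p : nholo f p -> nholo g p ->
  \forall y \near p, dlist s (f \+ g) y = dlist s f y + dlist s g y.
Proof.
move=> hf hg; elim: s => [|v s IH] /=; first exact: nearW.
have := near_open IH; have := nholo_dlist s hf; have := nholo_dlist s hg.
apply: filterS3 => y dg df e; rewrite (near_eq_derive _ e) deriveD //.
  exact: diff_derivable.
exact: diff_derivable.
Qed.

Lemma ordD k f g p : nholo f p -> nholo g p -> ord k f p -> ord k g p ->
  ord k (f \+ g) p.
Proof.
move=> hf hg of_ og s sk; have /nbhs_singleton -> := dlistD s hf hg.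
by rewrite of_ ?og ?addr0.
Qed.

Lemma nholoM f g p : nholo f p -> nholo g p -> nholo (f \* g) p.
Proof. by apply: filterS2 => y df dg; exact: differentiableM. Qed.

Lemma derive_mul f g p v : nholo f p -> nholo g p ->
  \forall y \near p, ((f \* 'D_v g) \+ ('D_v f \* g)) y = 'D_v (f \* g) y.
Proof.
apply: filterS2 => y df dg; rewrite deriveM; try exact: diff_derivable.
by rewrite /= /GRing.scale /= [g y * _]mulrC.
Qed.

Lemma ordM k a f p : nholo a p -> nholo f p -> ord k f p -> ord k (a \* f) p.
Proof.
elim: k a f => [|k IH] a f ha hf; first by [].
move=> /[dup] h /ordS [f0 hD]; apply/ordS; split=> [|v]; first by rewrite /= f0 mulr0.
have hDa := nholo_derive v ha; have hDf := nholo_derive v hf.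
apply: (ord_near (derive_mul v ha hf)); apply: ordD; try exact: nholoM.
  exact: IH.
by apply: IH => //; exact: ord_le h.
Qed.

(** By induction on [k] through the product rule, as in [ordM]; the factor [a] raises
    the order by one because it vanishes at [p]. *)
Lemma ordM1 k a f p : nholo a p -> nholo f p -> a p = 0 -> ord k f p ->
  ord k.+1 (a \* f) p.
Proof.
move=> ha + a0; elim: k f => [|k IH] f hf h.
  by apply/ordS; split; rewrite /= ?a0 ?mul0r.
have [f0 hD] := (ordS k f p).1 h.
apply/ordS; split=> [|v]; first by rewrite /= a0 mul0r.
have hDa := nholo_derive v ha; have hDf := nholo_derive v hf.
apply: (ord_near (derive_mul v ha hf)); apply: ordD; try exact: nholoM.
  exact: IH.
exact: ordM.
Qed.

Lemma dlist_comm s v f p : nholo f p ->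
  \forall y \near p, dlist s ('D_v f) y = 'D_v (dlist s f) y.
Proof.
move=> hf; elim: s => [|u s IH] /=; first exact: nearW.
have := near_open IH; have := near_open (nholo_dlist s hf).
apply: filterS2 => y df e; rewrite (near_eq_derive _ e).
exact: (derive_comm io).
Qed.

(** Integrating along the line [p + t v], starting from the highest derivative. *)
Lemma ord_flat f p v k : nholo f p -> (forall i, (i < k)%N -> dlist (nseq i v) f p = 0) ->
  exists K d : R, 0 < d /\ forall t : C, nm t <= d -> nm (f (p + t *: v)) <= K * nm t ^+ k.
Proof.
have line_in (g : V -> C) : nholo g p -> exists d : R, 0 < d /\
    forall t, nm t <= d -> differentiable g (p + t *: v).
  move=> /(nbhs_vn io) [r r0 H]; have v0 : 0 < vn v + 1 by rewrite ltr_wpDl ?vn_ge0.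
  exists (r / 2 / (vn v + 1)); split; first by rewrite !divr_gt0.
  move=> t; rewrite ler_pdivlMr // => ht; apply: H; rewrite addrC addKr vnZ.
  by have := nm_ge0 io t; lra.
elim: k f => [|k IH] f hf h.
  have [r [M [r0 H]]] := holo_bd_local io hf.
  have v0 : 0 < vn v + 1 by rewrite ltr_wpDl ?vn_ge0.
  exists M, (r / 2 / (vn v + 1)); split; first by rewrite !divr_gt0.
  move=> t; rewrite ler_pdivlMr // => ht; rewrite expr0 mulr1; apply: (H _ _).2.
  by rewrite addrC addKr vnZ; have := nm_ge0 io t; lra.
have [K [d [d0 H]]] : exists K d : R, 0 < d /\
    forall t : C, nm t <= d -> nm ('D_v f (p + t *: v)) <= K * nm t ^+ k.
  apply: (IH ('D_v f)) => [|i ik]; first exact: nholo_derive.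
  have -> : dlist (nseq i v) ('D_v f) = dlist (nseq i.+1 v) f.
    by rewrite -dlist_rcons; congr (dlist _ f); elim: i {ik} => //= i ->.
  exact: h.
have [d' [d'0 H']] := line_in f hf.
exists (2 * K), (Num.min d d'); split; first by rewrite lt_min d0.
move=> t; rewrite le_min => /andP[td td'].
have f0 : f (p + 0 *: v) = 0 by rewrite scale0r addr0; exact: (h 0%N).
have -> : f (p + t *: v) = f (p + t *: v) - f (p + 0 *: v) by rewrite f0 subr0.
rewrite exprSr mulrA -(mulrA 2).
apply: (@mean_ineq (fun t => f (p + t *: v))) => z zt; split.
  by apply: line_derivable; apply: diff_derivable; apply: H'; exact: le_trans td'.
rewrite line_derive; apply: (le_trans (H _ (le_trans zt td))).
have K0 : 0 <= K.
  have := le_trans (nm_ge0 io _) (H (io d) _); rewrite nm_ofR gtr0_norm // => /(_ (lexx _)).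
  by rewrite pmulr_lge0 // exprn_gt0.
by rewrite ler_wpM2l // lerXn2r ?nnegrE ?nm_ge0.
Qed.

Lemma small_le0 (a K d : R) : 0 < d -> (forall x, 0 < x -> x <= d -> a <= K * x) -> a <= 0.
Proof.
move=> d0 H; rewrite leNgt; apply/negP => a0; have K0 : 0 < `|K| + 1 by rewrite ltr_wpDl.
pose x := Num.min d (a / 2 / (`|K| + 1)).
have x0 : 0 < x by rewrite lt_min d0 !divr_gt0.
have xd : x <= d by rewrite ge_min lexx.
have xa : x * (`|K| + 1) <= a / 2.
  by rewrite -ler_pdivlMr // ge_min lexx orbT.
have := H x x0 xd; have : K * x <= (`|K| + 1) * x.
  apply: ler_wpM2r; first exact: ltW.
  by rewrite (le_trans (ler_norm _)) // lerDl.
by rewrite mulrC in xa; lra.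
Qed.

Lemma coef_lead (s M : R) (g : C -> C) k : 0 < s -> holo_disc s g ->
  (forall z, nm z = s -> nm (g z) <= M) -> (forall i, (i < k)%N -> coef s i g = 0) ->
  forall t, nm t <= s / 2 ->
    nm (g t - coef s k g * t ^+ k) <= 4 * M / s ^+ k.+1 * nm t ^+ k.+1.
Proof.
move=> s0 hg gM ck t ts; have := series_bound k.+1 s0 hg gM ts.
rewrite big_ord_recr /= big1 ?add0r => [|i _]; last by rewrite ck ?mul0r.
by move=> /le_trans; apply; rewrite expr_div_n mulrA mulrAC.
Qed.

Lemma coef_flat (s M : R) (g : C -> C) : 0 < s -> holo_disc s g ->
  (forall z, nm z = s -> nm (g z) <= M) ->
  (forall k, exists K d : R, 0 < d /\ forall t : C, nm t <= d -> nm (g t) <= K * nm t ^+ k) ->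
  forall k, coef s k g = 0.
Proof.
move=> s0 hg gM flat k; elim/ltn_ind: k => k IH.
have [K [d [d0 H]]] := flat k.+1.
have L := coef_lead s0 hg gM IH.
apply/eqP; rewrite -(nm_eq0 io) eq_le nm_ge0 andbT.
have m0 : 0 < Num.min d (s / 2) by rewrite lt_min d0 divr_gt0.
apply: (small_le0 (K := K + 4 * M / s ^+ k.+1) m0) => x x0.
rewrite le_min => /andP[xd xs].
have nx : nm (io x) = x by rewrite nm_ofR gtr0_norm.
have h1 := H (io x); have h2 := L (io x); rewrite nx in h1 h2.
rewrite -(ler_pM2r (exprn_gt0 k x0)) -{1}nx -nmX -nmM.
rewrite [X in nm X](_ : _ = g (io x) - (g (io x) - coef s k g * io x ^+ k)); last by ring.
apply: (le_trans (nmB _ _ _)); apply: (le_trans (lerD (h1 xd) (h2 xs))).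
by rewrite exprS -mulrDl mulrA.
Qed.

Lemma coef_all0 (s M : R) (g : C -> C) : 0 < s -> holo_disc s g ->
  (forall z, nm z = s -> nm (g z) <= M) -> (forall k, coef s k g = 0) ->
  forall t, nm t <= s / 2 -> g t = 0.
Proof.
move=> s0 hg gM c0 t ts; apply: (@nm_small _ _ io _ (4 * M)) => e e0.
have [k hk] : exists k : nat, (1 / 2) ^+ k < e.
  exists (Num.bound e^-1); rewrite expr_div_n expr1n ltr_pdivrMr ?exprn_gt0 //.
  rewrite -ltr_pdivrMl // mulr1; apply: lt_trans (archi_boundP _) _.
    by rewrite invr_ge0 ltW.
  by rewrite -natrX ltr_nat ltn_expl.
have M0 : 0 <= M.
  by apply: le_trans (gM (io s) _); rewrite ?nm_ge0 // nm_ofR gtr0_norm.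
have := series_bound k s0 hg gM ts; rewrite big1 ?subr0 => [|i _]; last first.
  by rewrite c0 mul0r.
move=> /le_trans; apply; rewrite mulrC ler_wpM2r ?mulr_ge0 //.
have q0 : 0 <= nm t / s by rewrite divr_ge0 ?nm_ge0 // ltW.
have q1 : nm t / s <= 1 / 2 by rewrite ler_pdivrMr //; lra.
by apply: le_trans (ltW hk); rewrite lerXn2r // nnegrE.
Qed.

(** On the line through [p] and [y] the function is flat at [p], so all its Taylor
    coefficients vanish and the remainder estimates force it to vanish. *)
Theorem identity_thm f p (r M : R) : 0 < r -> holo_bd f p r M ->
  (forall k, ord k f p) -> forall y, vn (y - p) < r / 2 -> f y = 0.
Proof.
move=> r0 H all0 y yp; have hf : nholo f p.
  by apply/(nbhs_vn io); exists r => // z /H [].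
(* The disc of radius 2 puts y, at t = 1, in the half disc where the series
   converges to the function. *)
have s2 : 0 < 2 :> R by [].
have sv : 2 * vn (y - p) < r by lra.
have [h1 h2] := holo_line H s2 sv.
have -> : f y = f (p + 1 *: (y - p)) by rewrite scale1r addrC subrK.
apply: (coef_all0 s2 h1 h2); last by rewrite nm1 divff.
apply: (coef_flat s2 h1 h2) => k.
by apply: ord_flat => // i ik; apply: (all0 k); rewrite size_nseq.
Qed.

(** The zero at [t = 0] is isolated: near it the lowest nonzero term of the power
    series dominates. *)
Lemma root_order f p v (r M : R) : 0 < r -> holo_bd f p r M -> 2 * vn v < r ->
  f p = 0 -> f (p + v) != 0 ->
  exists tau m : R, [/\ 0 < tau, tau <= 1, 0 < m &
    forall t : C, nm t = tau -> m <= nm (f (p + t *: v))].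
Proof.
move=> r0 H v2 fp fpv; have s2 : 0 < 2 :> R by [].
have [h1 h2] := holo_line H s2 v2; set g := fun t => _ in h1 h2.
have [k ck kmin] : exists2 k, coef 2 k g != 0 & forall i, (i < k)%N -> coef 2 i g = 0.
  have ex : exists k, coef 2 k g != 0.
    apply: contrapT => /forallNP all0; move/eqP: fpv; apply.
    rewrite -[v]scale1r; apply: (coef_all0 s2 h1 h2); last by rewrite nm1 divff.
    by move=> k; apply/eqP; have /negP := all0 k; rewrite negbK.
  case: (ex_minnP ex) => k ck km; exists k => // i ik; apply/eqP.
  by apply: contraTT ik => /km; rewrite leqNgt.
have L := coef_lead s2 h1 h2 kmin.
have c0 : 0 < nm (coef 2 k g) by rewrite nm_gt0.
set K := 4 * M / 2 ^+ k.+1 in L; set c := coef 2 k g in ck c0 L.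
have K0 : 0 < `|K| + 1 by rewrite ltr_wpDl.
pose tau := Num.min 1 (nm c / 2 / (`|K| + 1)).
have t0 : 0 < tau by rewrite lt_min ltr01 !divr_gt0.
have t1 : tau <= 1 by rewrite ge_min lexx.
have tK : (`|K| + 1) * tau <= nm c / 2.
  by rewrite mulrC -ler_pdivlMr // ge_min lexx orbT.
exists tau, (nm c / 2 * tau ^+ k); split => //.
  by rewrite mulr_gt0 ?exprn_gt0 ?divr_gt0.
move=> t tt; have := L t; rewrite tt divff // => /(_ t1) hL.
have := nmB io (g t) (g t - c * t ^+ k); rewrite opprB addrC subrK nmM nmX tt.
have : K * tau ^+ k.+1 <= nm c / 2 * tau ^+ k.
  rewrite exprS mulrA; apply: ler_wpM2r; first by rewrite exprn_ge0 // ltW.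
  apply: le_trans tK; apply: ler_wpM2r; first exact: ltW.
  by rewrite (le_trans (ler_norm _)) // lerDl.
by rewrite /g; lra.
Qed.

(** If [f] had no zero on the disc [p + w + t v], then [1 / f] would be holomorphic
    there and its value at the centre would be the mean of its values on a circle
    where [f] is bounded below by about [m].  For small [w] the value of [f] at the
    centre is much smaller than that. *)
Theorem root_persist f p v (r M : R) : 0 < r -> holo_bd f p r M -> 8 * vn v < r ->
  f p = 0 -> f (p + v) != 0 ->
  exists2 rho : R, 0 < rho & forall w, vn w < rho ->
    exists t : C, nm t <= 1 /\ f (p + w + t *: v) = 0.
Proof.
move=> r0 H v8 fp fpv; have v2 : 2 * vn v < r by have := vn_ge0 io v; lra.
have [tau [m [tau0 tau1 m0 Hm]]] := root_order r0 H v2 fp fpv.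
have M0 := holo_bd_ge0 r0 H.
pose L := 16 * M / r + 1; have L0 : 0 < L.
  by rewrite ltr_wpDl // divr_ge0 ?mulr_ge0 // ltW.
have lip y k : vn (y - p) <= r / 2 -> vn k <= r / 8 ->
    nm (f (y + k) - f y) <= L * vn k.
  move=> yp kr; apply: (le_trans (lip_near r0 H yp kr)).
  by apply: ler_wpM2r; rewrite ?vn_ge0 // lerDl.
exists (Num.min (r / 8) (m / 8 / L)); first by rewrite lt_min !divr_gt0.
move=> w; rewrite lt_min => /andP[wr wm]; apply: contrapT => /forallNP no.
have Lw : L * vn w < m / 8 by rewrite mulrC -ltr_pdivlMr.
have tv t : nm t <= 1 -> vn (t *: v) <= vn v.
  by move=> t1; rewrite vnZ -[leRHS]mul1r ler_wpM2r ?vn_ge0.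
have nz t : nm t <= 1 -> f (p + w + t *: v) != 0.
  by move=> t1; apply/eqP => e; apply: (no t).
pose h (t : C) := (f (p + w + t *: v))^-1.
have tt z : nm z <= 1 -> nm (io tau * z) <= tau.
  by move=> z1; rewrite nmM nm_ofR gtr0_norm // -[leRHS]mulr1 ler_wpM2l // ltW.
have tt1 z : nm z <= 1 -> nm (io tau * z) <= 1.
  by move=> z1; apply: le_trans tau1; exact: tt.
have hh : holo_disc 1 (fun z => h (io tau * z)).
  move=> z z1; apply: derivable_dilate; apply: derivableV; first exact: nz (tt1 z z1).
  apply: line_derivable; apply: diff_derivable; apply: (H _ _).1.
  have := tv _ (tt1 z z1); have := vn_shift io (p + w) ((io tau * z) *: v) p.
  by rewrite (addrAC p w (- p)) subrr add0r; have := vn_ge0 io v; lra.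
have := mean_value hh; rewrite mulr0 /h scale0r addr0 => e.
have : nm (cmean io (fun z => h (io tau * z))) <= 2 * (2 / m).
  apply: cmean_norm.
    apply: circ_continuous => z z1; apply: derivable_continuous; apply: hh.
    by rewrite z1.
  move=> z z1; rewrite /h nmV -[leRHS]invrK invf_div.
  have z1' : nm z <= 1 by rewrite z1.
  rewrite lef_pV2 ?posrE ?divr_gt0 ?nm_gt0 ?nz ?tt1 //.
  have nt : nm (io tau * z) = tau by rewrite nmM z1 mulr1 nm_ofR gtr0_norm.
  have h1 := Hm _ nt; have := tv _ (tt1 z z1') => h2.
  have h3 : vn (p + (io tau * z) *: v - p) <= r / 2.
    by rewrite (addrAC p _ (- p)) subrr add0r; have := vn_ge0 io v; lra.
  have := lip _ w h3 (ltW wr); rewrite (addrAC p _ w) => h4.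
  have := nmB io (f (p + w + (io tau * z) *: v))
     (f (p + w + (io tau * z) *: v) - f (p + (io tau * z) *: v)).
  by rewrite opprB addrC subrK; lra.
rewrite /h e nmV; have := lip p w; rewrite subrr vn0 fp subr0 => h1.
have f0 : f (p + w) != 0.
  by have := nz 0; rewrite nm0 scale0r addr0; apply.
have h2 : nm (f (p + w)) < m / 8.
  by apply: le_lt_trans Lw; apply: h1; [lra|exact: ltW].
have -> : 2 * (2 / m) = (m / 4)^-1 by field; rewrite gt_eqF.
by rewrite lef_pV2 ?posrE ?nm_gt0 // ?divr_gt0 //; lra.
Qed.

End Vanishing.

(** * A counting proof of Sard's theorem *)
Section RowNorm.
Variables (R : realType) (C : numClosedFieldType) (io : complexification R C) (n : nat).
Notation nm := (nm io).
Notation vn := (vn io).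
Implicit Types (x y : 'rV[C]_n).

Lemma vn_leP x (K : R) : 0 <= K -> (vn x <= K) <-> (forall i, nm (x 0 i) <= K).
Proof.
move=> K0; have K0' : 0 <= io K by rewrite -(rmorph0 io) ofR_le.
have -> : (vn x <= K) = (`|x| <= io K) by rewrite -(vnE io) ofR_le.
have [k' Ek] : exists k' : {nonneg C}, io K = k'%:num by exists (NngNum K0').
rewrite /Num.norm /= mx_normE Ek num_le; split.
  move=> /bigmax_leP H i.
  have : (`|x 0 i|%:nng)%:num <= k'%:num by rewrite num_le; exact: (H.2 (0, i) isT).
  by rewrite -Ek /= -(nmE io) ofR_le.
move=> H; apply/bigmax_leP; split; first by rewrite -num_le /= -?Ek.
move=> -[i j] _ /=; have : (`|x i j|%:nng)%:num <= k'%:num.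
  by rewrite -Ek /= -(nmE io) ofR_le ord1.
by rewrite num_le.
Qed.

Lemma vn_coord x i : nm (x 0 i) <= vn x.
Proof. exact: (vn_leP x (vn_ge0 io x)).1. Qed.

Lemma vn_delta k : vn (delta_mx 0 k : 'rV[C]_n) <= 1.
Proof.
apply/vn_leP => // i; rewrite mxE.
by case: (_ && _); rewrite ?nm1 ?nm0.
Qed.

Lemma vn_dist3 x y z : vn (x - z) <= vn (x - y) + vn (y - z).
Proof. by have := vnD io (x - y) (y - z); rewrite addrA subrK. Qed.

End RowNorm.

Section Sard.
Variables (R : realType) (C : numClosedFieldType) (io : complexification R C) (m : nat).
Notation nm := (nm io).
Notation vn := (vn io).
Let n := m.+1.
Implicit Types (x y : 'rV[C]_n).

Definition nowhere_dense (A : set 'rV[C]_n) := forall y0 (r : R), 0 < r ->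
  exists y1 (rho : R), [/\ vn (y1 - y0) < r, 0 < rho & forall a, A a -> rho <= vn (a - y1)].

Lemma trunc_close (a b : R) : 0 <= a -> 0 <= b -> Num.truncn a = Num.truncn b -> `|a - b| <= 1.
Proof.
move=> a0 b0 e; have /andP[h1 h2] := truncn_itv a0.
have /andP[h3 h4] := truncn_itv b0; rewrite e in h1 h2.
by rewrite -natr1 in h2 h4; rewrite ler_norml; lra.
Qed.

Lemma trunc_lt (a : R) (k : nat) : 0 <= a -> a < k%:R -> (Num.truncn a < k)%N.
Proof.
move=> a0 ak; have /andP[h1 _] := truncn_itv a0.
by rewrite -(ltr_nat R); apply: le_lt_trans ak.
Qed.

Lemma nm_sum (I : finType) (F : I -> C) : nm (\sum_i F i) <= \sum_i nm (F i).
Proof.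
elim/big_ind2 : _ => [|x1 x2 y1 y2 h1 h2|//]; first by rewrite nm0.
by apply: (le_trans (nmD _ _ _)); exact: lerD.
Qed.

Lemma nm_sum_le (k : nat) (G : 'I_k -> C) (K : R) : (forall i, nm (G i) <= K) ->
  nm (\sum_i G i) <= k%:R * K.
Proof.
move=> GK; apply: (le_trans (nm_sum _)).
have -> : k%:R * K = \sum_(i < k) K by rewrite sumr_const card_ord mulr_natl.
exact: ler_sum.
Qed.

(** Naturals at distance less than [N] are determined by their residues, which is how
    a coordinate is recovered from [N] possible values. *)
Lemma modn_close (a b N : nat) : (0 < N)%N -> `|a%:R - b%:R : R| < N%:R ->
  (a %% N = b %% N)%N -> a = b.
Proof.
wlog ab : a b / (a <= b)%N.
  move=> H N0 h e; have [ab|/ltnW ba] := leqP a b; first exact: H.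
  by apply/esym; apply: H => //; rewrite distrC.
move=> N0; rewrite distrC -natrB // normr_nat ltr_nat => h e.
have : b == a %[mod N] by apply/eqP.
rewrite eqn_mod_dvd // => dv; case: (posnP (b - a)%N) => [/eqP|p].
  by rewrite subn_eq0 => ba; apply/eqP; rewrite eqn_leq ab.
by have := dvdn_leq p dv; rewrite leqNgt h.
Qed.

(** With [n = k + 1], [N = E s] and [K = E s^2] the hypothesis compares the number [K^(2 n)]
    of target points with the number [(F N)^(2 n) N^(2 n - 2)] of available codes.
    The powers of [s] are [4 n] and [4 n - 2], so a large [s] makes it fail. *)
Lemma count_absurd (F E s k : nat) : (0 < E)%N ->
  s = (F ^ (2 * k.+1) * E ^ (2 * k)).+1 ->
  (((E * s ^ 2) ^ 2) ^ k.+1 <= ((F * (E * s)) ^ 2) ^ k.+1 * ((E * s) ^ 2) ^ k)%N -> False.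
Proof.
move=> E0 es; have s0 : (0 < s)%N by rewrite es.
have -> : (((E * s ^ 2) ^ 2) ^ k.+1 = (E * s) ^ (2 * k.+1) * (s ^ (2 * k) * s ^ 2))%N.
  rewrite [(s ^ (2 * k) * _)%N]mulnC -expnD -mulnS -expnMn -expnM.
  by rewrite -mulnA mulnn.
have -> : (((F * (E * s)) ^ 2) ^ k.+1 * ((E * s) ^ 2) ^ k =
   (E * s) ^ (2 * k.+1) * (s ^ (2 * k) * (F ^ (2 * k.+1) * E ^ (2 * k))))%N.
  rewrite -!expnM (expnMn F) (expnMn E s (2 * k)).
  move: (F ^ _)%N ((E * s) ^ _)%N (E ^ _)%N (s ^ _)%N => x y z t.
  by rewrite -mulnA mulnCA (mulnCA t) (mulnC t).
rewrite leq_pmul2l ?expn_gt0 ?muln_gt0 ?E0 ?s0 // leq_pmul2l ?expn_gt0 ?s0 //.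
have -> : (F ^ (2 * k.+1) * E ^ (2 * k) = s.-1)%N by rewrite es.
move=> h; have : (s <= s ^ 2)%N by rewrite -mulnn leq_pmulr.
by move=> /leq_trans /(_ h); rewrite -ltnS prednK // ltnn.
Qed.

Variables (T : Type) (P : set T) (psi ka : T -> 'rV[C]_n) (B L : R).
Hypothesis ka_bd : forall z, P z -> vn (ka z) <= B.
Hypothesis L1 : 1 <= L.
Hypothesis psi_lip : forall z w, P z -> P w -> vn (psi z - psi w) <= L * vn (ka z - ka w).
(* Near each w, the map psi stays quadratically close to a complex hyperplane,
   namely the kernel of the linear form lam, normalized to have a coefficient 1. *)
Hypothesis slab : forall w, P w -> exists (lam : 'I_n -> C) (j : 'I_n),
  [/\ lam j = 1, forall i, nm (lam i) <= 1 & forall z, P z ->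
    nm (\sum_i (psi z - psi w) 0 i * lam i) <= L * vn (ka z - ka w) ^+ 2].

(** The points [z] of [P] are parametrized by bounded vectors [ka z], divided into cells
    of side [1/N].  Were the image of [psi] dense in a ball, every point of a
    grid in it, of step [eta = c / N^2], would be approximated within [1/N^2].  Two grid
    points that come from the same cell differ by [O(1/N)], that is by less than [N]
    steps in each coordinate, and by [O(1/N^2)] in the direction [lam], which is less
    than one step.  So a grid point is determined by its cell and by the residues
    modulo [N] of all its coordinates but one.  Counting these codes gives a
    contradiction for large [N]. *)
Lemma sard_count : nowhere_dense (psi @` P).
Proof.
move=> y0 r r0; apply: contrapT => no.
have dense y : vn (y - y0) < r -> forall rho : R, 0 < rho ->
    exists z, P z /\ vn (psi z - y) < rho.
  move=> yr rho rho0; apply: contrapT => /forallNP h; apply: no.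
  exists y, rho; split => // _ [z Pz <-]; rewrite leNgt; apply/negP => zy.
  by apply: (h z).
have L1' := L1.
(* The step c / N^2 has to exceed the errors: 8 L bounds twice the quadratic term on
   a cell of diameter 2 / N, and 2 n two approximation errors paired with lam. *)
pose c : R := 8 * L + 2 * n%:R + 1.
have nR : 0 <= n%:R :> R by [].
have c0 : 0 < c by rewrite /c; lra.
pose E := (Num.bound (2 * c / r)).+1.
have Er : 2 * c / r < E%:R.
  apply: lt_trans (archi_boundP _) _; first by rewrite divr_ge0 ?mulr_ge0 // ltW.
  by rewrite ltr_nat.
pose B' := Num.bound `|B|; have B'B : B < B'%:R.
  by apply: le_lt_trans (ler_norm _) _; exact: archi_boundP.
pose F := (2 * B' + 1)%N.
pose s := (F ^ (2 * m.+1) * E ^ (2 * m)).+1.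
pose N := (E * s)%N; pose K := (E * s ^ 2)%N.
have N0 : (0 < N)%N by rewrite muln_gt0.
have NR : 0 < N%:R :> R by rewrite ltr0n.
have NR1 : 1 <= N%:R :> R by rewrite ler1n.
pose eta : R := c / N%:R ^+ 2.
have eta0 : 0 < eta by rewrite divr_gt0 // exprn_gt0.
have etaK : 2 * (eta * K%:R) < r.
  have -> : 2 * (eta * K%:R) = 2 * c / E%:R.
    rewrite /eta /K /N !natrM; field.
    by rewrite !pnatr_eq0 /E /s.
  by rewrite ltr_pdivrMr ?ltr0n // [ltRHS]mulrC -ltr_pdivrMr.
pose G := {ffun 'I_n -> 'I_K * 'I_K}.
pose off (g : G) : 'rV[C]_n :=
  \row_i (io eta * (io (g i).1%:R + 'i * io (g i).2%:R)).
have offr g : vn (off g) < r.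
  apply: le_lt_trans etaK; apply/vn_leP; first by rewrite !mulr_ge0 // ltW.
  move=> i; rewrite mxE nmM nm_ofR gtr0_norm // mulrCA ler_pM2l //.
  apply: (le_trans (nmD _ _ _)); rewrite nmM nmi mul1r !nm_ofR !normr_nat.
  by rewrite mulr_natl mulr2n; apply: lerD; rewrite ler_nat ltnW.
have N20 : 0 < (N%:R ^+ 2)^-1 :> R by rewrite invr_gt0 exprn_gt0.
have offy g : vn (y0 + off g - y0) < r by rewrite addrC addKr.
have [zz Hzz] := @choice G T (fun g z => P z /\
  vn (psi z - (y0 + off g)) < (N%:R ^+ 2)^-1) (fun g => dense _ (offy g) _ N20).
pose Q := (F * N)%N.
have Q0 : (0 < Q)%N by rewrite muln_gt0 N0 /F addn1.
pose cellT := {ffun 'I_n -> 'I_Q.-1.+1 * 'I_Q.-1.+1}.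
pose ce (x : R) : nat := Num.truncn (N%:R * (x + B'%:R)).
pose cell (z : T) : cellT := [ffun i => (inord (ce (re io (ka z 0 i))), inord (ce (im io (ka z 0 i))))].
have ce_ok (x : R) : `|x| <= B -> 0 <= N%:R * (x + B'%:R) /\ (ce x < Q.-1.+1)%N.
  rewrite ler_norml => /andP[x1 x2].
  have h : 0 <= N%:R * (x + B'%:R) by rewrite mulr_ge0 // ?ltW //; lra.
  split => //; rewrite prednK //; apply: trunc_lt => //.
  rewrite /Q /F natrM mulrC ltr_pM2r // natrD natrM; lra.
have ce_close (x x' : R) : `|x| <= B -> `|x'| <= B ->
    (inord (ce x) : 'I_Q.-1.+1) = inord (ce x') -> `|x - x'| <= N%:R^-1.
  move=> /ce_ok [x0 xQ] /ce_ok [x'0 x'Q] /(congr1 val); rewrite /= !inordK //.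
  move=> /(trunc_close x0 x'0).
  rewrite -mulrBr (_ : x + B'%:R - _ = x - x'); last by ring.
  by rewrite normrM gtr0_norm // mulrC -ler_pdivlMr // div1r.
have reB z i : P z -> `|re io (ka z 0 i)| <= B /\ `|im io (ka z 0 i)| <= B.
  move=> Pz; have h := le_trans (vn_coord io (ka z) i) (ka_bd Pz).
  by split; apply: le_trans h; [exact: re_le|exact: im_le].
have cellP z w : P z -> P w -> cell z = cell w -> vn (ka z - ka w) <= 2 / N%:R.
  move=> Pz Pw e; apply/vn_leP => [|i]; first by rewrite divr_ge0 // ltW.
  have := congr1 (fun h : cellT => h i) e; rewrite !ffunE => -[e1 e2].
  have [z1 z2] := reB z i Pz; have [w1 w2] := reB w i Pw.
  apply: (le_trans (nm_le_reim io _)); rewrite !mxE !raddfB /= mulrDl mul1r.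
  by apply: lerD; [exact: ce_close e1|exact: ce_close e2].
pose u : R := N%:R^-1; have u0 : 0 < u by rewrite invr_gt0.
have u1 : u <= 1 by rewrite invf_le1.
have Nu2 : (N%:R ^+ 2)^-1 = u ^+ 2 by rewrite exprVn.
have uu : u ^+ 2 <= u by rewrite expr2 -[leRHS]mul1r ler_wpM2r // ltW.
have etaN : eta * N%:R = c * u by rewrite /eta /u; field; rewrite gt_eqF.
have offB g g' i : (off g - off g') 0 i = io eta *
   (io ((g i).1%:R - (g' i).1%:R) + 'i * io ((g i).2%:R - (g' i).2%:R)).
  by rewrite !mxE !rmorphB /=; ring.
have off_re (g g' : G) i : eta * `|(g i).1%:R - (g' i).1%:R| <= nm ((off g - off g') 0 i).
  rewrite offB nmM nm_ofR (gtr0_norm eta0) ler_pM2l //.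
  by set z : C := _ + 'i * _; have := re_le io z; rewrite re_rect.
have off_im (g g' : G) i : eta * `|(g i).2%:R - (g' i).2%:R| <= nm ((off g - off g') 0 i).
  rewrite offB nmM nm_ofR (gtr0_norm eta0) ler_pM2l //.
  by set z : C := _ + 'i * _; have := im_le io z; rewrite im_rect.
pose d g := psi (zz g) - (y0 + off g).
have dlt g : vn (d g) <= (N%:R ^+ 2)^-1 by apply: ltW; exact: (Hzz g).2.
have offE g g' : off g - off g' = psi (zz g) - psi (zz g') - (d g - d g').
  rewrite /d; move: (psi (zz g)) (psi (zz g')) => a b.
  by apply/rowP => i; rewrite !mxE; ring.
have close (g g' : G) i : cell (zz g) = cell (zz g') ->
    `|(g i).1%:R - (g' i).1%:R : R| < N%:R /\ `|(g i).2%:R - (g' i).2%:R : R| < N%:R.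
  move=> e; have h : nm ((off g - off g') 0 i) < eta * N%:R.
    apply: le_lt_trans (vn_coord io _ i) _; rewrite offE.
    apply: le_lt_trans (vnB _ _ _) _; have := psi_lip (Hzz g).1 (Hzz g').1.
    have := cellP _ _ (Hzz g).1 (Hzz g').1 e; have := vnB io (d g) (d g').
    have := dlt g; have := dlt g'; rewrite Nu2 etaN.
    set X := vn (ka _ - ka _); set Y := vn (d g - d g') => l1 l2 l3 l4 l5.
    have : L * X <= L * (2 * u) by rewrite ler_wpM2l //; lra.
    rewrite /c mulrDl mulrDl mul1r; have : 0 <= 2 * n%:R * u by rewrite !mulr_ge0 // ltW.
    have : 1 * u <= L * u by rewrite ler_wpM2r // ltW.
    by lra.
  by split; rewrite -(ltr_pM2l eta0); apply: le_lt_trans h.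
have S (lam : 'I_n -> C) x : (forall i, nm (lam i) <= 1) ->
    nm (\sum_i x 0 i * lam i) <= n%:R * vn x.
  move=> l1; apply: nm_sum_le => i; rewrite nmM -[leRHS]mulr1.
  by apply: ler_pM; rewrite ?nm_ge0 // vn_coord.
(* The coordinate of a grid point that is recovered from the others depends on the
   cell only; it is the one where lam has the coefficient 1. *)
have jex (cl : cellT) : exists j : 'I_n, forall g g', cell (zz g) = cl ->
    cell (zz g') = cl -> (forall i, i != j -> g i = g' i) -> g j = g' j.
  have [[g0 e0]|no0] := pselect (exists g, cell (zz g) = cl); last first.
    by exists ord0 => g g' e; exfalso; apply: no0; exists g.
  have [lam [j [lj l1 sl]]] := slab (Hzz g0).1; exists j => g g' e e' gg'.
  have sg h : cell (zz h) = cl ->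
      nm (\sum_i (psi (zz h) - psi (zz g0)) 0 i * lam i) <= L * (2 / N%:R) ^+ 2.
    move=> eh; apply: (le_trans (sl _ (Hzz h).1)); rewrite ler_pM2l; last by lra.
    have q0 : 0 <= 2 / N%:R :> R by rewrite divr_ge0 // ltW.
    have hq := cellP _ _ (Hzz h).1 (Hzz g0).1 (etrans eh (esym e0)).
    by rewrite lerXn2r // nnegrE ?vn_ge0.
  have E1 : (off g - off g') 0 j = \sum_i (off g - off g') 0 i * lam i.
    rewrite (bigD1 j) //= lj mulr1 big1 ?addr0 // => i ij.
    by rewrite offB gg' // !subrr rmorph0 mulr0 addr0 mulr0 mul0r.
  have E2 : \sum_i (off g - off g') 0 i * lam i =
     \sum_i (psi (zz g) - psi (zz g0)) 0 i * lam i
     - \sum_i (psi (zz g') - psi (zz g0)) 0 i * lam i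
     - (\sum_i (d g) 0 i * lam i - \sum_i (d g') 0 i * lam i).
    rewrite -!sumrB; apply: eq_bigr => i _; rewrite offE !mxE; ring.
  have h : nm ((off g - off g') 0 j) < eta.
    rewrite E1 E2; apply: le_lt_trans (nmB _ _ _) _.
    have m1 := nmB io (\sum_i (psi (zz g) - psi (zz g0)) 0 i * lam i)
       (\sum_i (psi (zz g') - psi (zz g0)) 0 i * lam i).
    have m2 := nmB io (\sum_i (d g) 0 i * lam i) (\sum_i (d g') 0 i * lam i).
    have m3 := sg _ e; have m4 := sg _ e'.
    have m5 := S lam (d g) l1; have m6 := S lam (d g') l1.
    have m7 : n%:R * vn (d g) <= n%:R * u ^+ 2 by rewrite ler_wpM2l // -Nu2.
    have m8 : n%:R * vn (d g') <= n%:R * u ^+ 2 by rewrite ler_wpM2l // -Nu2.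
    rewrite exprMn -/u in m3 m4.
    have -> : eta = 8 * L * u ^+ 2 + 2 * n%:R * u ^+ 2 + u ^+ 2 by rewrite /eta Nu2 /c; ring.
    have : 0 < u ^+ 2 by rewrite exprn_gt0.
    by lra.
  have one (a b : nat) : eta * `|a%:R - b%:R| < eta -> a = b.
    move=> k; apply: (@modn_close a b 1) => //; last by rewrite !modn1.
    by rewrite -(ltr_pM2l eta0) mulr1.
  have k1 := one _ _ (le_lt_trans (off_re g g' j) h).
  have k2 := one _ _ (le_lt_trans (off_im g g' j) h).
  by case: (g j) (g' j) k1 k2 => a b [a' b'] /= /val_inj -> /val_inj ->.
have [J HJ] := choice jex.
pose resT := {ffun 'I_m -> 'I_N.-1.+1 * 'I_N.-1.+1}.
pose f (g : G) : cellT * resT := (cell (zz g),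
  [ffun i => (inord ((g (lift (J (cell (zz g))) i)).1 %% N),
              inord ((g (lift (J (cell (zz g))) i)).2 %% N))]).
have finj : injective f.
  move=> g g' [e /ffunP er].
  have eq_lift i : g (lift (J (cell (zz g))) i) = g' (lift (J (cell (zz g))) i).
    have := er i; rewrite !ffunE -e => -[] /(congr1 val) + /(congr1 val).
    rewrite /= !inordK ?prednK ?ltn_pmod // => e1 e2.
    have [k1 k2] := close g g' (lift (J (cell (zz g))) i) e.
    have := modn_close N0 k1 e1; have := modn_close N0 k2 e2.
    by case: (g _) (g' _) => a b [a' b'] /= /val_inj -> /val_inj ->.
  have eq_ne i : i != J (cell (zz g)) -> g i = g' i.
    by case: (unliftP (J (cell (zz g))) i) => [k -> _|->]; rewrite ?eqxx.
  apply/ffunP => i; have [->|/eq_ne //] := eqVneq i (J (cell (zz g))).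
  exact: (HJ (cell (zz g))).
have := leq_card f finj.
rewrite card_prod !card_ffun !card_prod !card_ord !prednK // !mulnn.
exact: (@count_absurd F E s m).
Qed.

End Sard.

(** * Meagre sets and Baire's theorem *)
Section Baire.
Variables (R : realType) (C : numClosedFieldType) (io : complexification R C) (m : nat).
Notation nm := (nm io).
Notation vn := (vn io).
Notation V := ('rV[C]_m.+1).
Notation nowhere_dense := (@nowhere_dense R C io m).

Definition meagre (A : set V) := exists B : nat -> set V,
  (forall k, nowhere_dense (B k)) /\ A `<=` \bigcup_k B k.

Lemma nowhere_denseS (A B : set V) : A `<=` B -> nowhere_dense B -> nowhere_dense A.
Proof.
move=> AB h y0 r r0; have [y1 [rho [h1 h2 h3]]] := h y0 r r0.
by exists y1, rho; split => // a /AB; exact: h3.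
Qed.

Lemma nowhere_dense0 : nowhere_dense set0.
Proof. by move=> y0 r r0; exists y0, 1; split => //; rewrite subrr vn0. Qed.

Lemma meagre_bigcup (A : nat -> set V) : (forall k, meagre (A k)) ->
  meagre (\bigcup_k A k).
Proof.
move=> /choice [B HB].
exists (fun i => if unpickle i is Some (k, l) then B k l else set0); split.
  move=> i; case: unpickle => [[k l]|]; last exact: nowhere_dense0.
  exact: (HB k).1.
move=> x [k _ /(HB k).2 [l _ xB]]; exists (pickle (k, l)) => //.
by rewrite pickleK.
Qed.

Theorem baire (A : set V) : meagre A -> forall y0 (r : R), 0 < r ->
  exists y, vn (y - y0) < r /\ ~ A y.
Proof.
move=> [B [ndB AB]] y0 r r0.
(* The limit of the balls is only known to lie within twice the radius of each
   centre, hence the margin of three radii. *)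
have step (s : nat * (V * R)) : exists s' : V * R, 0 < s.2.2 ->
   [/\ 0 < s'.2, vn (s'.1 - s.2.1) + s'.2 <= s.2.2 &
     forall a, B s.1 a -> 3 * s'.2 <= vn (a - s'.1)].
  have [s0|s0] := ltrP 0 s.2.2; last by exists s.2.
  have s2 : 0 < s.2.2 / 2 by rewrite divr_gt0.
  have [y1 [rho [h1 h2 h3]]] := ndB s.1 s.2.1 _ s2.
  exists (y1, Num.min (s.2.2 / 2) (rho / 3)) => _ /=.
  have le1 : Num.min (s.2.2 / 2) (rho / 3) <= s.2.2 / 2 by rewrite ge_min lexx.
  have le2 : Num.min (s.2.2 / 2) (rho / 3) <= rho / 3 by rewrite ge_min lexx orbT.
  split; first by rewrite lt_min s2 divr_gt0.
    by lra.
  by move=> a /h3; lra.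
have [next Hnext] := choice step.
pose st := fix st k := if k is k'.+1 then next (k', st k') else (y0, r / 3).
have st0 k : 0 < (st k).2.
  by elim: k => [|k IH] /=; [rewrite divr_gt0|have [] := Hnext (k, st k) IH].
have stS k : vn ((st k.+1).1 - (st k).1) + (st k.+1).2 <= (st k).2.
  by have [] := Hnext (k, st k) (st0 k).
have st_mono k l : vn ((st (k + l)%N).1 - (st k).1) + (st (k + l)%N).2 <= (st k).2.
  elim: l => [|l IH]; first by rewrite addn0 subrr vn0 add0r.
  rewrite addnS; have := stS (k + l)%N.
  by have := vn_dist3 io (st (k + l).+1).1 (st (k + l)%N).1 (st k).1; lra.
have coord (g : {additive C -> R}) : (forall z, `|g z| <= nm z) -> forall i,
    exists x : R, forall k, g ((st k).1 0 i) - (st k).2 <= x <= g ((st k).1 0 i) + (st k).2.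
  move=> gn i; apply: nested_point => k l.
  have c1 := st_mono k l; have c2 := st_mono l k; rewrite addnC in c2.
  have d1 := le_trans (gn _) (vn_coord io ((st (k + l)%N).1 - (st k).1) i).
  have d2 := le_trans (gn _) (vn_coord io ((st (k + l)%N).1 - (st l).1) i).
  have p := st0 (k + l)%N.
  move: d1 d2; rewrite !mxE !raddfB !ler_norml => /andP[d1 d1'] /andP[d2 d2'].
  by lra.
have [a Ha] := choice (coord _ (re_le io)).
have [b Hb] := choice (coord _ (im_le io)).
pose y : V := \row_i (io (a i) + 'i * io (b i)).
have yk k : vn (y - (st k).1) <= 2 * (st k).2.
  apply/vn_leP => [|i]; first by rewrite mulr_ge0 // ltW.
  apply: (le_trans (nm_le_reim io _)); rewrite !mxE !raddfB /= -/re re_rect im_rect.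
  have := Ha i k; have := Hb i k => /andP[b1 b2] /andP[a1 a2].
  by rewrite mulr_natl mulr2n; apply: lerD; rewrite ler_norml; lra.
exists y; split; first by have := yk 0%N; rewrite /=; lra.
move=> /AB [k _ Bk]; have [_ _ /(_ _ Bk)] := Hnext (k, st k) (st0 k).
have := yk k.+1; have := st0 k.+1; rewrite /= => *; lra.
Qed.

Lemma dense_rows : exists D : {ffun 'I_m.+1 -> rat * rat} -> V,
  forall x (e : R), 0 < e -> exists f, vn (D f - x) < e.
Proof.
exists (fun f => \row_i (io (ratr (f i).1) + 'i * io (ratr (f i).2))) => x e e0.
have ex (y : R) : exists q : rat, `|ratr q - y| <= e / 4.
  have [|q] := @rat_in_itvoo _ (y - e / 4) (y + e / 4); first by lra.
  by rewrite in_itv /= => /andP[q1 q2]; exists q; rewrite ler_norml; lra.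
have [q Hq] := choice ex.
exists [ffun i => (q (re io (x 0 i)), q (im io (x 0 i)))].
apply: (@le_lt_trans _ _ (e / 2)); last by lra.
apply/vn_leP => [|i]; first by rewrite divr_ge0 // ltW.
apply: (le_trans (nm_le_reim io _)); rewrite !mxE !ffunE !raddfB /= re_rect im_rect.
by have := Hq (re io (x 0 i)); have := Hq (im io (x 0 i)); lra.
Qed.

(** A local property that passes to subsets holds on the members of a countable cover,
    taken among the balls with rational centres and radii [1 / (l + 1)]. *)
Lemma lindelof (good : set V -> Prop) (P : set V) : good set0 ->
  (forall A B : set V, A `<=` B -> good B -> good A) ->
  (forall x, P x -> exists2 r : R, 0 < r & good [set y | P y /\ vn (y - x) < r]) ->
  exists B : nat -> set V, P `<=` \bigcup_k B k /\ forall k, good (B k).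
Proof.
move=> g0 gS loc; have [D HD] := dense_rows.
pose U (i : {ffun 'I_m.+1 -> rat * rat} * nat) : set V :=
  [set y | P y /\ vn (y - D i.1) < i.2.+1%:R^-1].
exists (fun k => if unpickle k is Some i then
   (if pselect (good (U i)) is left _ then U i else set0) else set0).
split=> [x Px|k]; last by case: unpickle => // i; case: pselect.
have [r r0 gr] := loc x Px.
have [l hl] : exists l : nat, l.+1%:R^-1 < r / 2.
  exists (Num.bound (r / 2)^-1); rewrite -[ltRHS]invrK ltf_pV2 ?posrE ?ltr0n ?invr_gt0 ?divr_gt0 //.
  apply: lt_trans (archi_boundP _) _; first by rewrite invr_ge0 divr_ge0 // ltW.
  by rewrite ltr_nat.
have l0 : 0 < l.+1%:R^-1 :> R by rewrite invr_gt0 ltr0n.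
have [f hf] := HD x _ l0.
exists (pickle (f, l)) => //; rewrite pickleK.
have xU : U (f, l) x by split => //=; rewrite vn_distC.
case: pselect => // -[]; apply: gS gr => y [Py yD]; split => //.
have yD' : vn (y - D f) < l.+1%:R^-1 := yD.
apply: le_lt_trans (vn_dist3 io y (D f) x) _; rewrite [r]splitr.
by apply: ltrD; [exact: lt_trans yD' hl|exact: lt_trans hf hl].
Qed.

(** The images [Psi A] of interest are those of [A] under a map, or the sums of such
    an image with a disc. *)
Lemma meagre_local (Psi : set V -> set V) (P : set V) :
  Psi set0 `<=` set0 -> (forall A B : set V, A `<=` B -> Psi A `<=` Psi B) ->
  (forall B : nat -> set V, Psi (\bigcup_k B k) `<=` \bigcup_k Psi (B k)) ->
  (forall x, P x -> exists2 r : R, 0 < r &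
     nowhere_dense (Psi [set y | P y /\ vn (y - x) < r])) -> meagre (Psi P).
Proof.
move=> P0 PS PU loc.
have [||B [PB HB]] := @lindelof (fun A => nowhere_dense (Psi A)) P _ _ loc.
- exact: nowhere_denseS P0 nowhere_dense0.
- by move=> A B AB; apply: nowhere_denseS; exact: PS.
by exists (fun k => Psi (B k)); split => //; apply: subset_trans (PU B); exact: PS.
Qed.

End Baire.

(** * Countable atlases of connected manifolds *)
Section CountableAtlas.
Variables (R : realType) (C : numClosedFieldType) (io : complexification R C) (m : nat).
Notation vn := (vn io).
Notation V := ('rV[C]_m.+1).
Variable S : complexManifold C m.+1.

Lemma chart_ball (e : chart C m.+1 S) (p : S) (U : set S) : chart_dom e p -> open U -> U p ->
  exists2 r : R, 0 < r & forall y, vn (y - chart_map e p) < r ->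
    chart_cod e y /\ U (chart_inv e y).
Proof. by move=> ep oU Up; have := chart_inv_near ep oU Up; move=> /(nbhs_vn io). Qed.

(** A locally finite family has countably many members that meet a set contained in
    one chart, since such a set has the Lindelof property. *)
Lemma meets_countable (D : set (set S)) (e : chart C m.+1 S) (B : set S) :
  locally_finite D -> B `<=` chart_dom e ->
  countable [set B' | D B' /\ B' `&` B !=set0].
Proof.
move=> lf Be; pose P := [set x | chart_cod e x /\ B (chart_inv e x)].
pose good (A : set V) := countable [set B' | D B' /\ exists2 x, A x & B' (chart_inv e x)].
have [|||A [PA HA]] := @lindelof _ _ io m good P.
- by apply: sub_countable (countable0 _); apply: subset_card_le => B' [_ [x []]].
- move=> A A' AA'; apply: sub_countable; apply: subset_card_le => B' [DB [x Ax Bx]].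
  by split => //; exists x => //; exact: AA'.
- move=> x [cx _]; have [N Np fN] := lf (chart_inv e x).
  have ep := chart_inv_dom cx.
  have [r r0 Hr] := chart_ball ep (@open_interior _ N) Np.
  rewrite chart_invK // in Hr; exists r => //.
  apply: sub_countable (finite_set_countable fN); apply: subset_card_le.
  move=> B' [DB [y [_ yr] By]]; split => //; exists (chart_inv e y); split => //.
  by have [_ /interior_subset] := Hr y yr.
apply: (@sub_countable _ _ _ (\bigcup_k [set B' | D B' /\ exists2 x, A k x & B' (chart_inv e x)])).
  apply: subset_card_le => B' [DB [p [B'p Bp]]].
  have ep := Be p Bp.
  have /PA [k _ Ak] : P (chart_map e p).
    by split; [exact: chart_map_cod|rewrite chart_mapK].
  by exists k => //; split => //; exists (chart_map e p) => //; rewrite chart_mapK.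
by apply: bigcup_countable => // k _; exact: HA.
Qed.

(** In a locally finite refinement of the cover by chart domains, the members reached
    from a given one by finite chains of intersecting members are countably many.
    Their union and the union of the other members are open and disjoint. *)
Theorem countable_atlas (p0 : S) : connected [set: S] ->
  exists e : nat -> chart C m.+1 S, (forall k, atlas (e k)) /\
    forall p, exists k, chart_dom (e k) p.
Proof.
move=> conS; have [||D [oD cD rD lf]] := @mfd_paracompact _ _ S
   [set A | exists2 e : chart C m.+1 S, atlas e & A = chart_dom e].
- by move=> _ [e _ ->]; exact: chart_dom_open.
- apply/seteqP; split => // p _; have [e [ae ep]] := atlas_cover p.
  by exists (chart_dom e) => //; exists e.
have [e0 [ae0 _]] := atlas_cover p0.
have ce (B : set S) : exists e : chart C m.+1 S, atlas e /\ (D B -> B `<=` chart_dom e).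
  have [DB|nDB] := pselect (D B); last by exists e0.
  by have [_ [e ae ->] Be] := rD B DB; exists e.
have [ch Hch] := choice ce.
have cov p : exists2 B, D B & B p by have : [set: S] p by []; rewrite -cD => -[B DB Bp]; exists B.
have [B0 DB0 Bp0] := cov p0.
pose Rch := fix Rch k := if k is k'.+1 then
   \bigcup_(B in Rch k') [set B' | D B' /\ B' `&` B !=set0] else [set B0].
have RD k : Rch k `<=` D by case: k => [B ->//|k B [A _ []]].
have Rc k : countable (Rch k).
  elim: k => [|k IH] /=; first exact: countable1.
  apply: bigcup_countable => // B RB; apply: (@meets_countable _ (ch B)) => //.
  by apply: (Hch B).2; exact: RD RB.
pose RR := \bigcup_k Rch k.
have RRc : countable RR by apply: bigcup_countable.
have all_p : forall p, exists2 B, RR B & B p.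
  pose U := [set p | exists2 B, RR B & B p].
  suff UT : U = [set: S] by move=> p; have : [set: S] p by []; rewrite -UT.
  have oU : open U.
    have -> : U = \bigcup_(B in RR) B by [].
    by apply: bigcup_open => B [k _ RB]; apply: oD; exact: RD RB.
  have oUc : open (~` U).
    have -> : ~` U = \bigcup_(B in D `\` RR) B.
      apply/seteqP; split => p.
        move=> nU; have [B DB Bp] := cov p; exists B => //; split => // RB.
        by apply: nU; exists B.
      move=> [B [DB nRB] Bp] [B' [k _ RB'] B'p]; apply: nRB; exists k.+1 => //.
      by exists B' => //; split => //; exists p.
    by apply: bigcup_open => B [DB _]; exact: oD.
  apply: conS; first by exists p0; exists B0 => //; exists 0%N.
    by exists U => //; rewrite setTI.
  by exists U; rewrite ?setTI // -openC.
have /countable_injP [f finj] := RRc.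
pose e k := if pselect (exists2 B, RR B & f B = k) is left h
  then ch (projT1 (cid2 h)) else e0.
exists e; split=> [k|p].
  by rewrite /e; case: pselect => // h; exact: (Hch _).1.
have [B RB Bp] := all_p p; exists (f B); rewrite /e; case: pselect => [h|[]]; last by exists B.
case: cid2 => B' /= RB' fB'.
have -> : B' = B by apply: finj; rewrite ?inE.
by apply: (Hch B).2 => //; have [k _ RkB] := RB; exact: RD RkB.
Qed.

End CountableAtlas.

(** * Local images of strata *)
Section LinearAlgebra.
Variables (F : fieldType) (n : nat).

(** Linear form of the dimension count.  The rows of [J] are the values of [d phi] on
    the coordinate vectors and [g] is a differential whose Hamiltonian vector [Q g] is
    killed by [d phi].  The vector [Q g] is tangent to [ker g], as [Q] is skew, so
    [d phi] sends [ker g] to a space of codimension at least two; the resulting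
    [lam] is a linear form that kills this image and moreover [v]. *)
Lemma kernel_direction (Q J : 'M[F]_n) (g : 'cV[F]_n) (v : 'rV[F]_n) :
  Q \in unitmx -> Q^T = - Q -> (2 : F) != 0 -> g != 0 -> J^T *m Q *m g = 0 ->
  exists (lam : 'cV[F]_n) (s : F), [/\ lam != 0, J *m lam = s *: g & v *m lam = 0].
Proof.
move=> Qu Qs two g0 h.
pose mu : 'rV[F]_n := (Q *m g)^T.
have muJ : mu *m J = 0 by rewrite /mu -[J]trmxK -trmx_mul mulmxA h trmx0.
have mug : mu *m g = 0.
  have h1 : (mu *m g)^T = g^T *m Q *m g by rewrite trmx_mul /mu trmxK mulmxA.
  have h2 : mu *m g = - (g^T *m Q *m g) by rewrite /mu trmx_mul Qs mulmxN mulNmx.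
  have h3 : mu *m g = (mu *m g)^T by rewrite [mu *m g]mx11_scalar tr_scalar_mx.
  have e : mu *m g = - (mu *m g) by rewrite {1}h2 -h1 -h3.
  apply/eqP; have : (mu *m g) *+ 2 == 0 by rewrite mulr2n {1}e addNr.
  by rewrite -scaler_nat scaler_eq0 (negbTE two).
have mu0 : mu != 0.
  apply: contra g0 => /eqP e; have : Q *m g = 0 by rewrite -[Q *m g]trmxK -/mu e trmx0.
  by move=> /(congr1 (mulmx (invmx Q))); rewrite mulKmx // mulmx0 => ->.
(* A kernel vector (lam, s) of this matrix solves both equations at once, and
   the row (mu, 0) shows that the matrix is singular. *)
pose B : 'M[F]_(n + 1) := block_mx J (- g) v 0.
have Bs : \det B = 0.
  apply/eqP/det0P; exists (row_mx mu 0).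
    by rewrite row_mx_eq0 negb_and mu0.
  by rewrite mul_row_block muJ mulmxN mug oppr0 !mul0mx !addr0 row_mx0.
have /eqP := Bs; rewrite -det_tr => /det0P [w w0 Bw].
have Bw' : B *m w^T = 0 by rewrite -[B]trmxK -trmx_mul Bw trmx0.
rewrite -[w^T]vsubmxK mul_block_col in Bw'.
have /eqP := Bw'; rewrite col_mx_eq0 => /andP[/eqP e1 /eqP e2].
set lam := usubmx _ in e1 e2; set t := dsubmx w^T in e1 e2.
exists lam, (t 0 0); split.
- apply: contra w0 => /eqP l0; rewrite -trmx_eq0 -[w^T]vsubmxK -/lam -/t.
  move: e1; rewrite l0 mulmx0 add0r mulNmx => /eqP; rewrite oppr_eq0.
  rewrite [t]mx11_scalar mul_mx_scalar scaler_eq0 (negbTE g0) orbF => /eqP ->.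
  by rewrite -scalemx1 scale0r col_mx0.
- have /eqP := e1; rewrite mulNmx subr_eq0 => /eqP ->.
  by rewrite [t in LHS]mx11_scalar mul_mx_scalar.
- by rewrite mul0mx addr0 in e2.
Qed.

Lemma kernel_singular (J : 'M[F]_n) : \det J = 0 ->
  exists2 lam : 'cV[F]_n, lam != 0 & J *m lam = 0.
Proof.
rewrite -det_tr => /eqP /det0P [w w0 h]; exists w^T; first by rewrite trmx_eq0.
by rewrite -[J]trmxK -trmx_mul h trmx0.
Qed.

End LinearAlgebra.

Lemma differentiable_bigsum (C : numClosedFieldType) (V : normedModType C)
    (I : Type) (s : seq I) (f : I -> V -> C) x :
  (forall i, differentiable (f i) x) -> differentiable (fun y => \sum_(i <- s) f i y) x.
Proof.
move=> df; elim: s => [|a s IH].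
  have -> : (fun y => \sum_(i <- [::]) f i y) = cst 0 by apply/funext => y; rewrite big_nil.
  exact: differentiable_cst.
have -> : (fun y => \sum_(i <- a :: s) f i y) = f a \+ (fun y => \sum_(i <- s) f i y).
  by apply/funext => y; rewrite big_cons.
exact: differentiableD.
Qed.

Section LocalSard.
Variables (R : realType) (C : numClosedFieldType) (io : complexification R C) (m : nat).
Notation nm := (nm io).
Notation vn := (vn io).
Notation n := m.+1.
Notation V := ('rV[C]_m.+1).

Lemma derive_partial (g : V -> C) (x h : V) : differentiable g x ->
  'D_h g x = \sum_k h 0 k * partial k g x.
Proof.
move=> dg; rewrite deriveE // {1}[h]row_sum_delta linear_sum /=.
by apply: eq_bigr => k _; rewrite linearZ /= /partial deriveE.
Qed.

Lemma differentiable_entry (t : V -> V) (x : V) a : differentiable t x ->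
  differentiable (fun y => t y 0 a) x.
Proof.
move=> dt; apply: (@differentiable_comp _ _ _ _ t (fun y : V => y 0 a)) => //.
exact: differentiable_coord.
Qed.

Lemma diff_entry (x u : V) a : 'd (fun y : V => y 0 a) x u = u 0 a.
Proof.
have @f : {linear V -> C}.
  by exists (fun N : V => N 0 a); do 2![eexists]; do ?[constructor];
     rewrite ?mxE// => ? *; rewrite ?mxE//; move=> ?; rewrite !mxE.
have fc : continuous f by exact: coord_continuous.
by have := diff_lin x fc; rewrite (_ : (fun _ => _) = f) // => ->.
Qed.

Lemma jacobian_entry (t : V -> V) (x : V) k a : differentiable t x ->
  'J t x k a = partial k (fun y => t y 0 a) x.
Proof.
move=> dt; have dc y : differentiable (fun z : V => z 0 a) y by exact: differentiable_coord.
rewrite /partial deriveE; last exact: differentiable_entry.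
have := diff_comp dt (dc (t x)); rewrite /comp => -> /=.
by rewrite diff_entry /jacobian /lin1_mx mxE.
Qed.

(** Divide by the entry of largest modulus. *)
Lemma normalize (lam : 'cV[C]_n) : lam != 0 ->
  exists (c : C) (j : 'I_n), (c *: lam) j 0 = 1 /\ forall i, nm ((c *: lam) i 0) <= 1.
Proof.
move=> l0; pose j := [arg max_(i > ord0) nm (lam i 0)]%O.
have jmax i : nm (lam i 0) <= nm (lam j 0).
  by rewrite /j; case: arg_maxP => // k _; apply.
have lj : lam j 0 != 0.
  apply: contra l0 => /eqP e; apply/eqP/colP => i; rewrite mxE; apply/eqP.
  by rewrite -(nm_eq0 io) eq_le nm_ge0 andbT -(nm0 io) -e.
exists (lam j 0)^-1, j; split=> [|i]; rewrite mxE ?mulVf //.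
by rewrite nmM nmV mulrC ler_pdivrMr ?nm_gt0 // mul1r.
Qed.

Lemma uniform_constants (k : nat) (Phi : 'I_k -> R -> R -> Prop) :
  (forall i, exists r K : R, 0 < r /\ forall r' K', 0 < r' -> r' <= r -> K <= K' -> Phi i r' K') ->
  exists r K : R, 0 < r /\ forall i r' K', 0 < r' -> r' <= r -> K <= K' -> Phi i r' K'.
Proof.
move=> /choice [r /choice [K H]].
have r0 i : 0 < r i := (H i).1.
have sr : 0 < \sum_i (r i)^-1 + 1.
  by rewrite ltr_wpDl // sumr_ge0 // => i _; rewrite invr_ge0 ltW.
exists (\sum_i (r i)^-1 + 1)^-1, (\sum_i `|K i|); split; first by rewrite invr_gt0.
move=> i r' K' r'0 r'r KK; apply: (H i).2 => //.
  apply: (le_trans r'r); rewrite -[leRHS]invrK lef_pV2 ?posrE ?invr_gt0 //.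
  rewrite (bigD1 i) //= -addrA lerDl addr_ge0 // sumr_ge0 // => j _.
  by rewrite invr_ge0 ltW.
apply: le_trans KK; rewrite (bigD1 i) //=; apply: (le_trans (ler_norm _)).
by rewrite lerDl sumr_ge0.
Qed.

(** Uniform second-order estimates: Taylor remainder, Lipschitz bound and bound
    of the differential. *)
Definition c2_on (f : V -> C) (x0 : V) (r K : R) := forall z w : V,
  vn (z - x0) < r -> vn (w - x0) < r ->
  [/\ nm (f z - f w - 'D_(z - w) f w) <= K * vn (z - w) ^+ 2,
      nm (f z - f w) <= K * vn (z - w) & forall h, nm ('D_h f w) <= K * vn h].

(** The pairing of an increment of [f] with [lam] is that of the increment of the
    variable with [J lam], up to a quadratic error. *)
Lemma linear_part (f : V -> V) (x0 z w : V) (r K : R) (lam : 'cV[C]_n) :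
  (forall i, c2_on (fun y => f y 0 i) x0 r K) -> differentiable f w ->
  vn (z - x0) < r -> vn (w - x0) < r -> (forall i, nm (lam i 0) <= 1) ->
  nm (\sum_i (f z - f w) 0 i * lam i 0 - \sum_a (z - w) 0 a * ('J f w *m lam) a 0)
    <= n%:R * (K * vn (z - w) ^+ 2).
Proof.
move=> c2 df zr wr l1; pose err i := f z 0 i - f w 0 i - 'D_(z - w) (fun y => f y 0 i) w.
suff -> : \sum_i (f z - f w) 0 i * lam i 0 - \sum_a (z - w) 0 a * ('J f w *m lam) a 0 =
    \sum_i err i * lam i 0.
  apply: nm_sum_le => i; rewrite nmM -[leRHS]mulr1.
  by apply: ler_pM; rewrite ?nm_ge0 //; have [] := c2 i _ _ zr wr.
have -> : \sum_a (z - w) 0 a * ('J f w *m lam) a 0 =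
    \sum_i 'D_(z - w) (fun y => f y 0 i) w * lam i 0.
  transitivity (\sum_a \sum_i (z - w) 0 a * 'J f w a i * lam i 0).
    by apply: eq_bigr => a _; rewrite [(_ *m lam) a 0]mxE mulr_sumr; apply: eq_bigr => i _; rewrite mulrA.
  rewrite exchange_big /=; apply: eq_bigr => i _; rewrite -mulr_suml; congr (_ * _).
  rewrite derive_partial; last exact: differentiable_entry.
  by apply: eq_bigr => a _; rewrite (jacobian_entry _ _ df).
rewrite -sumrB; apply: eq_bigr => i _; rewrite -mulrBl; congr (_ * _).
by rewrite /err [X in X - _]mxE [X in _ + X - _]mxE.
Qed.

Lemma c2_local (f : V -> C) (x0 : V) : nholo f x0 ->
  exists r K : R, 0 < r /\ forall r' K', 0 < r' -> r' <= r -> K <= K' -> c2_on f x0 r' K'.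
Proof.
move=> /(holo_bd_local io) [r [M [r0 H]]].
have M0 := holo_bd_ge0 r0 H.
pose K := 16 * M / (r / 2) ^+ 2 + 8 * M / (r / 2) + 4 * M / (r / 2).
exists (r / 16), K; split; first by rewrite divr_gt0.
have r2 : 0 < r / 2 by rewrite divr_gt0.
have k1 : 0 <= 16 * M / (r / 2) ^+ 2 by rewrite divr_ge0 ?mulr_ge0 ?exprn_ge0 // ltW.
have k2 : 0 <= 8 * M / (r / 2) by rewrite divr_ge0 ?mulr_ge0 // ltW.
have k3 : 0 <= 4 * M / (r / 2) by rewrite divr_ge0 ?mulr_ge0 // ltW.
move=> r' K' r'0 r'r KK z w zx wx.
have Hw : holo_bd io f w (r / 2) M.
  by apply: holo_bd_sub H _; lra.
have zw : vn (z - w) <= r / 2 / 4.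
  by have := vn_dist3 io z x0 w; rewrite [vn (x0 - w)]vn_distC; lra.
have zE : f z = f (w + (z - w)) by rewrite addrC subrK.
rewrite zE; split.
- apply: (le_trans (taylor2 r2 Hw zw)); apply: ler_wpM2r; first by rewrite exprn_ge0 ?vn_ge0.
  by apply: le_trans KK; rewrite /K; lra.
- apply: (le_trans (taylor1 r2 Hw zw)); apply: ler_wpM2r; first exact: vn_ge0.
  by apply: le_trans KK; rewrite /K; lra.
- move=> h; apply: (le_trans (derive_bound r2 Hw h)); apply: ler_wpM2r; first exact: vn_ge0.
  by apply: le_trans KK; rewrite /K; lra.
Qed.

Lemma nholo_sum (k : nat) (G : 'I_k -> V -> C) x : (forall l, nholo (G l) x) ->
  nholo (fun y => \sum_l G l y) x.
Proof.
move=> /filter_forall; apply: filterS => y dG; exact: differentiable_bigsum.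
Qed.

Lemma ord_sum (k d : nat) (G : 'I_k -> V -> C) x : (forall l, nholo (G l) x) ->
  (forall l, ord d (G l) x) -> ord d (fun y => \sum_l G l y) x.
Proof.
elim: k G => [|k IH] G hG oG.
  have -> : (fun y => \sum_(l < 0) G l y) = (fun=> 0).
    by apply/funext => z; rewrite big_ord0.
  by move=> s _; rewrite dlist0.
have := ordD io (nholo_sum (fun l => hG (widen_ord (leqnSn _) l))) (hG ord_max)
  (IH _ (fun l => hG (widen_ord (leqnSn _) l)) (fun l => oG (widen_ord (leqnSn _) l))) (oG ord_max).
by congr ord; apply/funext => y; rewrite big_ord_recr.
Qed.

(** A vector field [Y] with [Y F = c F] does not lower the order of vanishing of [F].  It
    can be replaced by its value [u] at [x], as the error involves the differences
    [Y l x - Y l y], which vanish at [x] and make up for the derivative of [F].  So ['D_u F]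
    has order [k] too, and ['D_u] commutes with the other derivatives. *)
Lemma ord_transport (F c : V -> C) (Y : 'I_n -> V -> C) x k :
  nholo F x -> nholo c x -> (forall l, nholo (Y l) x) ->
  (\forall y \near x, \sum_l Y l y * partial l F y = c y * F y) -> ord k F x ->
  forall s, (size s < k)%N -> 'D_(\row_l Y l x) (dlist s F) x = 0.
Proof.
move=> hF hc hY e; case: k => [//|k] oF s sk; set u := \row_l _.
have hP l : nholo (partial l F) x by exact: (nholo_derive io).
have hZ l : nholo (fun y => Y l x - Y l y) x.
  by apply: filterS (hY l) => y dy; apply: differentiableB.
have hG l : nholo ((fun y => Y l x - Y l y) \* partial l F) x by exact: nholoM.
have [F0 oP] := (ordS k F x).1 oF.
have oG l : ord k.+1 ((fun y => Y l x - Y l y) \* partial l F) x.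
  by apply: (ordM1 io) => //; rewrite ?subrr //; exact: oP.
have oD : ord k.+1 ('D_u F) x.
  apply: (ord_near io _ (ordD io (nholoM hc hF) (nholo_sum hG) (ordM io hc hF oF) (ord_sum hG oG))).
  have := hF; move: e; apply: filterS2 => y e dF /=; rewrite (derive_partial u dF) -e -big_split /=.
  by apply: eq_bigr => l _; rewrite mxE; ring.
by have /nbhs_singleton <- := dlist_comm io s u hF; exact: oD.
Qed.

Section Strata.
Variables (W : set V) (phi : V -> V) (F : V -> C) (Q : V -> 'M[C]_n) (c : 'I_n -> V -> C).
Hypothesis W_near : forall x, W x -> \forall y \near x, W y.
Hypothesis phiD : forall x, W x -> differentiable phi x.
Hypothesis FD : forall x, W x -> differentiable F x.
Hypothesis QD : forall x k l, W x -> differentiable (fun y => Q y k l) x.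
Hypothesis cD : forall x i, W x -> differentiable (c i) x.
Hypothesis Qu : forall x, W x -> Q x \in unitmx.
Hypothesis Qs : forall x, W x -> (Q x)^T = - Q x.
(* The Hamiltonian fields of the components of phi map F to its multiples. *)
Hypothesis XF : forall x i, W x ->
  \sum_l (('J phi x)^T *m Q x) i l * partial l F x = c i x * F x.

Let nh (f : V -> C) : (forall x, W x -> differentiable f x) -> forall x, W x -> nholo f x.
Proof. by move=> h x /W_near; apply: filterS => y; exact: h. Qed.

Lemma phi_nholo i x : W x -> nholo (fun y => phi y 0 i) x.
Proof. by apply: nh => y Wy; apply: differentiable_entry; exact: phiD. Qed.

Lemma phi_c2 x0 : W x0 -> exists r K : R, 0 < r /\ forall i r' K', 0 < r' -> r' <= r -> K <= K' ->
  c2_on (fun y => phi y 0 i) x0 r' K'.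
Proof.
move=> Wx0; apply: (@uniform_constants _ (fun i r K => c2_on (fun y => phi y 0 i) x0 r K)) => i.
by apply: c2_local; exact: phi_nholo.
Qed.

(** Along the points of order [k], a derivative [G = dlist s F] of order less than [k] is
    killed by the Hamiltonian fields of the components of [phi]; put together, these
    equations say that the Hamiltonian vector of [G] is killed by [d phi]. *)
Lemma tangent_kernel x k s : W x -> ord k F x -> (size s < k)%N ->
  ('J phi x)^T *m Q x *m (\col_l partial l (dlist s F) x) = 0.
Proof.
move=> Wx oF sk; apply/colP => i; rewrite !mxE.
pose Y l y := \sum_q partial q (fun z => phi z 0 i) y * Q y q l.
have YE l y : W y -> Y l y = (('J phi y)^T *m Q y) i l.
  move=> Wy; rewrite mxE; apply: eq_bigr => q _.
  by rewrite mxE (jacobian_entry _ _ (phiD Wy)).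
have hY l : nholo (Y l) x.
  apply: nholo_sum => q; apply: nholoM.
    by apply: (nholo_derive io); exact: phi_nholo.
  by apply: nh Wx => y Wy; exact: QD.
have hF : nholo F x by exact: nh FD x Wx.
have hc : nholo (c i) x by apply: nh Wx => y Wy; exact: cD.
have e : \forall y \near x, \sum_l Y l y * partial l F y = c i y * F y.
  apply: filterS (W_near Wx) => y Wy; rewrite -XF //.
  by apply: eq_bigr => l _; rewrite YE.
have := ord_transport hF hc hY e oF sk.
rewrite derive_partial; last by apply: nholo_diff; exact: (nholo_dlist io).
move=> H; rewrite -[RHS]H; apply: eq_bigr => l _; rewrite [in RHS]mxE YE //.
by rewrite [X in _ * X]mxE.
Qed.

(** The points of order [k] near [x0] lie in [G = 0] for a derivative [G] of order [k - 1]
    with [partial j G <> 0].  The product of the stratum with the disc is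
    parametrized by the remaining coordinates and by [t], which takes the place of
    the [j]-th one; so [sard_count] applies to [phi x + t v] once its image is seen
    to be tangent to a hyperplane at each point.  The form [lam] of [kernel_direction]
    provides the hyperplane: it kills [v], and [lam o d phi] is a multiple of [dG],
    which is quadratically small on differences of points of [G = 0]. *)
Lemma strata_local (v : V) x0 k : W x0 -> F x0 = 0 -> ord k F x0 -> ~ ord k.+1 F x0 ->
  exists2 r : R, 0 < r & nowhere_dense io
    [set y | exists x (t : C), [/\ W x, ord k F x, vn (x - x0) < r, nm t <= 1 & y = phi x + t *: v]].
Proof.
move=> Wx0 F0 oF noF.
have [s0 sk ds0] : exists2 s0, (size s0 <= k)%N & dlist s0 F x0 != 0.
  apply: contrapT => h; apply: noF => s; rewrite ltnS => sk.
  by apply: contrapT => /eqP ne; apply: h; exists s.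
have {sk} : size s0 = k.
  apply/eqP; rewrite eqn_leq sk leqNgt; apply/negP => lt.
  by move/eqP: ds0; apply; exact: oF.
(* The empty list is excluded because F x0 = 0; for the others G is the derivative
   along all the directions but the last one taken, u. *)
case: s0 ds0 => [/eqP//|u s /= du sk].
have sk' : (size s < k)%N by rewrite -sk.
set G := dlist s F in du.
have hF : nholo F x0 by exact: nh FD x0 Wx0.
have hG : nholo G x0 by exact: (nholo_dlist io).
have [j gj] : exists j, partial j G x0 != 0.
  apply: contrapT => /forallNP h; move: du; rewrite derive_partial; last exact: nholo_diff.
  rewrite big1 ?eqxx // => i _; have /negP := h i; rewrite negbK => /eqP ->.
  by rewrite mulr0.
have [r1 [K1 [r10 H1]]] := phi_c2 Wx0.
have [r2 [K2 [r20 H2]]] := c2_local hG.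
pose c0 := nm (partial j G x0) / 2; have c00 : 0 < c0 by rewrite divr_gt0 // nm_gt0.
have [r3 r30 H3] : exists2 r3 : R, 0 < r3 & forall w, vn (w - x0) < r3 -> c0 <= nm (partial j G w).
  have hp : nholo (partial j G) x0 by exact: (nholo_derive io).
  have /(continuous_vn io) /(_ c0 c00) [d d0 Hd] : {for x0, continuous (partial j G)}.
    by apply: differentiable_continuous; exact: nholo_diff.
  exists d => // w /Hd; rewrite nm_vn nm_distC => hw.
  have := nmD io (partial j G x0 - partial j G w) (partial j G w); rewrite subrK.
  have : nm (partial j G x0) = c0 + c0 by rewrite /c0 -splitr.
  by lra.
have [r4 r40 H4] : exists2 r4 : R, 0 < r4 & forall w, vn (w - x0) < r4 -> W w.
  by have /(nbhs_vn io) := W_near Wx0.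
pose K := `|K1| + `|K2| + 1.
have K0 : 0 < K by rewrite /K ltr_wpDl // addr_ge0.
have K1K : K1 <= K by rewrite /K; have := ler_norm K1; have := normr_ge0 K2; lra.
have K2K : K2 <= K by rewrite /K; have := ler_norm K2; have := normr_ge0 K1; lra.
pose r := Num.min (Num.min r1 r2) (Num.min r3 (c0 / (4 * K))).
have r0 : 0 < r by rewrite !lt_min r10 r20 r30 divr_gt0 // mulr_gt0.
have [rr1 rr2 rr3 rrK] : [/\ r <= r1, r <= r2, r <= r3 & r <= c0 / (4 * K)].
  by split; rewrite /r !ge_min lexx ?orbT.
have rK : 4 * K * r <= c0 by rewrite mulrC -ler_pdivlMr // mulr_gt0.
have P1 i := H1 i r K r0 rr1 K1K; have P2 := H2 r K r0 rr2 K2K.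
have c3 w : vn (w - x0) < r -> c0 <= nm (partial j G w).
  by move=> wr; apply: H3; exact: lt_le_trans rr3.
exists r => //; pose nR : R := n%:R; have n0 : 0 <= nR by [].
have K0w := ltW K0; have c0w := ltW c00; have r0w := ltW r0.
pose P : set (V * C) := [set p | [/\ W p.1, ord k F p.1, vn (p.1 - x0) < r & nm p.2 <= 1]].
pose psi (p : V * C) : V := phi p.1 + p.2 *: v.
pose ka (p : V * C) : V := \row_i (if i == j then p.2 else p.1 0 i).
pose L' := 2 + 2 * nR * K / c0.
have L'0 : 0 <= L'.
  by rewrite /L'; apply: addr_ge0 => //; do ?[apply: mulr_ge0 => //]; rewrite ?invr_ge0.
pose A := nR * K + nR * K / c0 * K.
have A0 : 0 <= A.
  by rewrite /A; apply: addr_ge0; do ?[apply: mulr_ge0 => //]; rewrite ?invr_ge0.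
have v0 := vn_ge0 io v.
pose L := 1 + K * L' + vn v + A * L' ^+ 2.
have Lp1 : 0 <= K * L' by rewrite mulr_ge0.
have Lp2 : 0 <= A * L' ^+ 2 by rewrite mulr_ge0 ?exprn_ge0.
have kaj z w : (ka z - ka w) 0 j = z.2 - w.2 by rewrite !mxE eqxx.
have kai z w i : i != j -> (ka z - ka w) 0 i = (z.1 - w.1) 0 i.
  by move=> ij; rewrite !mxE (negbTE ij).
have tD z w : nm (z.2 - w.2) <= vn (ka z - ka w) by rewrite -kaj vn_coord.
have flat z w : P z -> P w -> nm ('D_(z.1 - w.1) G w.1) <= K * vn (z.1 - w.1) ^+ 2.
  move=> [Wz oz zr _] [Ww ow wr _]; have [h _ _] := P2 _ _ zr wr.
  have Gz : G z.1 = 0 := oz s sk'; have Gw : G w.1 = 0 := ow s sk'.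
  by move: h; rewrite Gz Gw subrr sub0r nmN.
have Gn w : P w -> differentiable G w.1.
  move=> [Ww _ _ _]; apply: nholo_diff; apply: (nholo_dlist io); exact: nh FD _ Ww.
have pG w l : P w -> nm (partial l G w.1) <= K.
  move=> [_ _ wr _]; have [_ _ h] := P2 _ _ wr wr.
  apply: le_trans (h _) _; rewrite -[leRHS]mulr1; apply: ler_wpM2l; first exact: K0w.
  exact: vn_delta.
(* On G = 0 the j-th coordinate is a Lipschitz function of the others: the j-th
   partial derivative is at least c0 and the radius was chosen so small that the
   quadratic term is absorbed. *)
have hlip z w : P z -> P w -> vn (z.1 - w.1) <= L' * vn (ka z - ka w).
  move=> Pz Pw; set h := z.1 - w.1; set D := vn (ka z - ka w).
  have D0 : 0 <= D by exact: vn_ge0.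
  have hi i : i != j -> nm (h 0 i) <= D by move=> ij; rewrite -(kai z w i ij) vn_coord.
  have hj : vn h <= D + nm (h 0 j).
    apply/vn_leP => [|i]; first by rewrite addr_ge0 // nm_ge0.
    have [->|/hi hi'] := eqVneq i j; first by rewrite lerDr.
    by apply: le_trans hi' _; rewrite lerDl nm_ge0.
  have h2r : vn h <= 2 * r.
    case: Pz Pw => _ _ zr _ [_ _ wr _].
    by have := vn_dist3 io z.1 x0 w.1; rewrite [vn (x0 - w.1)]vn_distC -/h; lra.
  have fl := flat z w Pz Pw; rewrite -/h in fl.
  have E : h 0 j * partial j G w.1 = 'D_h G w.1 - \sum_(l | l != j) h 0 l * partial l G w.1.
    by rewrite (derive_partial h (Gn w Pw)) (bigD1 j) //= addrK.
  have S : nm (\sum_(l | l != j) h 0 l * partial l G w.1) <= nR * (D * K).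
    rewrite big_mkcond; apply: nm_sum_le => l; case: ifP => lj; last by rewrite nm0 mulr_ge0.
    by rewrite nmM; apply: ler_pM; rewrite ?nm_ge0 ?hi // pG.
  have B1 : nm (h 0 j) * c0 <= K * vn h ^+ 2 + nR * (D * K).
    apply: (@le_trans _ _ (nm (h 0 j * partial j G w.1))).
      by rewrite nmM ler_wpM2l ?nm_ge0 // c3 //; case: Pw.
    by rewrite E; apply: (le_trans (nmB _ _ _)); exact: lerD.
  have B2 : K * vn h ^+ 2 <= c0 / 2 * vn h.
    rewrite expr2 mulrA; apply: ler_wpM2r; first exact: vn_ge0.
    have : K * vn h <= K * (2 * r) by rewrite ler_wpM2l.
    by lra.
  have B3 : c0 / 2 * vn h <= c0 / 2 * (D + nm (h 0 j)) by rewrite ler_wpM2l // divr_ge0.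
  have B4 : nm (h 0 j) <= D + 2 * (nR * (D * K)) / c0.
    rewrite -(ler_pM2r c00) mulrDl divfK ?gt_eqF //.
    by move: B1 B2 B3; rewrite mulrDr; lra.
  apply: (le_trans hj); rewrite /L'.
  have -> : (2 + 2 * nR * K / c0) * D = D + (D + 2 * (nR * (D * K)) / c0) by ring.
  by rewrite lerD2l.
have phi_lip z w : P z -> P w -> vn (phi z.1 - phi w.1) <= K * vn (z.1 - w.1).
  move=> [_ _ zr _] [_ _ wr _]; apply/vn_leP => [|i]; first by rewrite mulr_ge0 ?vn_ge0.
  by rewrite !mxE; have [_ h _] := P1 i _ _ zr wr.
apply: (@nowhere_denseS _ _ _ _ _ (psi @` P)).
  by move=> _ [x [t [Wx ox xr t1 ->]]]; exists (x, t).
apply: (@sard_count _ _ io _ _ P psi ka (vn x0 + r + 1) L).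
- move=> z [_ _ zr z1]; have xz : vn z.1 <= vn x0 + r.
    have -> : z.1 = x0 + (z.1 - x0) by rewrite addrC subrK.
    by apply: (le_trans (vnD _ _ _)); rewrite lerD2l ltW.
  apply/vn_leP => [|i]; first by rewrite !addr_ge0 ?vn_ge0.
  rewrite mxE; case: ifP => _; first by rewrite (le_trans z1) // lerDr addr_ge0 ?vn_ge0.
  by apply: (le_trans (vn_coord io _ _)); apply: (le_trans xz); rewrite lerDl.
- by rewrite /L; lra.
- move=> z w Pz Pw; have -> : psi z - psi w = phi z.1 - phi w.1 + (z.2 - w.2) *: v.
    by rewrite /psi; apply/rowP => i; rewrite !mxE; ring.
  apply: (le_trans (vnD _ _ _)); rewrite vnZ.
  set D := vn (ka z - ka w); have D0 : 0 <= D by exact: vn_ge0.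
  have e1 : vn (phi z.1 - phi w.1) <= K * (L' * D).
    by apply: (le_trans (phi_lip z w Pz Pw)); rewrite ler_wpM2l ?hlip // ltW.
  have e2 : nm (z.2 - w.2) * vn v <= D * vn v by rewrite ler_wpM2r.
  have : 0 <= A * L' ^+ 2 * D by rewrite mulr_ge0.
  move=> e3; apply: (le_trans (lerD e1 e2)); rewrite /L.
  have -> : (1 + K * L' + vn v + A * L' ^+ 2) * D =
    K * (L' * D) + D * vn v + (D + A * L' ^+ 2 * D) by ring.
  by rewrite lerDl addr_ge0.
move=> w Pw; have [Ww ow wr w1] := Pw.
have g0 : \col_l partial l G w.1 != 0.
  apply/eqP => /colP /(_ j); rewrite !mxE => e; have := c3 _ wr; rewrite e nm0.
  by rewrite leNgt c00.
have two : (2 : C) != 0 by rewrite pnatr_eq0.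
have [lam0 [s1 [l0 Jl0 vl0]]] := kernel_direction v (Qu Ww) (Qs Ww) two g0 (tangent_kernel Ww ow sk').
have [cc [j0 [lj l1]]] := normalize l0.
pose lam := cc *: lam0; pose sg := cc * s1.
have Jl : 'J phi w.1 *m lam = sg *: \col_l partial l G w.1.
  by rewrite -scalemxAr Jl0 scalerA.
have Ja a : ('J phi w.1 *m lam) a 0 = sg * partial a G w.1 by rewrite Jl !mxE.
have vl : \sum_i v 0 i * lam i 0 = 0.
  have : (v *m lam) 0 0 = 0 by rewrite -scalemxAr vl0 scaler0 mxE.
  by rewrite mxE.
exists (fun i => lam i 0), j0; split => // z Pz.
set h := z.1 - w.1; have [Wz oz zr z1] := Pz.
have JE a b : 'J phi w.1 a b = partial a (fun y => phi y 0 b) w.1 by apply: jacobian_entry; exact: phiD.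
have lin : \sum_a h 0 a * ('J phi w.1 *m lam) a 0 = sg * 'D_h G w.1.
  rewrite (derive_partial h (Gn w Pw)) mulr_sumr.
  by apply: eq_bigr => a _; rewrite Ja mulrCA.
have rest : nm (\sum_i (phi z.1 - phi w.1) 0 i * lam i 0 - sg * 'D_h G w.1)
    <= nR * (K * vn h ^+ 2).
  by rewrite -lin; apply: (linear_part P1) => //; exact: phiD.
have E : \sum_i (psi z - psi w) 0 i * lam i 0 = sg * 'D_h G w.1 +
    (\sum_i (phi z.1 - phi w.1) 0 i * lam i 0 - sg * 'D_h G w.1).
  rewrite [RHS]addrC subrK; transitivity (\sum_i ((phi z.1 - phi w.1) 0 i * lam i 0 +
      (z.2 - w.2) * (v 0 i * lam i 0))).
    by apply: eq_bigr => i _; rewrite /psi !mxE; ring.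
  by rewrite big_split /= -mulr_sumr vl mulr0 addr0.
have sgB : nm sg <= nR * K / c0.
  have e : ('J phi w.1 *m lam) j 0 = sg * partial j G w.1 by rewrite Jl !mxE.
  have b : nm (('J phi w.1 *m lam) j 0) <= nR * K.
    rewrite mxE; apply: nm_sum_le => i; rewrite nmM -[leRHS]mulr1; apply: ler_pM; rewrite ?nm_ge0 //.
    rewrite JE; have [_ _ hh] := P1 i _ _ wr wr; apply: (le_trans (hh _)).
    rewrite -[leRHS]mulr1; apply: ler_wpM2l; first exact: K0w.
    exact: vn_delta.
  rewrite ler_pdivlMr //; apply: le_trans b; rewrite e nmM.
  by apply: ler_wpM2l; [exact: nm_ge0|exact: c3].
set D := vn (ka z - ka w); have D0 : 0 <= D by exact: vn_ge0.
have h2 : vn h ^+ 2 <= L' ^+ 2 * D ^+ 2.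
  by rewrite -exprMn lerXn2r ?nnegrE ?vn_ge0 ?mulr_ge0 // hlip.
rewrite E; apply: (le_trans (nmD _ _ _)).
have t1 : nm (sg * 'D_h G w.1) <= nR * K / c0 * (K * vn h ^+ 2).
  by rewrite nmM; apply: ler_pM; rewrite ?nm_ge0 // flat.
apply: (@le_trans _ _ (A * vn h ^+ 2)).
  by apply: (le_trans (lerD t1 rest)); rewrite /A le_eqVlt; apply/orP; left; apply/eqP; ring.
apply: (@le_trans _ _ (A * (L' ^+ 2 * D ^+ 2))); first by rewrite ler_wpM2l.
rewrite mulrA; apply: ler_wpM2r; first by rewrite exprn_ge0.
by rewrite /L; lra.
Qed.

End Strata.

End LocalSard.

Section SingularLocal.
Variables (R : realType) (C : numClosedFieldType) (io : complexification R C) (m : nat).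
Notation nm := (nm io).
Notation vn := (vn io).
Notation n := m.+1.
Notation V := ('rV[C]_m.+1).

(** The case of a map that is singular on an open set, where the domain is its own
    parametrization and a form [lam] with [lam o d phi = 0] gives the hyperplane. *)
Lemma singular_local (W : set V) (phi : V -> V) x0 :
  (forall x, W x -> \forall y \near x, W y) -> (forall x, W x -> differentiable phi x) ->
  (forall x, W x -> \det ('J phi x) = 0) -> W x0 ->
  exists2 r : R, 0 < r & nowhere_dense io (phi @` [set x | W x /\ vn (x - x0) < r]).
Proof.
move=> W_near phiD J0 Wx0; have [r [K1 [r0 H1]]] := phi_c2 io W_near phiD Wx0.
exists r => //; pose nR : R := n%:R; have n0 : 0 <= nR by [].
pose K := `|K1| + 1; have K0 : 0 < K by rewrite ltr_wpDl.
have K0w := ltW K0; have r0w := ltW r0.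
have K1K : K1 <= K by rewrite /K; have := ler_norm K1; lra.
have P1 i := H1 i r K r0 (lexx _) K1K.
pose L := 1 + K + nR * K; have nK : 0 <= nR * K by rewrite mulr_ge0.
apply: (@sard_count _ _ io _ _ _ phi id (vn x0 + r) L).
- move=> z [_ zr]; have -> : z = x0 + (z - x0) by rewrite addrC subrK.
  by apply: (le_trans (vnD _ _ _)); rewrite lerD2l ltW.
- by rewrite /L; lra.
- move=> z w [_ zr] [_ wr]; apply: (@le_trans _ _ (K * vn (z - w))).
    apply/vn_leP => [|i]; first by rewrite mulr_ge0 ?vn_ge0.
    by rewrite !mxE; have [_ h _] := P1 i _ _ zr wr.
  by apply: ler_wpM2r; [exact: vn_ge0|rewrite /L; lra].
move=> w [Ww wr].
have [lam0 l0 Jl0] := kernel_singular (J0 w Ww).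
have [cc [j0 [lj l1]]] := normalize io l0.
pose lam := cc *: lam0.
have Jl a : ('J phi w *m lam) a 0 = 0 by rewrite -scalemxAr Jl0 scaler0 mxE.
exists (fun i => lam i 0), j0; split => // z [Wz zr].
have lin : \sum_a (z - w) 0 a * ('J phi w *m lam) a 0 = 0.
  by rewrite big1 // => a _; rewrite Jl mulr0.
have := linear_part P1 (phiD w Ww) zr wr l1; rewrite lin subr0 => /le_trans; apply.
by rewrite mulrA; apply: ler_wpM2r; [rewrite exprn_ge0 // vn_ge0|rewrite /L; lra].
Qed.

End SingularLocal.

(** * The derivative of a determinant *)
Section DetDerive.
Variables (C : numClosedFieldType) (V : normedModType C).

Lemma near_eq_differentiable (W : normedModType C) (f g : V -> W) x :
  (\forall y \near x, f y = g y) -> differentiable f x -> differentiable g x.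
Proof.
move=> fg df; have [cd e] := (diff_locallyP x f).1 df.
have fgx : f x = g x by exact: nbhs_singleton fg.
have e' : g \o shift x = cst (g x) + 'd f x +o_ 0 id.
  apply/eqaddoP => eps eps0; have /eqaddoP /(_ eps eps0) := e.
  have : \forall h \near 0, f (h + x) = g (h + x).
    have := fg; rewrite (near_shift 0); apply: filterS => h /=.
    by rewrite /shift /= subr0.
  apply: filterS2 => h efg; rewrite !fctE /= -efg -fgx.
  by [].
have e2 := diff_unique cd e'.
by apply/diff_locallyP; rewrite e2.
Qed.

Lemma derive_bigsum (I : Type) (s : seq I) (f : I -> V -> C) x v :
  (forall i, differentiable (f i) x) ->
  'D_v (fun y => \sum_(i <- s) f i y) x = \sum_(i <- s) 'D_v (f i) x.
Proof.
move=> df; elim: s => [|a s IH].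
  have -> : (fun y => \sum_(i <- [::]) f i y) = cst 0 by apply/funext => y; rewrite big_nil.
  by rewrite derive_cst big_nil.
have -> : (fun y => \sum_(i <- a :: s) f i y) = f a \+ (fun y => \sum_(i <- s) f i y).
  by apply/funext => y; rewrite big_cons.
rewrite deriveD ?IH ?big_cons //; apply: diff_derivable => //.
exact: differentiable_bigsum.
Qed.

Lemma differentiable_bigprod (I : Type) (s : seq I) (f : I -> V -> C) x :
  (forall i, differentiable (f i) x) -> differentiable (fun y => \prod_(i <- s) f i y) x.
Proof.
move=> df; elim: s => [|a s IH].
  have -> : (fun y => \prod_(i <- [::]) f i y) = cst 1 by apply/funext => y; rewrite big_nil.
  exact: differentiable_cst.
have -> : (fun y => \prod_(i <- a :: s) f i y) = f a \* (fun y => \prod_(i <- s) f i y).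
  by apply/funext => y; rewrite big_cons.
exact: differentiableM.
Qed.

Lemma derive_prod2 (f g : V -> C) x v : differentiable f x -> differentiable g x ->
  'D_v (f \* g) x = 'D_v f x * g x + f x * 'D_v g x.
Proof.
move=> df dg; rewrite deriveM; try exact: diff_derivable.
by rewrite /GRing.scale /= addrC [g x * _]mulrC.
Qed.

Lemma derive_bigprod (I : eqType) (s : seq I) (f : I -> V -> C) x v : uniq s ->
  (forall i, differentiable (f i) x) ->
  'D_v (fun y => \prod_(i <- s) f i y) x =
  \sum_(i <- s) \prod_(j <- s) (if j == i then 'D_v (f j) x else f j x).
Proof.
move=> + df; elim: s => [_|a s IH].
  have -> : (fun y => \prod_(i <- [::]) f i y) = cst 1 by apply/funext => y; rewrite big_nil.
  by rewrite derive_cst big_nil.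
move=> /= /andP[nas us].
have -> : (fun y => \prod_(i <- a :: s) f i y) = f a \* (fun y => \prod_(i <- s) f i y).
  by apply/funext => y; rewrite big_cons.
rewrite derive_prod2 //; last exact: differentiable_bigprod.
rewrite (IH us) !big_cons eqxx mulr_sumr; congr (_ * _ + _).
  apply: eq_big_seq => j js; case: eqP => // e; by move: nas; rewrite -e js.
apply: eq_big_seq => i is_; rewrite big_cons; case: eqP => // e.
by move: nas; rewrite e is_.
Qed.

Lemma differentiable_det (k : nat) (A : V -> 'M[C]_k) x :
  (forall i j, differentiable (fun y => A y i j) x) -> differentiable (fun y => \det (A y)) x.
Proof.
move=> dA; rewrite /determinant; apply: differentiable_bigsum => s.
apply: differentiableM; first exact: differentiable_cst.
exact: differentiable_bigprod.
Qed.

(** Jacobi's formula: by Leibniz' expansion the derivative is the sum over [i] of the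
    determinants with the [i]-th row differentiated, each of which is expanded along
    that row. *)
Lemma derive_det (k : nat) (A : V -> 'M[C]_k) x v :
  (forall i j, differentiable (fun y => A y i j) x) ->
  'D_v (fun y => \det (A y)) x = \tr (\adj (A x) *m (\matrix_(i, j) 'D_v (fun y => A y i j) x)).
Proof.
move=> dA; set DA := \matrix_(i, j) _.
rewrite /determinant derive_bigsum; last first.
  move=> s; apply: differentiableM; first exact: differentiable_cst.
  exact: differentiable_bigprod.
transitivity (\sum_(s : 'S_k) (-1) ^+ s * \sum_i \prod_j (if j == i then DA j (s j) else A x j (s j))).
  apply: eq_bigr => s _; rewrite derive_prod2 //; last exact: differentiable_bigprod.
    rewrite derive_cst mul0r add0r derive_bigprod ?index_enum_uniq //.
    congr (_ * _); apply: eq_bigr => i _; apply: eq_bigr => j _.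
    by rewrite !mxE.
under eq_bigr => s _ do rewrite mulr_sumr.
rewrite exchange_big /=.
transitivity (\sum_i \sum_j DA i j * cofactor (A x) i j).
  apply: eq_bigr => i _.
  pose B := \matrix_(p, q) (if p == i then DA p q else A x p q).
  have BE p q : B p q = if p == i then DA p q else A x p q by rewrite [LHS]mxE.
  transitivity (\det B).
    rewrite /determinant; apply: eq_bigr => s _; congr (_ * _).
    by apply: eq_bigr => j _; rewrite BE.
  rewrite (expand_det_row B i); apply: eq_bigr => j _; rewrite BE eqxx; congr (_ * _).
  rewrite /cofactor; congr (_ * \det _); apply/matrixP => p q.
  by rewrite [LHS]mxE [LHS]mxE BE eq_sym (negbTE (neq_lift _ _)) [RHS]mxE [RHS]mxE.
rewrite /mxtrace; transitivity (\sum_i \sum_j cofactor (A x) j i * DA j i).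
  by rewrite exchange_big /=; apply: eq_bigr => i _; apply: eq_bigr => j _; rewrite mulrC.
by apply: eq_bigr => i _; rewrite [RHS]mxE; apply: eq_bigr => j _; rewrite [X in _ = X * _]mxE.
Qed.

End DetDerive.

(** * Poisson manifolds and Poisson morphisms in charts *)
Section PoissonChart.
Variables (R : realType) (C : numClosedFieldType) (io : complexification R C) (m : nat).
Notation n := m.+1.
Notation V := ('rV[C]_m.+1).

Section Bivector.
Variables (M : complexManifold C n) (b : bivectorField M).

Definition coord (e : chart C n M) (a : 'I_n) : M -> C := fun q => chart_map e q 0 a.
Definition bivec_mx (e : chart C n M) (y : V) : 'M[C]_n := b e (chart_inv e y).

Lemma cod_near (e : chart C n M) y : chart_cod e y -> \forall z \near y, chart_cod e z.
Proof. by move=> cy; apply: open_nbhs_nbhs; split => //; exact: chart_cod_open. Qed.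

Lemma coord_holomorphic (e : chart C n M) a : atlas e ->
  holomorphic_fun (chart_dom e) (coord e a).
Proof.
move=> ae e2 ae2 x xd; apply: (@differentiable_entry _ _ (transition e2 e)).
exact: (atlas_compat ae2 ae).
Qed.

Lemma partial_coord (e : chart C n M) k a y : chart_cod e y ->
  partial k (coord e a \o chart_inv e) y = (k == a)%:R.
Proof.
move=> cy; have e1 : \forall z \near y, (coord e a \o chart_inv e) z = (fun z : V => z 0 a) z.
  by apply: filterS (cod_near cy) => z cz; rewrite /coord /= chart_invK.
rewrite /partial (near_eq_derive _ e1) deriveE; last exact: differentiable_coord.
by rewrite diff_entry mxE eqxx /= eq_sym.
Qed.

(** The Hamiltonian field of a coordinate is a row of the bivector matrix. *)
Lemma bracket_coordl (e : chart C n M) i (H : M -> C) (U : set M) q : atlas e ->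
  chart_dom e q -> open U -> U q -> U `<=` chart_dom e -> holomorphic_fun U H ->
  bracket b (coord e i) H q = \sum_l b e q i l * partial l (H \o chart_inv e) (chart_map e q).
Proof.
move=> ae eq_ oU Uq Ue hH.
have hc : holomorphic_fun U (coord e i).
  move=> e2 ae2 x [cx Ux]; apply: (coord_holomorphic i ae ae2); split => //.
  exact: Ue.
rewrite (bracketE b ae eq_ oU Uq hc hH) /bracket_in exchange_big /=.
apply: eq_bigr => l _; rewrite (bigD1 i) //= big1 ?addr0.
  by rewrite partial_coord ?eqxx ?mulr1 //; exact: chart_map_cod.
move=> k ki; rewrite partial_coord; last exact: chart_map_cod.
by rewrite (negbTE ki) mulr0 mul0r.
Qed.

Lemma bracket_coord (e : chart C n M) i j q : atlas e -> chart_dom e q ->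
  bracket b (coord e i) (coord e j) q = b e q i j.
Proof.
move=> ae eq_; rewrite (bracket_coordl i ae eq_ (chart_dom_open e) eq_ (@subset_refl _ _)
  (coord_holomorphic j ae)).
rewrite (bigD1 j) //= partial_coord; last exact: chart_map_cod.
rewrite eqxx mulr1 big1 ?addr0 // => l lj; rewrite partial_coord; last exact: chart_map_cod.
by rewrite (negbTE lj) mulr0.
Qed.

Lemma bracket_germr (F G G' : M -> C) (U : set M) q : open U -> U q ->
  (forall q, U q -> G q = G' q) -> bracket b F G q = bracket b F G' q.
Proof.
move=> oU Uq GG; rewrite /bracket /bracket_in /chart_at; case: cid => e [ae eq_] /=.
apply: eq_bigr => k _; apply: eq_bigr => l _; congr (_ * _).
apply: near_eq_derive; have := chart_inv_near eq_ oU Uq.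
by apply: filterS => y [_ Uy] /=; exact: GG.
Qed.

Lemma bivec_mx_diff (e : chart C n M) k l y : atlas e -> chart_cod e y ->
  differentiable (fun z => bivec_mx e z k l) y.
Proof. by move=> ae; exact: bivec_hol. Qed.

Lemma bivec_mx_skew (e : chart C n M) y : atlas e -> chart_cod e y ->
  (bivec_mx e y)^T = - bivec_mx e y.
Proof. by move=> ae cy; apply: bivec_skew => //; exact: chart_inv_dom. Qed.

Lemma entry_holomorphic (e : chart C n M) j k : atlas e ->
  holomorphic_fun (chart_dom e) (fun q => b e q j k).
Proof.
move=> ae e2 ae2 x [cx dx]; have xe2 := chart_inv_dom cx.
apply: (@near_eq_differentiable _ _ _ ((fun z => bivec_mx e z j k) \o transition e2 e)).
  have := chart_inv_near xe2 (chart_dom_open e) dx; rewrite chart_invK //.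
  by apply: filterS => y [cy dy]; rewrite /bivec_mx /transition /= chart_mapK.
apply: differentiable_comp; first by apply: (atlas_compat ae2 ae).
by apply: bivec_mx_diff => //; exact: chart_map_cod.
Qed.

Lemma sing_chart (e : chart C n M) q : atlas e -> chart_dom e q ->
  ~ invertible_at b q <-> \det (b e q) = 0.
Proof.
move=> ae eq_; split=> [ni|d0 inv]; last first.
  by have := inv e ae eq_; rewrite unitmxE d0 unitr0.
apply: contrapT => /eqP d; apply: ni => e2 ae2 e2q.
rewrite unitmxE unitfE; apply/eqP => d2; move/eqP: d; apply.
by rewrite (bivec_transition b ae2 ae e2q eq_) !det_mulmx d2 mulr0 mul0r.
Qed.

End Bivector.

Section Jacobi.
Variables (M : poissonManifold C n).
Notation b := (pbivec M).
Notation P := (bivec_mx b).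

(** The Jacobi identity for three coordinate functions. *)
Lemma jacobi_chart (e : chart C n M) i j k y : atlas e -> chart_cod e y ->
  \sum_l P e y i l * partial l (fun z => P e z j k) y
  + \sum_l P e y j l * partial l (fun z => P e z k i) y
  + \sum_l P e y k l * partial l (fun z => P e z i j) y = 0.
Proof.
move=> ae cy; set q := chart_inv e y; have eq_ : chart_dom e q := chart_inv_dom cy.
have h a : holomorphic_fun (chart_dom e) (coord e a) := coord_holomorphic a ae.
have := jacobi_identity (chart_dom_open e) (h i) (h j) (h k) eq_.
have T i1 j1 k1 : bracket b (coord e i1) (bracket b (coord e j1) (coord e k1)) q =
    \sum_l P e y i1 l * partial l (fun z => P e z j1 k1) y.
  rewrite (@bracket_germr _ b _ _ (fun p => b e p j1 k1) _ _ (chart_dom_open e) eq_); last first.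
    by move=> p ep; exact: bracket_coord.
  rewrite (bracket_coordl b i1 ae eq_ (chart_dom_open e) eq_ (@subset_refl _ _)
    (entry_holomorphic b j1 k1 ae)).
  by apply: eq_bigr => l _; rewrite /q chart_invK.
by rewrite !T.
Qed.

(** Twice the divergence of the Hamiltonian field of the [i]-th coordinate. *)
Definition div_ham (e : chart C n M) (i : 'I_n) (y : V) : C :=
  2 * \sum_l partial l (fun z => P e z i l) y.

(** Write [X] for the Hamiltonian field of the [i]-th coordinate.  The Jacobi identity and
    skewness turn [X P] into [P B + B^T P], where [B] is the matrix of the derivatives
    of [X]: the bivector is invariant under [X].  By Jacobi's formula [X (\det P)] is
    [\tr (\adj P (P B + B^T P)) = 2 \tr B \det P]. *)
Lemma ham_det (e : chart C n M) i y : atlas e -> chart_cod e y ->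
  \sum_l P e y i l * partial l (fun z => \det (P e z)) y = div_ham e i y * \det (P e y).
Proof.
move=> ae cy; have dP k l : differentiable (fun z => P e z k l) y by exact: bivec_mx_diff.
have skew : forall z, chart_cod e z -> forall k l, P e z k l = - P e z l k.
  move=> z cz k l; have := bivec_mx_skew b ae cz.
  by move=> /matrixP /(_ l k); rewrite !mxE.
have dskew l k k' : partial l (fun z => P e z k k') y = - partial l (fun z => P e z k' k) y.
  rewrite /partial -deriveN; last exact: diff_derivable.
  apply: near_eq_derive; apply: filterS (cod_near cy) => z cz.
  by rewrite skew.
pose B := \matrix_(l, k) partial l (fun z => P e z i k) y.
have BE l k : B l k = partial l (fun z => P e z i k) y by rewrite [LHS]mxE.
have XP : \matrix_(j, k) (\sum_l P e y i l * partial l (fun z => P e z j k) y) =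
    P e y *m B + B^T *m P e y.
  apply/matrixP => j k; rewrite [LHS]mxE [RHS]mxE [X in _ = X + _]mxE [X in _ = _ + X]mxE.
  have := jacobi_chart i j k ae cy; rewrite -addrA => /eqP; rewrite addr_eq0 => /eqP ->.
  rewrite opprD -!sumrN; congr (_ + _); apply: eq_bigr => l _.
    by rewrite BE dskew mulrN opprK.
  by rewrite [B^T _ _]mxE BE skew // mulNr opprK mulrC.
transitivity (\sum_l P e y i l * \tr (\adj (P e y) *m \matrix_(j, k) partial l (fun z => P e z j k) y)).
  by apply: eq_bigr => l _; congr (_ * _); rewrite /partial (derive_det _ dP).
transitivity (\tr (\adj (P e y) *m (P e y *m B + B^T *m P e y))).
  rewrite -XP; under eq_bigr => l _ do rewrite -mxtraceZ scalemxAr.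
  rewrite -raddf_sum /= -mulmx_sumr; congr (\tr (_ *m _)); apply/matrixP => j k.
  by rewrite summxE [RHS]mxE; apply: eq_bigr => l _; rewrite !mxE.
rewrite mulmxDr mxtraceD mulmxA mul_adj_mx [\tr (_ *m (B^T *m _))]mxtrace_mulC -mulmxA mul_mx_adj.
rewrite mul_scalar_mx mul_mx_scalar !mxtraceZ mxtrace_tr /div_ham.
have -> : \tr B = \sum_l partial l (fun z => P e z i l) y.
  by apply: eq_bigr => l _; rewrite BE.
by ring.
Qed.

Lemma detP_diff (e : chart C n M) y : atlas e -> chart_cod e y ->
  differentiable (fun z => \det (P e z)) y.
Proof. by move=> ae cy; apply: differentiable_det => i j; exact: bivec_mx_diff. Qed.

Lemma div_ham_diff (e : chart C n M) i y : atlas e -> chart_cod e y ->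
  differentiable (div_ham e i) y.
Proof.
move=> ae cy; apply: differentiableM; first exact: differentiable_cst.
apply: differentiable_bigsum => l.
have hP : nholo (fun z => P e z i l) y.
  by apply: filterS (cod_near cy) => z cz; exact: bivec_mx_diff.
exact: nholo_diff (near_derive io (delta_mx 0 l) hP).
Qed.

End Jacobi.

Section Morphism.
Variables (S M : poissonManifold C n) (phi : S -> M).
Hypothesis phiP : poisson_morphism phi.
Variables (e : chart C n S) (e' : chart C n M).
Hypotheses (ae : atlas e) (ae' : atlas e').
Notation Q := (bivec_mx (pbivec S) e).
Notation P := (bivec_mx (pbivec M) e').

(** The representative [rep] of [phi] in the charts [e] and [e'], with its domain, and the
    determinant [rep_det] that detects the degenerate points below. *)
Definition rep_dom : set V := chart_cod e `&` (phi \o chart_inv e) @^-1` chart_dom e'.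
Definition rep : V -> V := chart_map e' \o phi \o chart_inv e.
Definition rep_det (x : V) : C := \det (P (rep x)).

Lemma phi_cont : continuous phi. Proof. exact: phiP.1.1. Qed.

Lemma pre_open (U : set M) : open U -> open (phi @^-1` U).
Proof. by move=> oU; exact: ((continuousP phi).1 phi_cont). Qed.

Lemma rep_dom_near x : rep_dom x -> \forall y \near x, rep_dom y.
Proof.
move=> [cx dx]; have := chart_inv_near (chart_inv_dom cx) (pre_open (chart_dom_open e')) dx.
by rewrite chart_invK.
Qed.

Lemma rep_diff x : rep_dom x -> differentiable rep x.
Proof. by move=> px; exact: (phiP.1.2 e e' ae ae'). Qed.

Lemma rep_cod x : rep_dom x -> chart_cod e' (rep x).
Proof. by move=> [_ dx]; exact: chart_map_cod. Qed.

Lemma repK x : rep_dom x -> chart_inv e' (rep x) = phi (chart_inv e x).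
Proof. by move=> [_ dx]; rewrite /rep /= chart_mapK. Qed.

Lemma pull_holomorphic a : holomorphic_fun (phi @^-1` chart_dom e') (coord e' a \o phi).
Proof.
move=> e2 ae2 x xd; apply: (@differentiable_entry _ _ (chart_map e' \o phi \o chart_inv e2)).
exact: (phiP.1.2 e2 e' ae2 ae').
Qed.

(** The Poisson property for the pairs of coordinate functions of [e']. *)
Lemma rep_bivec x : rep_dom x -> P (rep x) = ('J rep x)^T *m Q x *m 'J rep x.
Proof.
move=> px; have [cx dx] := px; set p := chart_inv e x.
have ep : chart_dom e p := chart_inv_dom cx.
apply/matrixP => i j.
have := phiP.2 _ _ _ (chart_dom_open e') (coord_holomorphic i ae') (coord_holomorphic j ae') p dx.
rewrite bracket_coord // (bracketE (pbivec S) ae ep (pre_open (chart_dom_open e')) dx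
  (pull_holomorphic i) (pull_holomorphic j)).
rewrite /bivec_mx repK // => <-.
rewrite /bracket_in /p chart_invK // mxE exchange_big /=; apply: eq_bigr => l _.
rewrite mxE mulr_suml; apply: eq_bigr => k _.
rewrite mxE !(jacobian_entry _ _ (rep_diff px)).
by congr (_ * _); exact: mulrC.
Qed.

Lemma rep_det_diff x : rep_dom x -> differentiable rep_det x.
Proof.
move=> px; apply: (@differentiable_comp _ _ _ _ rep (fun z => \det (P z))).
  exact: rep_diff.
by apply: detP_diff => //; exact: rep_cod.
Qed.

(** The Hamiltonian field of the pulled-back coordinate projects to that of the
    coordinate, so [ham_det] can be pulled back. *)
Lemma rep_det_ham x i : rep_dom x ->
  \sum_l (('J rep x)^T *m Q x) i l * partial l rep_det x = (div_ham e' i \o rep) x * rep_det x.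
Proof.
move=> px; have cy := rep_cod px; rewrite /= -(ham_det i ae' cy).
under eq_bigr => l _ do rewrite (partial_comp l (rep_diff px) (detP_diff ae' cy)) mulr_sumr.
rewrite exchange_big /=; apply: eq_bigr => a _.
rewrite (rep_bivec px) [in RHS]mxE mulr_suml; apply: eq_bigr => l _.
by rewrite mulrA.
Qed.

Lemma div_ham_rep_diff x i : rep_dom x -> differentiable (div_ham e' i \o rep) x.
Proof.
move=> px; apply: differentiable_comp; first exact: rep_diff.
by apply: div_ham_diff => //; exact: rep_cod.
Qed.

Lemma rep_det_sing x : rep_dom x -> ~ invertible_at (pbivec M) (phi (chart_inv e x)) <-> rep_det x = 0.
Proof. by move=> px; rewrite /rep_det /bivec_mx repK //; apply: sing_chart => //; exact: px.2. Qed.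

(** By [rep_bivec] the determinant is [(\det J)^2 \det Q]. *)
Lemma rep_det_singular x : rep_dom x -> Q x \in unitmx -> rep_det x = 0 -> \det ('J rep x) = 0.
Proof.
move=> px Qu; rewrite /rep_det rep_bivec // !det_mulmx det_tr => /eqP.
rewrite unitmxE unitfE in Qu; rewrite !mulf_eq0 (negbTE Qu) orbF orbb.
by move=> /eqP.
Qed.

End Morphism.
End PoissonChart.

(** * Symplectic resolutions *)
Section Main.
Variables (R : realType) (C : numClosedFieldType) (io : complexification R C) (m : nat).
Notation n := m.+1.
Notation V := ('rV[C]_m.+1).
Notation nm := (nm io).
Notation vn := (vn io).

Lemma chart_map_near (T : complexManifold C n) (e : chart C n T) p (d : R) :
  chart_dom e p -> 0 < d ->
  \forall p' \near p, chart_dom e p' /\ vn (chart_map e p' - chart_map e p) < d.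
Proof.
move=> ep d0; have od : nbhs p (chart_dom e).
  by apply: open_nbhs_nbhs; split => //; exact: chart_dom_open.
apply: filterI => //.
have := @chart_map_cont _ _ _ e; rewrite continuous_open_subspace; last exact: chart_dom_open.
move=> /(_ _ (mem_set ep)) h.
have Nd : nbhs (chart_map e p) [set y | vn (y - chart_map e p) < d].
  by apply/(nbhs_vn io); exists d.
exact: h Nd.
Qed.

Lemma ord_zero (f : V -> C) x k : (\forall y \near x, f y = 0) -> ord k f x.
Proof.
move=> f0; have f0' : \forall y \near x, (fun=> 0 : C) y = f y by apply: filterS f0 => y ->.
by apply: (ord_near io f0') => s _; rewrite dlist0.
Qed.

Lemma finite_order (f : V -> C) x : (exists k, ~ ord k f x) ->
  exists l, ord l f x /\ ~ ord l.+1 f x.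
Proof.
move=> [k]; elim: k => [|k IH] h; first by exfalso; apply: h.
by have [ok|nok] := pselect (ord k f x); [exists k|exact: IH].
Qed.

Section Resolution.
Variables (S M : poissonManifold C n) (phi : S -> M).
Hypothesis phiP : poisson_morphism phi.

Definition sing : set S := [set p | ~ invertible_at (pbivec M) (phi p)].

Lemma rep_dom_map (e : chart C n S) (e' : chart C n M) p : chart_dom e p ->
  chart_dom e' (phi p) -> rep_dom phi e e' (chart_map e p).
Proof. by move=> ep e'p; split; [exact: chart_map_cod|rewrite /= chart_mapK]. Qed.

Lemma sing_map (e : chart C n S) (e' : chart C n M) p : atlas e' -> chart_dom e p ->
  rep_dom phi e e' (chart_map e p) -> sing p <-> rep_det phi e e' (chart_map e p) = 0.
Proof. by move=> ae' ep pd; have := rep_det_sing ae' pd; rewrite chart_mapK. Qed.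

(** One pair of charts is enough to recognize an interior point, which brings the
    identity theorem to bear on a topological notion. *)
Lemma interior_sing_flat (e : chart C n S) (e' : chart C n M) x : atlas e -> atlas e' ->
  rep_dom phi e e' x -> interior sing (chart_inv e x) <->
  \forall y \near x, rep_det phi e e' y = 0.
Proof.
move=> ae ae' px; have ep := chart_inv_dom px.1; split=> [N|N].
  have [r r0 Hr] := chart_ball io ep (open_interior sing) N.
  rewrite chart_invK in Hr; last exact: px.1.
  have h : \forall y \near x, chart_cod e y /\ interior sing (chart_inv e y).
    by apply/(nbhs_vn io); exists r.
  have := rep_dom_near phiP px; move: h; apply: filterS2 => y [_ /interior_subset sy] py.
  exact/(rep_det_sing ae' py).
have [d d0 Hd] : exists2 d : R, 0 < d & forall y, vn (y - x) < d -> rep_det phi e e' y = 0 /\ rep_dom phi e e' y.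
  apply/(nbhs_vn io); apply: filterI => //; exact: rep_dom_near.
have := chart_map_near ep d0; apply: filterS => p' [ep' p'd].
rewrite chart_invK in p'd; last exact: px.1.
by have [F0 pd] := Hd _ p'd; apply/(sing_map ae' ep' pd).
Qed.

(** Near a limit point of the interior the determinant is flat at a point of the
    interior whose disc of holomorphy contains the limit point. *)
Lemma interior_sing_closed : closed (interior sing).
Proof.
rewrite closedE => p np; have [e [ae ep]] := atlas_cover p.
have [e' [ae' e'p]] := atlas_cover (phi p).
have px := rep_dom_map ep e'p; set x := chart_map e p in px.
have hF : nholo (rep_det phi e e') x.
  by apply: filterS (rep_dom_near phiP px) => y; exact: rep_det_diff.
have [r [B [r0 H]]] := holo_bd_local io hF.
have [rW rW0 HW] : exists2 r : R, 0 < r & forall y, vn (y - x) < r -> rep_dom phi e e' y.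
  by apply/(nbhs_vn io); exact: rep_dom_near.
pose d := Num.min r rW; have d0 : 0 < d by rewrite lt_min r0.
have dr : d <= r by rewrite ge_min lexx.
have dW : d <= rW by rewrite ge_min lexx orbT.
have d4 : 0 < d / 4 by rewrite divr_gt0.
have [p' [Np' [ep' p'd]]] : exists p', interior sing p' /\ (chart_dom e p' /\ vn (chart_map e p' - x) < d / 4).
  apply: contrapT => /forallNP no; apply: np.
  by apply: filterS (chart_map_near ep d4) => p' h Np'; apply: (no p').
set x' := chart_map e p' in p'd.
have px' : rep_dom phi e e' x' by apply: HW; lra.
have F0 : \forall y \near x', rep_det phi e e' y = 0.
  by apply/(interior_sing_flat ae ae' px'); rewrite /x' chart_mapK.
have Hx' : holo_bd io (rep_det phi e e') x' (3 * d / 4) B.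
  by apply: holo_bd_sub H _; lra.
have dd : 0 < 3 * d / 4 by lra.
have Z := identity_thm dd Hx' (fun k => ord_zero F0 (k := k)).
suff : interior sing (chart_inv e x) by rewrite /x chart_mapK.
apply/(interior_sing_flat ae ae' px); apply/(nbhs_vn io); exists (d / 8).
  by rewrite divr_gt0.
move=> y yx; apply: Z; have := vn_dist3 io y x x'; rewrite [vn (x - x')]vn_distC.
by lra.
Qed.

End Resolution.

Lemma image_bigcup_sub (T U : Type) (f : T -> U) (B : nat -> set T) :
  f @` (\bigcup_k B k) `<=` \bigcup_k (f @` B k).
Proof. by move=> _ [x [k _ Bx] <-]; exists k => //; exists x. Qed.

Section Resolved.
Variables (M : poissonManifold C n) (S : symplecticResolution M).
Notation phi := (@res_map _ _ _ S).
Notation phiP := (@res_poisson _ _ _ S).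

Lemma res_unit (e : chart C n (res_mfd S)) x : atlas e -> chart_cod e x ->
  bivec_mx (pbivec (res_mfd S)) e x \in unitmx.
Proof. by move=> ae cx; apply: (res_symplectic (s := S)) => //; exact: chart_inv_dom. Qed.

Lemma meagre_singular (e : chart C n (res_mfd S)) (e' : chart C n M) : atlas e -> atlas e' ->
  (forall p, sing phi p) -> meagre io (rep phi e e' @` rep_dom phi e e').
Proof.
move=> ae ae' allsing.
apply: (@meagre_local _ _ io _ (fun A => rep phi e e' @` A)).
- by move=> y [x []].
- by move=> A B AB; exact: image_subset.
- exact: image_bigcup_sub.
move=> x px; apply: (singular_local io (W := rep_dom phi e e')) => //.
- by move=> y; exact: (rep_dom_near phiP).
- by move=> y py; exact: (rep_diff phiP).
move=> y py; apply: (rep_det_singular phiP ae ae' py); first by apply: res_unit => //; exact: py.1.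
by apply/(rep_det_sing ae' py); exact: allsing.
Qed.

Lemma meagre_stratum (e : chart C n (res_mfd S)) (e' : chart C n M) (v : V) k : atlas e -> atlas e' ->
  meagre io [set y | exists x (t : C), [/\ [/\ rep_dom phi e e' x, rep_det phi e e' x = 0,
    ord k (rep_det phi e e') x & ~ ord k.+1 (rep_det phi e e') x], nm t <= 1 & y = rep phi e e' x + t *: v]].
Proof.
move=> ae ae'; pose Psi (A : set V) : set V := [set y | exists x (t : C), [/\ A x, nm t <= 1 & y = rep phi e e' x + t *: v]].
apply: (@meagre_local _ _ io _ Psi [set x | [/\ rep_dom phi e e' x, rep_det phi e e' x = 0,
    ord k (rep_det phi e e') x & ~ ord k.+1 (rep_det phi e e') x]]).
- by move=> y [x [t [[]]]].
- by move=> A B AB _ [x [t [/AB Bx t1 ->]]]; exists x, t.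
- by move=> B _ [x [t [[l _ Bx] t1 ->]]]; exists l => //; exists x, t.
move=> x [px F0 ok nok].
have [||||||||r r0 H] := @strata_local _ _ io _ (rep_dom phi e e') (rep phi e e') (rep_det phi e e')
  (bivec_mx (pbivec (res_mfd S)) e) (fun i => div_ham e' i \o rep phi e e') _ _ _ _ _ _ _ _ v x k px F0 ok nok.
- by move=> y; exact: (rep_dom_near phiP).
- by move=> y py; exact: (rep_diff phiP).
- by move=> y py; exact: (rep_det_diff phiP).
- by move=> y a b py; apply: bivec_mx_diff => //; exact: py.1.
- by move=> y i py; exact: (div_ham_rep_diff io phiP).
- by move=> y py; apply: res_unit => //; exact: py.1.
- by move=> y py; apply: bivec_mx_skew => //; exact: py.1.
- by move=> y i py; exact: (rep_det_ham phiP).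
exists r => //; apply: nowhere_denseS H => _ [y [t [[[py _ oy _] yr] t1 ->]]].
by exists y, t.
Qed.

Theorem not_connected_resolution : ~ symplectic M -> ~ connected_resolution S.
Proof.
move=> nsym con.
have [q0 nq0] : exists q0, ~ invertible_at (pbivec M) q0 by apply/existsNP.
have [p0 p0q0] := res_surj S q0.
have [e [ae cov]] := countable_atlas io p0 con.
have [e' [ae' e'q0]] := atlas_cover q0.
set y0 := chart_map e' q0; have cy0 : chart_cod e' y0 := chart_map_cod e'q0.
have reach z : chart_cod e' z -> exists k x, rep_dom phi (e k) e' x /\ rep phi (e k) e' x = z.
  move=> cz; have [p pq] := res_surj S (chart_inv e' z); have [k ekp] := cov p.
  have e'p : chart_dom e' (phi p) by rewrite pq; exact: chart_inv_dom.
  exists k, (chart_map (e k) p); split; first exact: rep_dom_map.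
  by rewrite /rep /= chart_mapK // pq chart_invK.
have [N|noN] := pselect (interior (sing phi) !=set0).
  have NT : interior (sing phi) = [set: res_mfd S].
    apply: con => //.
      by exists (interior (sing phi)); rewrite ?setTI //; exact: open_interior.
    by exists (interior (sing phi)); rewrite ?setTI //; exact: (interior_sing_closed phiP).
  have allsing p : sing phi p.
    by apply: interior_subset; rewrite NT.
  have mg : meagre io (\bigcup_k (rep phi (e k) e' @` rep_dom phi (e k) e')).
    by apply: meagre_bigcup => k; exact: meagre_singular.
  have [r r0 Hr] : exists2 r : R, 0 < r & forall z, vn (z - y0) < r -> chart_cod e' z.
    by apply/(nbhs_vn io); exact: cod_near.
  have [y [yr]] := baire mg y0 r0; apply.
  by have [k [x [px <-]]] := reach y (Hr y yr); exists k => //; exists x.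
pose f z := \det (bivec_mx (pbivec M) e' z).
have fy0 : f y0 = 0.
  by rewrite /f /bivec_mx /y0 chart_mapK //; apply/sing_chart.
have hf : nholo f y0 by apply: filterS (cod_near cy0) => z; exact: detP_diff.
have [r [B [r0 H]]] : exists r B : R, 0 < r /\ (holo_bd io f y0 r B /\ forall z, vn (z - y0) < r -> chart_cod e' z).
  have [r1 [B [r10 H1]]] := holo_bd_local io hf.
  have [r2 r20 H2] : exists2 r : R, 0 < r & forall z, vn (z - y0) < r -> chart_cod e' z.
    by apply/(nbhs_vn io); exact: cod_near.
  exists (Num.min r1 r2), B; split; first by rewrite lt_min r10.
  by split=> z; rewrite lt_min => /andP[z1 z2]; [exact: H1|exact: H2].
case: H => H Hcod.
(* If the determinant vanished identically near y0, then by continuity sing phi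
   would be a neighbourhood of p0. *)
have [v v8 fv] : exists2 v, 8 * vn v < r & f (y0 + v) != 0.
  apply: contrapT => no; apply: noN; exists p0.
  have r8 : 0 < r / 8 by rewrite divr_gt0.
  have nq := chart_map_near e'q0 r8; rewrite -p0q0 in nq.
  have : nbhs p0 (phi @^-1` [set q | chart_dom e' q /\
     vn (chart_map e' q - chart_map e' (phi p0)) < r / 8]) by exact: (phi_cont phiP).
  apply: filterS => p [e'p pd].
  apply/(sing_chart _ ae' e'p); rewrite p0q0 -/y0 in pd.
  have <- : f (chart_map e' (phi p)) = \det (pbivec M e' (phi p)).
    by rewrite /f /bivec_mx chart_mapK.
  apply/eqP; apply: contrapT => /negP ne; apply: no.
  exists (chart_map e' (phi p) - y0); last by rewrite addrC subrK.
  by rewrite mulrC -ltr_pdivlMr.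
have [rho rho0 root] := root_persist r0 H v8 fy0 fv.
have mg : meagre io (\bigcup_k \bigcup_l [set y | exists x (t : C), [/\ [/\ rep_dom phi (e k) e' x,
    rep_det phi (e k) e' x = 0, ord l (rep_det phi (e k) e') x & ~ ord l.+1 (rep_det phi (e k) e') x],
    nm t <= 1 & y = rep phi (e k) e' x + t *: v]]).
  by apply: meagre_bigcup => k; apply: meagre_bigcup => l; exact: meagre_stratum.
have d0 : 0 < Num.min rho (r / 2) by rewrite lt_min rho0 divr_gt0.
have [y [yr]] := baire mg y0 d0; apply.
move: yr; rewrite lt_min => /andP[y1 y2].
have [t [t1]] := root _ y1; rewrite (addrC y0) subrK => ft.
set z := y + t *: v in ft.
have cz : chart_cod e' z.
  apply: Hcod; apply: le_lt_trans (vn_shift io y (t *: v) y0) _.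
  have : vn (t *: v) <= vn v by rewrite vnZ -[leRHS]mul1r ler_wpM2r ?vn_ge0.
  by have := vn_ge0 io v; lra.
have [k [x [px xz]]] := reach z cz.
have Fx : rep_det phi (e k) e' x = 0 by rewrite /rep_det xz.
have [l [ol nol]] : exists l, ord l (rep_det phi (e k) e') x /\ ~ ord l.+1 (rep_det phi (e k) e') x.
  apply: finite_order; apply: contrapT => /forallNP all_ord; apply: noN.
  exists (chart_inv (e k) x); apply/(interior_sing_flat phiP (ae k) ae' px).
  have hF : nholo (rep_det phi (e k) e') x.
    by apply: filterS (rep_dom_near phiP px) => w pw; exact: (rep_det_diff phiP (ae k) ae' pw).
  have [r1 [B1 [r10 H1]]] := holo_bd_local io hF.
  apply/(nbhs_vn io); exists (r1 / 2); first by rewrite divr_gt0.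
  apply: (identity_thm r10 H1) => j; exact: contrapT (all_ord j).
(* The point y is phi x - t v with x a zero of order exactly l in the chart e k. *)
exists k => //; exists l => //; exists x, (- t); split => //.
  by rewrite nmN.
by rewrite xz /z scaleNr addrK.
Qed.

End Resolved.
End Main.

Definition complex_complexification (R : realType) : complexification R R[i].
Proof.
exists (real_complex R : {rmorphism R -> R[i]}).
- exact: lecR.
- move=> z; exists (complex.Re z), (complex.Im z); exact: complexE.
Defined.

Theorem corollary2 (R : realType) (n : nat) (M : poissonManifold R[i] n) :
  ~ symplectic M ->
  ~ exists S : symplecticResolution M, connected_resolution S.
Proof.
case: n M => [|m] M nsym [S conS].
  (* In dimension 0 every bivector is invertible. *)
  apply: nsym => p e ae ep; by rewrite unitmxE det_mx00 unitr1.
exact: (not_connected_resolution (complex_complexification R) nsym conS).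
Qed.
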